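(* Let $p\in(0,2]$, $m\in\mathbb{N}_0$ and $N\in\mathbb{N}$. Let $\mu:[0,1)\to[0,\infty)$ be continuous and let $\omega:\mathbb{D}\to\mathbb{D}$ with $\omega(0)=0$ be a Schwarz mapping of order $m$. Let $f\in H^{\infty}(\mathbb{D},\mathcal{B}(\mathcal{H}))$ be given by $f(z)=\sum_{n=0}^{\infty}A_nz^n$ in $\mathbb{D}$, where $A_0=a_0I$ with $|a_0|<1$ and $A_n\in\mathcal{B}(\mathcal{H})$ for all $n\in\mathbb{N}_0$, with $\|f\|_{H^{\infty}(\mathbb{D},\mathcal{B}(\mathcal{H}))}\le 1$. Let $\varphi=\{\varphi_n(r)\}_{n=0}^{\infty}\in\mathcal{F}$, let $R=R_N(p,m,\mu)$ be the minimal positive root of $$p\left(\frac{1-r^m}{1+r^m}\right)\varphi_0(r)-2\mu(r)\sum_{n=N}^{\infty}\varphi_n(r)=0,$$ and suppose $$p\left(\frac{1-r^m}{1+r^m}\right)\varphi_0(r)>2\mu(r)\sum_{n=N}^{\infty}\varphi_n(r)\quad\text{for } r\in[0,R).$$ Then $$\mathcal{M}_f(r):=\|f(\omega(z))\|^p\varphi_0(r)+\mu(r)\sum_{n=N}^{\infty}\|A_n\|\varphi_n(r)\le\varphi_0(r)\quad\text{for } |z|=r\le R.$$ Moreover, if $$p\left(\frac{1-r^m}{1+r^m}\right)\varphi_0(r)<2\mu(r)\sum_{n=N}^{\infty}\varphi_n(r)$$ in some interval $(R,R+\epsilon)$, $\epsilon>0$, then the number $R$ cannot be improved (i.e. it cannot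 be replaced by any larger number so that the inequality remains valid for all such $f$ and $\omega$).
   Context: $\mathbb{D}$ is the open unit disk, $\mathbb{N}_0=\{0,1,2,\dots\}$. $\mathcal{H}$ is a complex Hilbert space, $\mathcal{B}(\mathcal{H})$ the bounded linear operators with operator norm $\|\cdot\|$, $I$ the identity. $H^{\infty}(\mathbb{D},\mathcal{B}(\mathcal{H}))$ is the space of bounded holomorphic functions $\mathbb{D}\to\mathcal{B}(\mathcal{H})$ with norm $\sup_{z\in\mathbb{D}}\|f(z)\|$. A Schwarz mapping is an analytic map $\omega:\mathbb{D}\to\mathbb{D}$ with $\omega(0)=0$; it is of order $m$ if $z=0$ is a zero of $\omega$ of order $m$, i.e. $\omega^{(j)}(0)=0$ for $0\le j\le m-1$ and $\omega^{(m)}(0)\ne 0$. $\mathcal{F}$ is the set of sequences $\varphi=\{\varphi_n(r)\}_{n=0}^{\infty}$ of non-negative continuous functions on $[0,1)$ such that $\sum_{n}\varphi_n(r)$ converges locally uniformly on $[0,1)$. *)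

(* Defs.v *)
From Stdlib Require Import Reals Lra Lia FunctionalExtensionality ProofIrrelevance.
From Coquelicot Require Export Coquelicot.
Open Scope R_scope.

(** * Complex Hilbert spaces *)

Record HilbertSpace := {
  hilbert_sort :> CompleteNormedModule C_AbsRing;
  inner : hilbert_sort -> hilbert_sort -> C;
  inner_plus_l : forall x y z, inner (plus x y) z = (inner x z + inner y z)%C;
  inner_scal_l : forall (a : C) x y, inner (scal a x) y = (a * inner x y)%C;
  inner_conj : forall x y, inner y x = Cconj (inner x y);
  inner_norm : forall x, inner x x = RtoC (norm x ^ 2)
}.

(** * The normed space of bounded operators *)

Section BoundedOperators.

Variable H : NormedModule C_AbsRing.

(* Coquelicot's [is_linear] includes boundedness. *)
Record bop := Bop { bop_fun :> H -> H; bop_linear : is_linear bop_fun }.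

Lemma bop_eq (S T : bop) : (forall x, S x = T x) -> S = T.
Proof.
destruct S as [s Hs], T as [t Ht]; simpl; intros E.
assert (s = t) as -> by (apply functional_extensionality; exact E).
f_equal; apply proof_irrelevance.
Qed.

Lemma is_linear_bop_zero : is_linear (fun _ : H => zero : H).
Proof.
split.
- intros; now rewrite plus_zero_r.
- intros k x; symmetry; apply @scal_zero_r.
- exists 1; split; [lra|]; intros x; rewrite norm_zero.
  generalize (norm_ge_0 x); lra.
Qed.

Lemma is_linear_bop_id : is_linear (fun x : H => x).
Proof.
split; auto.
exists 1; split; [lra|]; intros; lra.
Qed.

Lemma plus_interchange (a b c d : H) :
  plus (plus a b) (plus c d) = plus (plus a c) (plus b d).
Proof.
rewrite <- !plus_assoc; f_equal.
rewrite !plus_assoc; f_equal; apply plus_comm.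
Qed.

Lemma is_linear_bop_plus (S T : bop) : is_linear (fun x : H => plus (S x) (T x)).
Proof.
destruct S as [s [s1 s2 [Ms [Ms0 s3]]]], T as [t [t1 t2 [Mt [Mt0 t3]]]]; simpl.
split.
- intros x y; rewrite s1, t1; apply plus_interchange.
- intros k x; rewrite s2, t2; symmetry; apply @scal_distr_l.
- exists (Ms + Mt); split; [lra|]; intros x.
  eapply Rle_trans; [apply @norm_triangle|].
  generalize (s3 x) (t3 x); lra.
Qed.

Lemma is_linear_bop_scal (a : C_AbsRing) (T : bop) : is_linear (fun x : H => scal a (T x)).
Proof.
destruct T as [t [t1 t2 [Mt [Mt0 t3]]]]; simpl.
split.
- intros x y; rewrite t1; apply @scal_distr_l.
- intros k x; rewrite t2, !(@scal_assoc C_AbsRing H); f_equal; apply Cmult_comm.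
- exists ((Cmod a + 1) * Mt); generalize (Cmod_ge_0 a); intros Ha; split; [nra|].
  intros x.
  eapply Rle_trans; [apply @norm_scal|].
  change (abs a) with (Cmod a).
  generalize (t3 x) (norm_ge_0 (t x)) (norm_ge_0 x); intros; nra.
Qed.

Definition bop_zero := Bop _ is_linear_bop_zero.
Definition bop_id := Bop _ is_linear_bop_id.
Definition bop_plus S T := Bop _ (is_linear_bop_plus S T).
Definition bop_scal a T := Bop _ (is_linear_bop_scal a T).
Definition bop_opp T := bop_scal (opp (one : C_AbsRing)) T.

Lemma bop_plus_comm S T : bop_plus S T = bop_plus T S.
Proof. apply bop_eq; intros x; apply plus_comm. Qed.

Lemma bop_plus_assoc S T U :
  bop_plus S (bop_plus T U) = bop_plus (bop_plus S T) U.
Proof. apply bop_eq; intros x; apply plus_assoc. Qed.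

Lemma bop_plus_zero_r T : bop_plus T bop_zero = T.
Proof. apply bop_eq; intros x; apply plus_zero_r. Qed.

Lemma bop_plus_opp_r T : bop_plus T (bop_opp T) = bop_zero.
Proof.
apply bop_eq; intros x; simpl.
rewrite (@scal_opp_one C_AbsRing H); exact (@plus_opp_r (NormedModule.AbelianGroup _ H) (T x)).
Qed.

Definition bop_AbelianMonoid_mixin :=
  AbelianMonoid.Mixin bop bop_plus bop_zero
    bop_plus_comm bop_plus_assoc bop_plus_zero_r.
Canonical bop_AbelianMonoid := AbelianMonoid.Pack bop bop_AbelianMonoid_mixin bop.

Definition bop_AbelianGroup_mixin :=
  AbelianGroup.Mixin bop_AbelianMonoid bop_opp bop_plus_opp_r.
Canonical bop_AbelianGroup :=
  AbelianGroup.Pack bop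
    (AbelianGroup.Class _ bop_AbelianMonoid_mixin bop_AbelianGroup_mixin) bop.

Lemma bop_scal_assoc (a b : C_AbsRing) T :
  bop_scal a (bop_scal b T) = bop_scal (mult a b) T.
Proof. apply bop_eq; intros x; apply @scal_assoc. Qed.

Lemma bop_scal_one T : bop_scal (one : C_AbsRing) T = T.
Proof. apply bop_eq; intros x; apply @scal_one. Qed.

Lemma bop_scal_distr_l (a : C_AbsRing) (S T : bop) :
  bop_scal a (plus S T) = plus (bop_scal a S) (bop_scal a T).
Proof. apply bop_eq; intros x; apply @scal_distr_l. Qed.

Lemma bop_scal_distr_r (a b : C_AbsRing) (T : bop) :
  bop_scal (plus a b) T = plus (bop_scal a T) (bop_scal b T).
Proof. apply bop_eq; intros x; apply @scal_distr_r. Qed.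

Definition bop_ModuleSpace_mixin :=
  ModuleSpace.Mixin C_AbsRing bop_AbelianGroup bop_scal
    bop_scal_assoc bop_scal_one bop_scal_distr_l bop_scal_distr_r.
Canonical bop_ModuleSpace :=
  ModuleSpace.Pack C_AbsRing bop
    (ModuleSpace.Class _ _ _ bop_ModuleSpace_mixin) bop.

(* The supremum is finite by [opnorm_lub]. *)
Definition opnorm (T : bop) : R :=
  real (Lub_Rbar (fun y => exists x : H, norm x <= 1 /\ y = norm (T x))).

Lemma opnorm_lub (T : bop) :
  is_lub_Rbar (fun y => exists x : H, norm x <= 1 /\ y = norm (T x)) (opnorm T).
Proof.
unfold opnorm.
set (E := fun y => exists x : H, norm x <= 1 /\ y = norm (T x)).
generalize (Lub_Rbar_correct E); intros L.
assert (F : is_finite (Lub_Rbar E)); [|now rewrite F].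
destruct (bop_linear T) as [_ _ [M [M0 HM]]].
destruct L as [L1 L2].
assert (U : Rbar_le (Lub_Rbar E) M).
{ apply L2; intros y [x [Hx ->]]; simpl.
  eapply Rle_trans; [apply HM|]; generalize (norm_ge_0 x); nra. }
assert (P : Rbar_le (norm (T zero)) (Lub_Rbar E)).
{ apply L1; exists zero; split; [rewrite norm_zero; lra|reflexivity]. }
destruct (Lub_Rbar E); simpl in *; now try reflexivity.
Qed.

Lemma opnorm_ge_0 (T : bop) : 0 <= opnorm T.
Proof.
destruct (opnorm_lub T) as [L _].
apply Rle_trans with (norm (T zero)); [apply norm_ge_0|].
apply L; exists zero; split; [rewrite norm_zero; lra|reflexivity].
Qed.

Lemma opnorm_bound (T : bop) (x : H) : norm (T x) <= opnorm T * norm x.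
Proof.
destruct (bop_linear T) as [_ T2 [M [M0 HM]]].
destruct (Req_dec (norm x) 0) as [E|E].
{ generalize (HM x); rewrite E; lra. }
assert (P : 0 < norm x) by (generalize (norm_ge_0 x); lra).
assert (B : norm (T (scal (RtoC (/ norm x)) x)) <= opnorm T).
{ destruct (opnorm_lub T) as [L _]; apply L; eexists; split; [|reflexivity].
  eapply Rle_trans; [apply @norm_scal|].
  change (abs (RtoC (/ norm x))) with (Cmod (RtoC (/ norm x))).
  rewrite Cmod_R, Rabs_pos_eq; [|now apply Rlt_le, Rinv_0_lt_compat].
  right; now field. }
assert (B' : norm (T x) <= norm x * norm (T (scal (RtoC (/ norm x)) x))).
{ replace (T x) with (scal (RtoC (norm x)) (T (scal (RtoC (/ norm x)) x))) at 1.
  - eapply Rle_trans; [apply @norm_scal|].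
    change (abs (RtoC (norm x))) with (Cmod (RtoC (norm x))).
    rewrite Cmod_R, Rabs_pos_eq; lra.
  - rewrite T2, scal_assoc.
    replace (mult _ _) with (one : C_AbsRing); [apply scal_one|].
    change (RtoC 1 = (RtoC (norm x) * RtoC (/ norm x))%C).
    rewrite <- RtoC_mult; f_equal; now field. }
nra.
Qed.

Lemma opnorm_le (T : bop) (M : R) :
  0 <= M -> (forall x, norm (T x) <= M * norm x) -> opnorm T <= M.
Proof.
intros M0 HM; destruct (opnorm_lub T) as [_ L].
apply (L (Finite M)); intros y [x [Hx ->]]; simpl.
eapply Rle_trans; [apply HM|]; generalize (norm_ge_0 x); nra.
Qed.

Lemma opnorm_triangle (S T : bop) : opnorm (plus S T) <= opnorm S + opnorm T.
Proof.
generalize (opnorm_ge_0 S) (opnorm_ge_0 T); intros.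
apply opnorm_le; [lra|]; intros x.
eapply Rle_trans; [apply @norm_triangle|].
generalize (opnorm_bound S x) (opnorm_bound T x); lra.
Qed.

Lemma opnorm_scal (a : C_AbsRing) (T : bop) :
  opnorm (scal a T) <= abs a * opnorm T.
Proof.
generalize (opnorm_ge_0 T) (abs_ge_0 a); intros.
apply opnorm_le; [nra|]; intros x.
eapply Rle_trans; [apply @norm_scal|].
generalize (opnorm_bound T x); nra.
Qed.

Lemma opnorm_eq_0 (T : bop) : opnorm T = 0 -> T = zero.
Proof.
intros E; apply bop_eq; intros x.
apply norm_eq_zero, Rle_antisym; [|apply norm_ge_0].
generalize (opnorm_bound T x); rewrite E; lra.
Qed.

Lemma opnorm_zero : opnorm (zero : bop_AbelianGroup) = 0.
Proof.
apply Rle_antisym; [|apply opnorm_ge_0].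
apply opnorm_le; [lra|]; intros x; simpl; rewrite norm_zero; lra.
Qed.

Lemma opnorm_opp_le (T : bop) : opnorm (opp T) <= opnorm T.
Proof.
apply opnorm_le; [apply opnorm_ge_0|]; intros x; simpl.
rewrite (@scal_opp_one C_AbsRing H), (@norm_opp C_AbsRing H); apply opnorm_bound.
Qed.

Definition bop_ball (S : bop) (eps : R) (T : bop) := opnorm (minus T S) < eps.

Lemma bop_ball_center S (eps : posreal) : bop_ball S eps S.
Proof.
unfold bop_ball; rewrite (@minus_eq_zero bop_AbelianGroup S).
eapply Rle_lt_trans; [right; exact opnorm_zero|apply cond_pos].
Qed.

Lemma bop_ball_sym S T eps : bop_ball S eps T -> bop_ball T eps S.
Proof.
unfold bop_ball; intros B; rewrite <- (@opp_minus bop_AbelianGroup).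
eapply Rle_lt_trans; [apply opnorm_opp_le|exact B].
Qed.

Lemma bop_ball_triangle S T U e1 e2 :
  bop_ball S e1 T -> bop_ball T e2 U -> bop_ball S (e1 + e2) U.
Proof.
unfold bop_ball; intros B1 B2; rewrite (@minus_trans bop_AbelianGroup T).
eapply Rle_lt_trans; [apply (opnorm_triangle (minus U T) (minus T S))|].
rewrite Rplus_comm; now apply Rplus_lt_compat.
Qed.

Definition bop_UniformSpace_mixin :=
  UniformSpace.Mixin bop bop_zero bop_ball
    bop_ball_center bop_ball_sym bop_ball_triangle.
Canonical bop_UniformSpace := UniformSpace.Pack bop bop_UniformSpace_mixin bop.

Canonical bop_NormedModuleAux :=
  NormedModuleAux.Pack C_AbsRing bop
    (NormedModuleAux.Class C_AbsRing bop
       (ModuleSpace.class _ bop_ModuleSpace) bop_UniformSpace_mixin) bop.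

Lemma bop_norm_ball (S T : bop) (eps : R) :
  opnorm (minus T S) < eps -> ball S eps T.
Proof. intros B; exact B. Qed.

Lemma bop_ball_norm (S T : bop) (eps : posreal) :
  ball S eps T -> opnorm (minus T S) < 1 * eps.
Proof. rewrite Rmult_1_l; intros B; exact B. Qed.

Definition bop_NormedModule_mixin :=
  NormedModule.Mixin C_AbsRing bop_NormedModuleAux opnorm 1
    opnorm_triangle opnorm_scal bop_norm_ball bop_ball_norm opnorm_eq_0.
Canonical bop_NormedModule :=
  NormedModule.Pack C_AbsRing bop
    (NormedModule.Class C_AbsRing bop
       (NormedModuleAux.class _ bop_NormedModuleAux) bop_NormedModule_mixin) bop.

End BoundedOperators.

Arguments bop_fun {H} _ _.
Arguments opnorm {H} _.

(** * Analytic functions on the unit disk *)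

Definition disk (z : C) : Prop := Cmod z < 1.

Definition holomorphic_on_disk {V : NormedModule C_AbsRing} (f : C -> V) : Prop :=
  forall z, disk z -> ex_derive f z.

Definition Hinfty {V : NormedModule C_AbsRing} (f : C -> V) : Prop :=
  holomorphic_on_disk f /\ exists M : R, forall z, disk z -> norm (f z) <= M.

Definition Hinfty_norm {V : NormedModule C_AbsRing} (f : C -> V) : Rbar :=
  Lub_Rbar (fun y => exists z, disk z /\ y = norm (f z)).

(* Coquelicot's total [C_derive] takes the limit of the difference quotient along
   the real direction; it is the complex derivative wherever [ex_derive] holds,
   hence everywhere on the disk when iterated on a holomorphic function. *)
Fixpoint C_derive_n (f : C -> C) (n : nat) : C -> C :=
  match n with
  | O => f
  | S k => C_derive (C_derive_n f k)
  end.

Definition schwarz_map (w : C -> C) : Prop :=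
  holomorphic_on_disk (w : C -> C_NormedModule) /\
  (forall z, disk z -> disk (w z)) /\
  w 0 = 0.

Definition schwarz_map_of_order (m : nat) (w : C -> C) : Prop :=
  schwarz_map w /\
  (forall j, (j < m)%nat -> C_derive_n w j 0 = 0) /\
  C_derive_n w m 0 <> 0.

(** * The class of weights and the Bohr sum *)

Definition unit_interval (r : R) : Prop := 0 <= r < 1.

Definition class_F (phi : nat -> R -> R) : Prop :=
  (forall n, continuous_on unit_interval (phi n)) /\
  (forall n r, unit_interval r -> 0 <= phi n r) /\
  (forall r0, unit_interval r0 -> exists delta : posreal,
     CVU_dom (fun n r => sum_n (fun k => phi k r) n)
             (fun r => unit_interval r /\ Rabs (r - r0) < delta)).

Definition tail (N : nat) (phi : nat -> R -> R) (r : R) : R :=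
  Series (fun k => phi (N + k)%nat r).

Definition is_minimal_positive_root (g : R -> R) (r : R) : Prop :=
  (0 < r < 1 /\ g r = 0) /\ forall s, 0 < s < 1 -> g s = 0 -> r <= s.

(* [Rpower 0 p = 1], since [ln 0 = 0] in the standard library; here [0 ^ p = 0]. *)
Definition rpow (x p : R) : R := if Req_dec_T x 0 then 0 else Rpower x p.

Section BohrInequality.

Variable H : HilbertSpace.

(* The series converges whenever [phi] is in [class_F] and the norms of the
   coefficients are bounded. *)
Definition bohr_sum (p : R) (N : nat) (mu : R -> R) (phi : nat -> R -> R)
    (f : C -> bop H) (A : nat -> bop H) (w : C -> C) (z : C) : R :=
  let r := Cmod z in
  rpow (norm (f (w z))) p * phi 0%nat r
    + mu r * Series (fun k => norm (A (N + k)%nat) * phi (N + k)%nat r).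

Definition bohr_inequality_upto (p : R) (m N : nat) (mu : R -> R)
    (phi : nat -> R -> R) (rho : R) : Prop :=
  forall (w : C -> C) (f : C -> bop H) (A : nat -> bop H) (a0 : C),
    schwarz_map_of_order m w ->
    Hinfty f ->
    (forall z, disk z -> is_pseries A z (f z)) ->
    A 0%nat = scal a0 (bop_id H) ->
    Cmod a0 < 1 ->
    Rbar_le (Hinfty_norm f) 1 ->
    forall z, disk z -> Cmod z <= rho ->
      bohr_sum p N mu phi f A w z <= phi 0%nat (Cmod z).

End BohrInequality.

(* Main.v *)
Require Import Defs.
From Stdlib Require Import Reals.
From Coquelicot Require Import Coquelicot.
From Stdlib Require Import Lra Lia IndefiniteDescription.
Open Scope R_scope.

(** Write a = |a0|, x = r^m and y = |f(w(z))| with |z| = r. Three sharp estimates carry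
    the inequality:
    - |w(z)| <= x, the Schwarz lemma for a zero of order m ([schwarz_map_order_bound]);
    - |f(u)| <= (a + |u|) / (1 + a |u|), an operator Schwarz-Pick bound
      ([operator_schwarz_pick]);
    - |A_n| <= 1 - a^2 for n >= 1 ([coefficient_bound]).

    Since p/2 <= 1, concavity gives y^p <= 1 - (p/2)(1 - y^2), and the first two estimates
    give 1 - y^2 >= (1 - a^2)(1 - x)/(1 + x). The hypothesis on the radius says that
    2 mu(r) times the tail of the weights is at most p (1 - x)/(1 + x) phi_0(r); multiplied
    by (1 - a^2)/2, this absorbs the tail of the Bohr sum.

    The radius is sharp because of w(z) = z^m and f(z) = (a + z)/(1 + a z) I, whose
    coefficients have norm (1 - a^2) a^(n-1) for n >= 1. At the point z = r the excess of the Bohr sum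
    over phi_0(r) is, to first order as a tends to 1, the product of 1 - a and of
    2 mu(r) (tail) - p (1 - x)/(1 + x) phi_0(r), which is positive just beyond the radius
    ([bohr_inequality_fails]).

    The estimates rest on complex analysis for functions that are only assumed to be
    differentiable at each point, and this theory is developed here from Goursat's
    theorem. Composing with the exponential turns circles about 0 into vertical segments,
    so that Goursat's theorem on rectangles makes integrals over such circles independent of
    the radius ([circle_int_const]). A circle on which the function is merely continuous
    does no harm, which is how Cauchy's formula at a point off the centre is obtained
    ([cauchy_punctured]). The puncture at 0 corresponds to the left end of the strip, so
    singularities at 0 are removed at no cost. Cauchy's formula applied to the powers h^n
    yields the maximum principle and hence the Schwarz lemma; expanding its kernel in a
    geometric series yields the Taylor expansion.

    Operator-valued functions enter only through the scalar functions
    z |-> <f(z) x, y>. The Schwarz-Pick bound passes to operators because a0 I has matrix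
    coefficients a0 <x, y> of modulus at most a on unit vectors. The coefficient bound uses
    that the block matrix with rows (a0, 0) and (A_n, a0) is a contraction
    ([toeplitz_contraction]), tested on a well chosen vector. *)

(** * Limiting arguments for moduli *)

Lemma Cmod_small_eq_0 (z : C) : (forall e, 0 < e -> Cmod z <= e) -> z = 0.
Proof.
intros B; apply Cmod_eq_0, Rle_antisym; [|apply Cmod_ge_0].
apply le_epsilon; intros e He; rewrite Rplus_0_l; now apply B.
Qed.

Lemma eq_of_Cmod_minus_small (u v : C) :
  (forall e, 0 < e -> Cmod (u - v) <= e) -> u = v.
Proof.
intros B; replace u with (v + (u - v))%C by ring.
rewrite (Cmod_small_eq_0 (u - v)%C B); ring.
Qed.

Lemma Cminus_neq_0 (z w : C) : z <> w -> (z - w)%C <> 0.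
Proof.
intros N E; apply N; replace z with (w + (z - w))%C by ring; rewrite E; ring.
Qed.

Lemma bernoulli t n : 0 <= t <= 1 -> 1 - INR n * t <= (1 - t) ^ n.
Proof.
intros Ht; induction n as [|n IH]; [simpl; lra|].
rewrite S_INR; simpl.
assert (0 <= INR n) by apply pos_INR.
apply Rle_trans with ((1 - t) * (1 - INR n * t)); [nra|].
apply Rmult_le_compat_l; lra.
Qed.

(** Lets r tend to 1 in an estimate that loses a factor r^n. *)
Lemma le_of_mul_pow_le X Y c n : 0 <= X -> 0 <= c < 1 ->
  (forall r, c < r < 1 -> X * r ^ n <= Y) -> X <= Y.
Proof.
intros HX Hc H; apply le_epsilon; intros e He.
assert (I := pos_INR n).
assert (D0 : 0 <= X * INR n) by now apply Rmult_le_pos.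
set (t := Rmin (e / (X * INR n + 1)) ((1 - c) / 2)).
assert (D : 0 < e / (X * INR n + 1)) by (apply Rdiv_lt_0_compat; lra).
assert (t0 : 0 < t) by (apply Rmin_glb_lt; lra).
assert (t1 : t <= (1 - c) / 2) by apply Rmin_r.
assert (t2 : X * INR n * t <= e).
{ apply Rle_trans with ((X * INR n + 1) * (e / (X * INR n + 1))); [|right; field; lra].
  apply Rmult_le_compat; try lra; apply Rmin_l. }
assert (Q := bernoulli t n ltac:(lra)).
specialize (H (1 - t) ltac:(lra)).
assert (X * (1 - INR n * t) <= X * (1 - t) ^ n) by now apply Rmult_le_compat_l.
lra.
Qed.

(** * Continuity and complex differentiability *)

(** The complex plane with the balls of the modulus, the uniform structure underlying
    complex differentiation; the product structure on pairs of reals has the same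
    neighbourhoods but other balls. *)
Definition CU := AbsRing_UniformSpace C_AbsRing.

Lemma locally_CU (z : C) (P : C -> Prop) :
  @locally CU z P <-> exists d, 0 < d /\ forall y, Cmod (y - z)%C < d -> P y.
Proof.
split.
- intros [d Hd]; exists d; split; [apply cond_pos|exact Hd].
- intros [d [d0 Hd]]; exists (mkposreal d d0); exact Hd.
Qed.

Definition ccont {U : UniformSpace} (f : U -> C) (x : U) : Prop :=
  forall eps, 0 < eps -> locally x (fun y => Cmod (f y - f x)%C < eps).

Section Continuity.

Context {U : UniformSpace}.
Implicit Types (f g : U -> C) (x : U).

Lemma ccont_const (c : C) x : ccont (fun _ : U => c) x.
Proof.
intros e He; apply filter_forall; intros y.
replace (c - c)%C with (RtoC 0) by ring; now rewrite Cmod_0.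
Qed.

Lemma ccont_plus f g x : ccont f x -> ccont g x -> ccont (fun y => f y + g y)%C x.
Proof.
intros Hf Hg e He.
assert (He2 : 0 < e / 2) by lra.
generalize (filter_and _ _ (Hf _ He2) (Hg _ He2)); apply filter_imp; intros y [H1 H2].
replace (f y + g y - (f x + g x))%C with ((f y - f x) + (g y - g x))%C by ring.
eapply Rle_lt_trans; [apply Cmod_triangle|lra].
Qed.

Lemma ccont_mult f g x : ccont f x -> ccont g x -> ccont (fun y => f y * g y)%C x.
Proof.
intros Hf Hg e He.
set (A := Cmod (f x)); set (B := Cmod (g x)).
assert (A0 : 0 <= A) by apply Cmod_ge_0.
assert (B0 : 0 <= B) by apply Cmod_ge_0.
set (d := Rmin 1 (e / (A + B + 1))).
assert (D : 0 < e / (A + B + 1)) by (apply Rdiv_lt_0_compat; lra).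
assert (Hd : 0 < d) by (apply Rmin_glb_lt; lra).
assert (d1 : d <= 1) by apply Rmin_l.
assert (d2 : d * (A + B + 1) <= e).
{ apply Rle_trans with (e / (A + B + 1) * (A + B + 1)).
  - apply Rmult_le_compat_r; [lra|apply Rmin_r].
  - right; field; lra. }
generalize (filter_and _ _ (Hf _ Hd) (Hg _ Hd)); apply filter_imp; intros y [H1 H2].
replace (f y * g y - f x * g x)%C with
  ((f y - f x) * (g y - g x) + ((f y - f x) * g x + f x * (g y - g x)))%C by ring.
eapply Rle_lt_trans; [apply Cmod_triangle|].
eapply Rle_lt_trans; [apply Rplus_le_compat_l, Cmod_triangle|].
rewrite !Cmod_mult; fold A B.
generalize (Cmod_ge_0 (f y - f x)%C) (Cmod_ge_0 (g y - g x)%C); intros; nra.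
Qed.

Lemma ccont_minus f g x : ccont f x -> ccont g x -> ccont (fun y => f y - g y)%C x.
Proof.
intros Hf Hg e He.
assert (E := ccont_plus f (fun y => (- (1)) * g y)%C x Hf
  (ccont_mult _ _ _ (ccont_const _ x) Hg) e He).
revert E; apply filter_imp; intros y; simpl.
now replace (f y - g y - (f x - g x))%C with
  (f y + - (1) * g y - (f x + - (1) * g x))%C by ring.
Qed.

Lemma ccont_pow f n x : ccont f x -> ccont (fun y => f y ^ n)%C x.
Proof.
intros Hf; induction n as [|n IH]; simpl.
- apply ccont_const.
- now apply ccont_mult.
Qed.

Lemma ccont_inv f x : f x <> 0 -> ccont f x -> ccont (fun y => / f y)%C x.
Proof.
intros N Hf e He.
set (A := Cmod (f x)).
assert (A0 : 0 < A) by now apply Cmod_gt_0.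
assert (D1 : 0 < A / 2) by lra.
assert (D2 : 0 < e * (A * (A / 2))) by (repeat apply Rmult_lt_0_compat; lra).
generalize (filter_and _ _ (Hf _ D1) (Hf _ D2)); apply filter_imp; intros y [H1 H2].
assert (Y : A / 2 <= Cmod (f y)).
{ assert (T := Cmod_triangle (f y) (- (f y - f x))%C).
  replace (f y + - (f y - f x))%C with (f x) in T by ring.
  rewrite Cmod_opp in T; fold A in T; lra. }
assert (Ny : f y <> 0) by (apply Cmod_gt_0; lra).
replace (/ f y - / f x)%C with (- (f y - f x) / (f x * f y))%C
  by (field; auto).
rewrite Cmod_div by now apply Cmult_neq_0.
rewrite Cmod_opp, Cmod_mult; fold A.
apply Rmult_lt_reg_r with (A * Cmod (f y)); [apply Rmult_lt_0_compat; lra|].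
unfold Rdiv; rewrite Rmult_assoc, Rinv_l by (apply Rgt_not_eq, Rmult_lt_0_compat; lra).
rewrite Rmult_1_r.
eapply Rlt_le_trans; [exact H2|].
apply Rmult_le_compat_l; [lra|]; apply Rmult_le_compat_l; lra.
Qed.

Lemma ccont_comp (g : CU -> C) (f : U -> C) x :
  ccont g (f x) -> ccont f x -> ccont (fun y => g (f y)) x.
Proof.
intros Hg Hf e He.
destruct (proj1 (locally_CU _ _) (Hg e He)) as [d [Hd D]].
generalize (Hf d Hd); apply filter_imp; intros y; apply D.
Qed.

Lemma ccont_ext_loc f g x :
  locally x (fun y => f y = g y) -> ccont f x -> ccont g x.
Proof.
intros E Hf e He.
assert (Ex := locally_singleton _ _ E); simpl in Ex.
generalize (filter_and _ _ E (Hf e He)); apply filter_imp; intros y [H1 H2].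
now rewrite <- H1, <- Ex.
Qed.

Lemma ccont_Re f x : ccont f x -> continuous (fun y => fst (f y)) x.
Proof.
intros Hf P [d HP]; unfold filtermap.
generalize (Hf d (cond_pos d)); apply filter_imp; intros y Hy.
apply HP; change (Rabs (fst (f y) - fst (f x)) < d).
eapply Rle_lt_trans; [|exact Hy].
eapply Rle_trans; [|apply Rmax_Cmod]; apply Rmax_l.
Qed.

Lemma ccont_Im f x : ccont f x -> continuous (fun y => snd (f y)) x.
Proof.
intros Hf P [d HP]; unfold filtermap.
generalize (Hf d (cond_pos d)); apply filter_imp; intros y Hy.
apply HP; change (Rabs (snd (f y) - snd (f x)) < d).
eapply Rle_lt_trans; [|exact Hy].
eapply Rle_trans; [|apply Rmax_Cmod]; apply Rmax_r.
Qed.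

Lemma ccont_pair (u v : U -> R) x :
  continuous u x -> continuous v x -> ccont (fun y => (u y, v y)) x.
Proof.
intros Hu Hv e He.
assert (E2 : 0 < e / 2) by lra.
assert (S : 0 < sqrt 2) by (apply sqrt_lt_R0; lra).
assert (S2 : sqrt 2 < 2).
{ replace 2 with (sqrt (2 * 2)) at 2 by (rewrite sqrt_square; lra).
  apply sqrt_lt_1; lra. }
assert (Lu := proj1 (filterlim_locally _ _) Hu (mkposreal _ E2)).
assert (Lv := proj1 (filterlim_locally _ _) Hv (mkposreal _ E2)).
generalize (filter_and _ _ Lu Lv); apply filter_imp; intros y [H1 H2].
change (Rabs (u y - u x) < e / 2) in H1; change (Rabs (v y - v x) < e / 2) in H2.
eapply Rle_lt_trans; [apply Cmod_2Rmax|]; simpl.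
assert (M : Rmax (Rabs (u y + - u x)) (Rabs (v y + - v x)) < e / 2)
  by (apply Rmax_lub_lt; [exact H1|exact H2]).
assert (0 <= Rmax (Rabs (u y + - u x)) (Rabs (v y + - v x))).
{ eapply Rle_trans; [apply Rabs_pos|apply Rmax_l]. }
nra.
Qed.

End Continuity.

Lemma ccont_id (z : C) : @ccont CU (fun y => y) z.
Proof. intros e He; apply locally_CU; exists e; split; auto. Qed.

Implicit Types (f g : C -> C) (z : C).

(** Caratheodory's form of complex differentiability: the difference quotient extends
    continuously to z. The calculus rules then reduce to those for continuity, and [q z]
    fills the removable singularity of (f y - f z) / (y - z) in Cauchy's formula. *)
Definition cdiff (f : C -> C) (z : C) : Prop :=
  exists q : C -> C, @ccont CU q z /\
    @locally CU z (fun y => f y - f z = q y * (y - z))%C.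

Lemma cdiff_ccont f z : cdiff f z -> @ccont CU f z.
Proof.
intros [q [Hq E]].
apply (@ccont_ext_loc CU (fun y => f z + q y * (y - z))%C).
- revert E; apply filter_imp; intros y E; rewrite <- E; ring.
- apply (@ccont_plus CU); [apply (@ccont_const CU)|].
  apply (@ccont_mult CU); [exact Hq|].
  apply (@ccont_minus CU); [apply ccont_id|apply (@ccont_const CU)].
Qed.

Lemma cdiff_const c z : cdiff (fun _ => c) z.
Proof.
exists (fun _ => RtoC 0); split; [apply (@ccont_const CU)|].
apply filter_forall; intros y; ring.
Qed.

Lemma cdiff_id z : cdiff (fun y => y) z.
Proof.
exists (fun _ => RtoC 1); split; [apply (@ccont_const CU)|].
apply filter_forall; intros y; ring.
Qed.

Lemma cdiff_plus f g z : cdiff f z -> cdiff g z -> cdiff (fun y => f y + g y)%C z.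
Proof.
intros [p [Hp Ep]] [q [Hq Eq]].
exists (fun y => p y + q y)%C; split; [now apply (@ccont_plus CU)|].
generalize (filter_and _ _ Ep Eq); apply filter_imp; intros y [E1 E2].
replace ((p y + q y) * (y - z))%C with (p y * (y - z) + q y * (y - z))%C by ring.
rewrite <- E1, <- E2; ring.
Qed.

Lemma cdiff_mult f g z : cdiff f z -> cdiff g z -> cdiff (fun y => f y * g y)%C z.
Proof.
intros Hf Hg; assert (Cg := cdiff_ccont _ _ Hg); revert Hf Hg.
intros [p [Hp Ep]] [q [Hq Eq]].
exists (fun y => p y * g y + f z * q y)%C; split.
- apply (@ccont_plus CU); apply (@ccont_mult CU); auto; apply (@ccont_const CU).
- generalize (filter_and _ _ Ep Eq); apply filter_imp; intros y [E1 E2].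
  replace ((p y * g y + f z * q y) * (y - z))%C
    with ((p y * (y - z)) * g y + f z * (q y * (y - z)))%C by ring.
  rewrite <- E1, <- E2; ring.
Qed.

Lemma cdiff_minus f g z : cdiff f z -> cdiff g z -> cdiff (fun y => f y - g y)%C z.
Proof.
intros [p [Hp Ep]] [q [Hq Eq]].
exists (fun y => p y - q y)%C; split; [now apply (@ccont_minus CU)|].
generalize (filter_and _ _ Ep Eq); apply filter_imp; intros y [E1 E2].
replace ((p y - q y) * (y - z))%C with (p y * (y - z) - q y * (y - z))%C by ring.
rewrite <- E1, <- E2; ring.
Qed.

Lemma cdiff_pow f n z : cdiff f z -> cdiff (fun y => f y ^ n)%C z.
Proof.
intros Hf; induction n as [|n IH]; simpl.
- apply cdiff_const.
- now apply cdiff_mult.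
Qed.

Lemma ccont_neq0 f z : @ccont CU f z -> f z <> 0 -> @locally CU z (fun y => f y <> 0).
Proof.
intros Hf N.
generalize (Hf _ (proj1 (Cmod_gt_0 _) N)); apply filter_imp; intros y Hy E.
rewrite E in Hy; replace (0 - f z)%C with (- f z)%C in Hy by ring.
rewrite Cmod_opp in Hy; lra.
Qed.

Lemma cdiff_inv f z : f z <> 0 -> cdiff f z -> cdiff (fun y => / f y)%C z.
Proof.
intros N Hf; assert (Cf := cdiff_ccont _ _ Hf); revert Hf; intros [p [Hp Ep]].
exists (fun y => (- / f z) * (p y * / f y))%C; split.
- apply (@ccont_mult CU); [apply (@ccont_const CU)|].
  apply (@ccont_mult CU); [exact Hp|exact (@ccont_inv CU f z N Cf)].
- generalize (filter_and _ _ Ep (ccont_neq0 _ _ Cf N)); apply filter_imp; intros y [E1 E2].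
  replace (- / f z * (p y * / f y) * (y - z))%C
    with (- / f z * ((p y * (y - z)) * / f y))%C by ring.
  rewrite <- E1; field; auto.
Qed.

Lemma cdiff_div f g z : g z <> 0 -> cdiff f z -> cdiff g z -> cdiff (fun y => f y / g y)%C z.
Proof. intros N Hf Hg; apply cdiff_mult; [exact Hf|now apply cdiff_inv]. Qed.

Lemma cdiff_comp f g z : cdiff f (g z) -> cdiff g z -> cdiff (fun y => f (g y)) z.
Proof.
intros [p [Hp Ep]] Hg; assert (Cg := cdiff_ccont _ _ Hg); revert Hg; intros [q [Hq Eq]].
exists (fun y => p (g y) * q y)%C; split.
- apply (@ccont_mult CU); [|exact Hq].
  exact (@ccont_comp CU p g z Hp Cg).
- destruct (proj1 (locally_CU _ _) Ep) as [d [Hd D]].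
  generalize (filter_and _ _ Eq (Cg d Hd)); apply filter_imp; intros y [E1 E2].
  rewrite (D _ E2), E1; ring.
Qed.

Lemma cdiff_ext_loc f g z : @locally CU z (fun y => f y = g y) -> cdiff f z -> cdiff g z.
Proof.
intros E [p [Hp Ep]]; exists p; split; [exact Hp|].
assert (Ez := locally_singleton _ _ E); simpl in Ez.
generalize (filter_and _ _ E Ep); apply filter_imp; intros y [E1 E2].
now rewrite <- E1, <- Ez.
Qed.

(** * The complex exponential *)

Definition Cexp (u : C) : C := (exp (fst u) * cos (snd u), exp (fst u) * sin (snd u)).

Lemma Cexp_plus u v : Cexp (u + v) = (Cexp u * Cexp v)%C.
Proof.
unfold Cexp; destruct u as [a b], v as [c d]; unfold Cmult, Cplus; simpl.
rewrite exp_plus, cos_plus, sin_plus; f_equal; ring.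
Qed.

Lemma Cmod_Cexp u : Cmod (Cexp u) = exp (fst u).
Proof.
unfold Cmod, Cexp; simpl.
replace (exp (fst u) * cos (snd u) * (exp (fst u) * cos (snd u) * 1) +
  exp (fst u) * sin (snd u) * (exp (fst u) * sin (snd u) * 1))
  with (Rsqr (exp (fst u)) * (Rsqr (sin (snd u)) + Rsqr (cos (snd u)))) by (unfold Rsqr; ring).
rewrite sin2_cos2, Rmult_1_r; apply sqrt_Rsqr, Rlt_le, exp_pos.
Qed.

Lemma exp_minus_1_bound x : Rabs x <= 1 / 2 -> 0 <= exp x - 1 - x <= 2 * x ^ 2.
Proof.
intros Hx; apply Rabs_le_between in Hx.
assert (E1 := exp_ineq1_le x); assert (E2 := exp_ineq1_le (- x)).
split; [lra|].
assert (P := exp_pos x).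
assert (Q : exp x * exp (- x) = 1) by (rewrite <- exp_plus, Rplus_opp_r; apply exp_0).
assert (exp x * (1 - x) <= 1) by (rewrite <- Q; apply Rmult_le_compat_l; lra).
apply Rmult_le_reg_r with (1 - x); [lra|].
nra.
Qed.

Lemma abs_sin_le x : Rabs (sin x) <= Rabs x.
Proof.
assert (P : forall y, 0 <= y -> sin y <= y /\ - y <= sin y).
{ intros y [Hy|<-]; [|rewrite sin_0; lra].
  split; [left; now apply sin_lt_x|].
  destruct (Rle_dec y 1) as [L|L].
  - apply Rle_trans with 0; [lra|]; apply sin_ge_0; [lra|].
    generalize PI2_1; lra.
  - generalize (SIN_bound y); lra. }
apply Rabs_le; unfold Rabs; destruct (Rcase_abs x) as [N|N].
- destruct (P (- x)) as [P1 P2]; [lra|]; rewrite sin_neg in *; lra.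
- destruct (P x); lra.
Qed.

Lemma cos_minus_1_bound x : 0 <= 1 - cos x <= x ^ 2 / 2.
Proof.
split; [generalize (COS_bound x); lra|].
replace x with (2 * (x / 2)) at 1 by field.
rewrite cos_2a_sin.
assert (S := abs_sin_le (x / 2)).
apply Rsqr_le_abs_1 in S; unfold Rsqr in S; lra.
Qed.

Lemma sin_minus_id_bound x : Rabs x <= 1 -> Rabs (sin x - x) <= x ^ 2.
Proof.
intros Hx.
destruct (MVT_gen (fun t => sin t - t) 0 x (fun t => cos t - 1)) as [c [Hc E]].
- intros t _; auto_derive; auto; ring.
- intros t _; apply (continuity_pt_minus sin id); [apply continuity_sin|apply continuity_pt_id].
- rewrite sin_0 in E; replace (sin x - x - (0 - 0)) with (sin x - x) in E by ring.
  replace (sin x - x) with ((cos c - 1) * (x - 0)) by lra.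
  rewrite Rminus_0_r, Rabs_mult.
  replace (x ^ 2) with (Rabs x * Rabs x) by (rewrite <- Rabs_mult, Rabs_pos_eq; [ring|nra]).
  apply Rmult_le_compat_r; [apply Rabs_pos|].
  assert (B := cos_minus_1_bound c).
  rewrite Rabs_left1 by lra.
  assert (C : Rabs c <= Rabs x).
  { apply Rabs_le; unfold Rabs; destruct (Rcase_abs x);
    [rewrite Rmin_right, Rmax_left in Hc|rewrite Rmin_left, Rmax_right in Hc]; lra. }
  assert (c ^ 2 = Rabs c * Rabs c) by (rewrite <- Rabs_mult, Rabs_pos_eq; [ring|nra]).
  generalize (Rabs_pos c) (Rabs_pos x); nra.
Qed.

(** Any quadratic bound would do; 24 is what the componentwise estimates give. *)
Lemma Cexp_0_bound u : Cmod u <= 1 / 2 -> Cmod (Cexp u - 1 - u) <= 24 * (Cmod u * Cmod u).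
Proof.
intros Hu; set (r := Cmod u) in *.
assert (X := Rmax_Cmod u); fold r in X.
destruct u as [x y]; simpl in X.
assert (Hx : Rabs x <= r) by (eapply Rle_trans; [apply Rmax_l|exact X]).
assert (Hy : Rabs y <= r) by (eapply Rle_trans; [apply Rmax_r|exact X]).
assert (Ex := exp_minus_1_bound x ltac:(lra)).
assert (Cy := cos_minus_1_bound y).
assert (Sy := sin_minus_id_bound y ltac:(lra)).
assert (x2 : x ^ 2 <= r * r).
{ replace (x ^ 2) with (Rabs x * Rabs x) by (rewrite <- Rabs_mult, Rabs_pos_eq; [ring|nra]).
  apply Rmult_le_compat; auto; apply Rabs_pos. }
assert (y2 : y ^ 2 <= r * r).
{ replace (y ^ 2) with (Rabs y * Rabs y) by (rewrite <- Rabs_mult, Rabs_pos_eq; [ring|nra]).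
  apply Rmult_le_compat; auto; apply Rabs_pos. }
assert (S1 := abs_sin_le y).
apply Rabs_le_between in Hx; apply Rabs_le_between in Sy.
assert (r0 : 0 <= r) by apply Cmod_ge_0.
eapply Rle_trans; [apply Cmod_2Rmax|].
assert (S2 : sqrt 2 <= 2).
{ replace 2 with (sqrt (2 * 2)) at 2 by (rewrite sqrt_square; lra).
  apply sqrt_le_1; lra. }
assert (0 <= sqrt 2) by apply sqrt_pos.
assert (M : Rmax (Rabs (fst (Cexp (x, y) - 1 - (x, y))%C))
   (Rabs (snd (Cexp (x, y) - 1 - (x, y))%C)) <= 12 * (r * r)); [|].
2:{ apply Rle_trans with (2 * (12 * (r * r))); [|lra].
    apply Rmult_le_compat; auto; eapply Rle_trans; [apply Rabs_pos|apply Rmax_l]. }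
apply Rmax_lub; simpl; apply Rabs_le.
- replace (exp x * cos y + - (1) + - x) with ((exp x - 1 - x) - exp x * (1 - cos y)) by ring.
  assert (0 <= exp x <= 3) by nra.
  nra.
- replace (exp x * sin y + - 0 + - y) with ((exp x - 1) * sin y + (sin y - y)) by ring.
  assert (Rabs ((exp x - 1) * sin y) <= 2 * (r * r)).
  { rewrite Rabs_mult.
    replace (2 * (r * r)) with ((2 * r) * r) by ring.
    apply Rmult_le_compat; try apply Rabs_pos; [|lra].
    apply Rabs_le; nra. }
  apply Rabs_le_between in H0; lra.
Qed.

(** By the functional equation only the difference quotient at 0 matters. *)
Lemma cdiff_Cexp u : cdiff Cexp u.
Proof.
set (q := fun h : C => if Ceq_dec h 0 then RtoC 1 else ((Cexp h - 1) / h)%C).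
exists (fun y => Cexp u * q (y - u))%C; split.
- apply (@ccont_mult CU); [apply (@ccont_const CU)|].
  assert (Q : @ccont CU q (u - u)%C).
  { replace (u - u)%C with (RtoC 0) by ring.
    intros e He; apply locally_CU.
    exists (Rmin (1 / 2) (e / 25)); split; [apply Rmin_glb_lt; lra|]; intros y Hy.
    replace (y - 0)%C with y in Hy by ring.
    assert (Y1 := Rlt_le_trans _ _ _ Hy (Rmin_l _ _)).
    assert (Y2 := Rlt_le_trans _ _ _ Hy (Rmin_r _ _)).
    unfold q; destruct (Ceq_dec 0 0) as [_|N]; [|now elim N].
    destruct (Ceq_dec y 0) as [->|N].
    { replace (1 - 1)%C with (RtoC 0) by ring; rewrite Cmod_0; lra. }
    replace ((Cexp y - 1) / y - 1)%C with ((Cexp y - 1 - y) / y)%C by (field; auto).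
    rewrite Cmod_div by auto.
    assert (P : 0 < Cmod y) by now apply Cmod_gt_0.
    assert (B := Cexp_0_bound y ltac:(lra)).
    apply Rle_lt_trans with (24 * Cmod y); [|lra].
    apply Rmult_le_reg_r with (Cmod y); [exact P|].
    unfold Rdiv; rewrite Rmult_assoc, Rinv_l by lra; lra. }
  apply (@ccont_comp CU q (fun y => y - u)%C); [exact Q|].
  apply (@ccont_minus CU); [apply ccont_id|apply (@ccont_const CU)].
- apply filter_forall; intros y; unfold q.
  destruct (Ceq_dec (y - u) 0) as [E|N].
  + replace y with (u + (y - u))%C by ring; rewrite E.
    replace (u + 0)%C with u by ring; ring.
  + replace (Cexp y) with (Cexp u * Cexp (y - u))%C by (rewrite <- Cexp_plus; f_equal; ring).
    now field.
Qed.

(** * Integrals of complex functions on segments *)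

Definition CRInt (f : R -> C) (a b : R) : C :=
  (RInt (fun t => fst (f t)) a b, RInt (fun t => snd (f t)) a b).

Definition ccont_on (f : R -> C) (a b : R) : Prop :=
  forall t, a <= t <= b -> @ccont R_UniformSpace f t.

Lemma ex_RInt_Re (f : R -> C) a b :
  a <= b -> ccont_on f a b -> ex_RInt (fun t => fst (f t)) a b.
Proof.
intros L Hf; apply (@ex_RInt_continuous R_CompleteNormedModule).
rewrite Rmin_left, Rmax_right by lra; intros t Ht.
now apply (@ccont_Re R_UniformSpace), Hf.
Qed.

Lemma ex_RInt_Im (f : R -> C) a b :
  a <= b -> ccont_on f a b -> ex_RInt (fun t => snd (f t)) a b.
Proof.
intros L Hf; apply (@ex_RInt_continuous R_CompleteNormedModule).
rewrite Rmin_left, Rmax_right by lra; intros t Ht.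
now apply (@ccont_Im R_UniformSpace), Hf.
Qed.

Lemma CRInt_ext (f g : R -> C) a b :
  a <= b -> (forall t, a < t < b -> f t = g t) -> CRInt f a b = CRInt g a b.
Proof.
intros L E; unfold CRInt; f_equal; apply RInt_ext; rewrite Rmin_left, Rmax_right by lra;
intros t Ht; now rewrite E.
Qed.

Lemma CRInt_plus (f g : R -> C) a b : a <= b -> ccont_on f a b -> ccont_on g a b ->
  CRInt (fun t => f t + g t)%C a b = (CRInt f a b + CRInt g a b)%C.
Proof.
intros L Hf Hg; unfold CRInt, Cplus; simpl; f_equal.
- apply (@RInt_plus R_CompleteNormedModule); now apply ex_RInt_Re.
- apply (@RInt_plus R_CompleteNormedModule); now apply ex_RInt_Im.
Qed.

Lemma CRInt_scal (c : C) (f : R -> C) a b : a <= b -> ccont_on f a b ->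
  CRInt (fun t => c * f t)%C a b = (c * CRInt f a b)%C.
Proof.
intros L Hf; unfold CRInt, Cmult; simpl.
assert (E1 := ex_RInt_Re f a b L Hf); assert (E2 := ex_RInt_Im f a b L Hf).
f_equal.
- rewrite (@RInt_minus R_CompleteNormedModule (fun t => fst c * fst (f t)) (fun t => snd c * snd (f t))).
  + unfold minus; simpl.
    rewrite (@RInt_scal R_CompleteNormedModule (fun t => fst (f t))) by exact E1.
    rewrite (@RInt_scal R_CompleteNormedModule (fun t => snd (f t))) by exact E2.
    reflexivity.
  + exact (@ex_RInt_scal R_NormedModule (fun t => fst (f t)) a b (fst c) E1).
  + exact (@ex_RInt_scal R_NormedModule (fun t => snd (f t)) a b (snd c) E2).
- rewrite (@RInt_plus R_CompleteNormedModule (fun t => fst c * snd (f t)) (fun t => snd c * fst (f t))).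
  + unfold plus; simpl.
    rewrite (@RInt_scal R_CompleteNormedModule (fun t => fst (f t))) by exact E1.
    rewrite (@RInt_scal R_CompleteNormedModule (fun t => snd (f t))) by exact E2.
    reflexivity.
  + exact (@ex_RInt_scal R_NormedModule (fun t => snd (f t)) a b (fst c) E2).
  + exact (@ex_RInt_scal R_NormedModule (fun t => fst (f t)) a b (snd c) E1).
Qed.

Lemma CRInt_minus (f g : R -> C) a b : a <= b -> ccont_on f a b -> ccont_on g a b ->
  CRInt (fun t => f t - g t)%C a b = (CRInt f a b - CRInt g a b)%C.
Proof.
intros L Hf Hg; unfold CRInt, Cminus, Cplus, Copp; simpl; f_equal.
- apply (@RInt_minus R_CompleteNormedModule); now apply ex_RInt_Re.
- apply (@RInt_minus R_CompleteNormedModule); now apply ex_RInt_Im.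
Qed.

Lemma CRInt_Chasles (f : R -> C) a b c : a <= b -> b <= c -> ccont_on f a c ->
  (CRInt f a b + CRInt f b c)%C = CRInt f a c.
Proof.
intros L1 L2 Hf.
assert (Hf1 : ccont_on f a b) by (intros t Ht; apply Hf; lra).
assert (Hf2 : ccont_on f b c) by (intros t Ht; apply Hf; lra).
unfold CRInt, Cplus; simpl; f_equal.
- apply (@RInt_Chasles R_CompleteNormedModule); now apply ex_RInt_Re.
- apply (@RInt_Chasles R_CompleteNormedModule); now apply ex_RInt_Im.
Qed.

(** Projecting f on the direction of its integral I gives |I|^2 = int Re(conj(I) f), a real
    integral to which monotonicity applies. *)
Lemma CRInt_bound (f : R -> C) (g : R -> R) a b : a <= b -> ccont_on f a b ->
  ex_RInt g a b -> (forall t, a < t < b -> Cmod (f t) <= g t) ->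
  Cmod (CRInt f a b) <= RInt g a b.
Proof.
intros L Hf Hg B.
set (I := CRInt f a b).
assert (Hcf : ccont_on (fun t => Cconj I * f t)%C a b).
{ intros t Ht; apply (@ccont_mult R_UniformSpace);
  [apply (@ccont_const R_UniformSpace)|now apply Hf]. }
assert (E : Cmod I ^ 2 = RInt (fun t => fst (Cconj I * f t)%C) a b).
{ change (Cmod I ^ 2 = fst (CRInt (fun t => Cconj I * f t)%C a b)).
  rewrite CRInt_scal by assumption; fold I.
  rewrite Cmult_comm, <- Cmod2_conj; reflexivity. }
destruct (Req_dec (Cmod I) 0) as [Z|N].
{ rewrite Z; apply RInt_ge_0; auto; intros t Ht.
  eapply Rle_trans; [apply Cmod_ge_0|now apply B]. }
assert (P : 0 < Cmod I) by (generalize (Cmod_ge_0 I); lra).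
apply Rmult_le_reg_l with (Cmod I); [exact P|].
replace (Cmod I * Cmod I) with (Cmod I ^ 2) by ring; rewrite E.
assert (S := @RInt_scal R_CompleteNormedModule g a b (Cmod I) Hg).
change (RInt (fun t => Cmod I * g t) a b = Cmod I * RInt g a b) in S.
rewrite <- S.
apply RInt_le; auto.
- now apply ex_RInt_Re.
- exact (@ex_RInt_scal R_NormedModule g a b (Cmod I) Hg).
- intros t Ht.
  eapply Rle_trans; [apply Rle_abs|].
  eapply Rle_trans; [eapply Rle_trans; [apply Rmax_l|apply Rmax_Cmod]|].
  rewrite Cmod_mult, Cmod_conj.
  apply Rmult_le_compat_l; [lra|now apply B].
Qed.

Lemma CRInt_bound_const (f : R -> C) (M : R) a b : a <= b -> ccont_on f a b ->
  (forall t, a < t < b -> Cmod (f t) <= M) -> Cmod (CRInt f a b) <= (b - a) * M.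
Proof.
intros L Hf B.
assert (E := @RInt_const R_CompleteNormedModule a b M).
change (RInt (fun _ => M) a b = (b - a) * M) in E; rewrite <- E.
apply CRInt_bound; auto; apply ex_RInt_const.
Qed.

Lemma CRInt_FTC (F f : R -> C) a b : a <= b -> ccont_on f a b ->
  (forall t, a <= t <= b -> is_derive (fun t => fst (F t)) t (fst (f t)) /\
     is_derive (fun t => snd (F t)) t (snd (f t))) ->
  CRInt f a b = (F b - F a)%C.
Proof.
intros L Hf HF; unfold CRInt.
replace (F b - F a)%C with (fst (F b) - fst (F a), snd (F b) - snd (F a)) by reflexivity.
f_equal; apply is_RInt_unique, (@is_RInt_derive R_CompleteNormedModule (fun t => _ (F t)));
rewrite Rmin_left, Rmax_right by lra; intros t Ht; try apply HF; auto.
- now apply (@ccont_Re R_UniformSpace), Hf.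
- now apply (@ccont_Im R_UniformSpace), Hf.
Qed.

Lemma ccont_RtoC (t : R) : @ccont R_UniformSpace RtoC t.
Proof. apply (@ccont_pair R_UniformSpace (fun t => t) (fun _ => 0)); [apply continuous_id|apply continuous_const]. Qed.

Lemma CRInt_const (c : C) a b : a <= b -> CRInt (fun _ => c) a b = ((b - a)%R * c)%C.
Proof.
intros L; unfold CRInt.
rewrite !(@RInt_const R_CompleteNormedModule); unfold scal; simpl; unfold mult; simpl.
destruct c as [x y]; unfold Cmult; simpl; f_equal; ring.
Qed.

Lemma CRInt_affine (p q : C) a b : a <= b ->
  CRInt (fun t => p + q * t)%C a b = (p * (b - a) + q * ((b * b - a * a) / 2))%C.
Proof.
intros L.
rewrite (CRInt_FTC (fun t => p * t + q * (t * t / 2))%C).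
- field.
- exact L.
- intros t _; apply (@ccont_plus R_UniformSpace); [apply (@ccont_const R_UniformSpace)|].
  apply (@ccont_mult R_UniformSpace); [apply (@ccont_const R_UniformSpace)|apply ccont_RtoC].
- intros t _; destruct p as [p1 p2], q as [q1 q2]; simpl.
  split; auto_derive; auto; field.
Qed.

(** * Goursat's theorem on rectangles *)

(** The integral of F over the boundary of [a, b] x [c, d], counterclockwise. *)
Definition rect_int (F : C -> C) (a b c d : R) : C :=
  (CRInt (fun x => F (x, c)) a b - CRInt (fun x => F (x, d)) a b
   + Ci * (CRInt (fun y => F (b, y)) c d - CRInt (fun y => F (a, y)) c d))%C.

Definition rect_ccont (F : C -> C) (a b c d : R) : Prop :=
  forall x y, a <= x <= b -> c <= y <= d -> @ccont CU F (x, y).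

Lemma ccont_horizontal (F : C -> C) x y :
  @ccont CU F (x, y) -> @ccont R_UniformSpace (fun t => F (t, y)) x.
Proof.
intros Hf; apply (@ccont_comp R_UniformSpace F (fun t => (t, y))); [exact Hf|].
apply (@ccont_pair R_UniformSpace); [apply continuous_id|apply continuous_const].
Qed.

Lemma ccont_vertical (F : C -> C) x y :
  @ccont CU F (x, y) -> @ccont R_UniformSpace (fun t => F (x, t)) y.
Proof.
intros Hf; apply (@ccont_comp R_UniformSpace F (fun t => (x, t))); [exact Hf|].
apply (@ccont_pair R_UniformSpace); [apply continuous_const|apply continuous_id].
Qed.

Lemma rect_horizontal (F : C -> C) a b c d y : rect_ccont F a b c d -> c <= y <= d ->
  ccont_on (fun x => F (x, y)) a b.
Proof. intros Hf Hy x Hx; apply ccont_horizontal; now apply Hf. Qed.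

Lemma rect_vertical (F : C -> C) a b c d x : rect_ccont F a b c d -> a <= x <= b ->
  ccont_on (fun y => F (x, y)) c d.
Proof. intros Hf Hx y Hy; apply ccont_vertical; now apply Hf. Qed.

Lemma rect_int_split (F : C -> C) a m b c n d : a <= m <= b -> c <= n <= d -> rect_ccont F a b c d ->
  rect_int F a b c d = (rect_int F a m c n + rect_int F m b c n + rect_int F a m n d + rect_int F m b n d)%C.
Proof.
intros [Hm1 Hm2] [Hn1 Hn2] Hf; unfold rect_int.
rewrite <- (CRInt_Chasles (fun x => F (x, c)) a m b) by (auto; eapply rect_horizontal; eauto; lra).
rewrite <- (CRInt_Chasles (fun x => F (x, d)) a m b) by (auto; eapply rect_horizontal; eauto; lra).
rewrite <- (CRInt_Chasles (fun y => F (a, y)) c n d) by (auto; eapply rect_vertical; eauto; lra).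
rewrite <- (CRInt_Chasles (fun y => F (b, y)) c n d) by (auto; eapply rect_vertical; eauto; lra).
ring.
Qed.

(** An affine function has a primitive, so its integral over a closed contour vanishes. *)
Lemma rect_int_affine p q a b c d : a <= b -> c <= d -> rect_int (fun z => p + q * z)%C a b c d = 0.
Proof.
intros L1 L2; unfold rect_int.
assert (EH : forall y, CRInt (fun x => p + q * (x, y))%C a b =
  ((p + q * Ci * y) * (b - a) + q * ((b * b - a * a) / 2))%C).
{ intros y; rewrite <- CRInt_affine by exact L1; apply CRInt_ext; auto; intros t _.
  replace (t, y) with (t + Ci * y)%C; [ring|].
  unfold Cplus, Cmult; simpl; f_equal; ring. }
assert (EV : forall x, CRInt (fun y => p + q * (x, y))%C c d =
  ((p + q * x) * (d - c) + q * Ci * ((d * d - c * c) / 2))%C).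
{ intros x; rewrite <- CRInt_affine by exact L2; apply CRInt_ext; auto; intros t _.
  replace (x, t) with (x + Ci * t)%C; [ring|].
  unfold Cplus, Cmult; simpl; f_equal; ring. }
rewrite !EH, !EV.
field.
Qed.

Lemma nested_intervals (u v : nat -> R) :
  (forall n, u n <= u (S n)) -> (forall n, v (S n) <= v n) -> (forall n, u n <= v n) ->
  exists x, forall n, u n <= x <= v n.
Proof.
intros Hu Hv Huv.
assert (Mu : forall n k, u n <= u (k + n)%nat).
{ intros n; induction k as [|k IH]; simpl; [lra|]; eapply Rle_trans; [exact IH|apply Hu]. }
assert (Mv : forall n k, v (k + n)%nat <= v n).
{ intros n; induction k as [|k IH]; simpl; [lra|]; eapply Rle_trans; [apply Hv|exact IH]. }
assert (C : forall n m, u n <= v m).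
{ intros n m; apply Rle_trans with (u (m + n)%nat); [apply Mu|].
  eapply Rle_trans; [apply Huv|]; rewrite Nat.add_comm; apply Mv. }
destruct (completeness (fun y => exists n, y = u n)) as [x [X1 X2]].
- exists (v 0%nat); intros y [n ->]; apply C.
- exists (u 0%nat); now exists 0%nat.
- exists x; intros n; split.
  + apply X1; now exists n.
  + apply X2; intros y [k ->]; apply C.
Qed.

Lemma dyadic_small (l e : R) : 0 < e -> exists n, l / 2 ^ n < e.
Proof.
intros He.
destruct (Rle_dec l 0) as [L|L].
{ exists 0%nat; simpl; lra. }
destruct (pow_lt_1_zero (/ 2) ltac:(rewrite Rabs_pos_eq; lra) (e / l)) as [n Hn].
{ apply Rdiv_lt_0_compat; lra. }
exists n; generalize (Hn n (le_n n)); rewrite Rabs_pos_eq by (apply pow_le; lra).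
intros B; rewrite pow_inv in B.
apply Rmult_lt_reg_r with (/ l); [apply Rinv_0_lt_compat; lra|].
replace (l / 2 ^ n * / l) with (/ 2 ^ n); [exact B|].
field; split; [lra|apply pow_nonzero; lra].
Qed.

(** A property of rectangles that passes from four quarters to the whole and holds near
    every point holds everywhere: otherwise bisection produces nested failing rectangles
    shrinking to a point. Decidability lets a function, rather than a choice, pick the
    failing quarter. *)
Section Bisection.

Variable P : R -> R -> R -> R -> Prop.
Hypothesis P_dec : forall a b c d, {P a b c d} + {~ P a b c d}.

(** The last quarter is returned untested: it is only reached when the other three satisfy P. *)
Definition bad_quarter (q : R * R * R * R) : R * R * R * R :=
  let '(a, b, c, d) := q in
  let m := (a + b) / 2 in let n := (c + d) / 2 in
  if P_dec a m c n then
    if P_dec m b c n then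
      if P_dec a m n d then (m, b, n, d) else (a, m, n, d)
    else (m, b, c, n)
  else (a, m, c, n).

Lemma rect_bisection a b c d :
  a <= b -> c <= d ->
  (forall a' b' c' d', a <= a' <= b' /\ b' <= b -> c <= c' <= d' /\ d' <= d ->
     let m := (a' + b') / 2 in let n := (c' + d') / 2 in
     P a' m c' n -> P m b' c' n -> P a' m n d' -> P m b' n d' -> P a' b' c' d') ->
  (forall x y, a <= x <= b -> c <= y <= d -> exists e, 0 < e /\
     forall a' b' c' d', a <= a' <= x /\ x <= b' <= b -> c <= c' <= y /\ y <= d' <= d ->
       b' - a' < e -> d' - c' < e -> P a' b' c' d') ->
  P a b c d.
Proof.
intros Lab Lcd Hglue Hloc.
destruct (P_dec a b c d) as [H0|H0]; [exact H0|exfalso].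
set (q := fun n => Nat.iter n bad_quarter (a, b, c, d)).
set (qa := fun n => fst (fst (fst (q n)))); set (qb := fun n => snd (fst (fst (q n)))).
set (qc := fun n => snd (fst (q n))); set (qd := fun n => snd (q n)).
assert (Q : forall n, q n = (qa n, qb n, qc n, qd n)).
{ intros n; unfold qa, qb, qc, qd; now destruct (q n) as [[[? ?] ?] ?]. }
assert (Inv : forall n, ~ P (qa n) (qb n) (qc n) (qd n) /\
  (a <= qa n <= qb n /\ qb n <= b) /\ (c <= qc n <= qd n /\ qd n <= d) /\
  qb n - qa n = (b - a) / 2 ^ n /\ qd n - qc n = (d - c) / 2 ^ n /\
  qa n <= qa (S n) /\ qb (S n) <= qb n /\ qc n <= qc (S n) /\ qd (S n) <= qd n).
{ assert (Step : forall n, ~ P (qa n) (qb n) (qc n) (qd n) ->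
    (a <= qa n <= qb n /\ qb n <= b) -> (c <= qc n <= qd n /\ qd n <= d) ->
    ~ P (qa (S n)) (qb (S n)) (qc (S n)) (qd (S n)) /\
    qb (S n) - qa (S n) = (qb n - qa n) / 2 /\ qd (S n) - qc (S n) = (qd n - qc n) / 2 /\
    qa n <= qa (S n) /\ qb (S n) <= qb n /\ qc n <= qc (S n) /\ qd (S n) <= qd n).
  { intros n N I1 I2.
    assert (E : q (S n) = bad_quarter (q n)) by reflexivity.
    rewrite (Q n) in E.
    revert N I1 I2 E; unfold bad_quarter.
    generalize (qa n) (qb n) (qc n) (qd n); intros a' b' c' d' N I1 I2.
    assert (G := Hglue a' b' c' d' I1 I2); simpl in G; revert G.
    set (m := (a' + b') / 2); set (k := (c' + d') / 2); intros G.
    assert (Hm : a' <= m <= b') by (unfold m; lra).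
    assert (Hk : c' <= k <= d') by (unfold k; lra).
    destruct (P_dec a' m c' k) as [P1|P1]; [destruct (P_dec m b' c' k) as [P2|P2];
      [destruct (P_dec a' m k d') as [P3|P3]|]|]; intros E;
      unfold qa, qb, qc, qd; rewrite E; simpl; unfold m, k in *;
      repeat split; try lra; auto. }
  induction n as [|n IH].
  - assert (S0 := Step 0%nat); unfold qa, qb, qc, qd in S0 |- *; simpl in S0 |- *.
    destruct S0 as [S1 [S2 [S3 S4]]]; auto; [lra|lra|].
    repeat split; auto; try lra; try field; apply S4.
  - destruct IH as [N [I1 [I2 [I3 [I4 _]]]]].
    destruct (Step n N I1 I2) as [S1 [S2 [S3 S4]]].
    assert (J1 : a <= qa (S n) <= qb (S n) /\ qb (S n) <= b) by lra.
    assert (J2 : c <= qc (S n) <= qd (S n) /\ qd (S n) <= d) by lra.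
    destruct (Step (S n) S1 J1 J2) as [_ [_ [_ S5]]].
    assert (P2 : 2 ^ n <> 0) by (apply pow_nonzero; lra).
    split; [exact S1|]; split; [exact J1|]; split; [exact J2|]; split; [|split; [|exact S5]].
    + rewrite S2, I3; simpl; field; auto.
    + rewrite S3, I4; simpl; field; auto. }
destruct (nested_intervals qa qb) as [x Hx]; try (intros n; apply Inv).
destruct (nested_intervals qc qd) as [y Hy]; try (intros n; apply Inv).
assert (Bx : a <= x <= b) by exact (Hx 0%nat).
assert (By : c <= y <= d) by exact (Hy 0%nat).
destruct (Hloc x y Bx By) as [e [He L]].
destruct (dyadic_small ((b - a) + (d - c)) e He) as [n Hn].
destruct (Inv n) as [N [I1 [I2 [I3 [I4 _]]]]].
specialize (Hx n); specialize (Hy n).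
assert (0 < / 2 ^ n) by (apply Rinv_0_lt_compat, pow_lt; lra).
unfold Rdiv in *.
apply N, L; try lra; nra.
Qed.

End Bisection.

Lemma rect_int_minus (F G : C -> C) a b c d : a <= b -> c <= d ->
  rect_ccont F a b c d -> rect_ccont G a b c d ->
  rect_int (fun z => F z - G z)%C a b c d = (rect_int F a b c d - rect_int G a b c d)%C.
Proof.
intros L1 L2 HF HG; unfold rect_int.
rewrite !CRInt_minus; auto; try (eapply rect_horizontal; eauto; lra);
  try (eapply rect_vertical; eauto; lra).
ring.
Qed.

Lemma rect_int_bound (F : C -> C) M a b c d : a <= b -> c <= d -> rect_ccont F a b c d ->
  (forall x y, a <= x <= b -> c <= y <= d -> Cmod (F (x, y)) <= M) ->
  Cmod (rect_int F a b c d) <= 2 * ((b - a) + (d - c)) * M.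
Proof.
intros L1 L2 HF B; unfold rect_int.
assert (H1 : Cmod (CRInt (fun x => F (x, c)) a b) <= (b - a) * M).
{ apply CRInt_bound_const; auto; [eapply rect_horizontal; eauto; lra|intros; apply B; lra]. }
assert (H2 : Cmod (CRInt (fun x => F (x, d)) a b) <= (b - a) * M).
{ apply CRInt_bound_const; auto; [eapply rect_horizontal; eauto; lra|intros; apply B; lra]. }
assert (H3 : Cmod (CRInt (fun y => F (b, y)) c d) <= (d - c) * M).
{ apply CRInt_bound_const; auto; [eapply rect_vertical; eauto; lra|intros; apply B; lra]. }
assert (H4 : Cmod (CRInt (fun y => F (a, y)) c d) <= (d - c) * M).
{ apply CRInt_bound_const; auto; [eapply rect_vertical; eauto; lra|intros; apply B; lra]. }
eapply Rle_trans; [apply Cmod_triangle|].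
rewrite Cmod_mult, Cmod_Ci.
unfold Cminus.
assert (T1 := Cmod_triangle (CRInt (fun x => F (x, c)) a b) (- CRInt (fun x => F (x, d)) a b)).
assert (T2 := Cmod_triangle (CRInt (fun y => F (b, y)) c d) (- CRInt (fun y => F (a, y)) c d)).
rewrite Cmod_opp in T1, T2; lra.
Qed.

Lemma Cmod_le_abs (x y : R) : Cmod (x, y) <= Rabs x + Rabs y.
Proof.
replace (x, y) with (x + Ci * y)%C by (unfold Cplus, Cmult; simpl; f_equal; ring).
eapply Rle_trans; [apply Cmod_triangle|].
rewrite Cmod_mult, Cmod_Ci, !Cmod_R; lra.
Qed.

(** The property propagated by bisection is |int F| <= e (half-perimeter)^2, which is
    additive over quarters since each has half the size. Near a point of differentiability
    it holds because F is affine up to an error e/2 times the distance, and affine functions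
    do not contribute. *)
Lemma goursat (F : C -> C) a b c d : a <= b -> c <= d ->
  (forall x y, a <= x <= b -> c <= y <= d -> cdiff F (x, y)) -> rect_int F a b c d = 0.
Proof.
intros Lab Lcd HF.
assert (CF : rect_ccont F a b c d) by (intros x y Hx Hy; apply cdiff_ccont; now apply HF).
set (P := fun e a b c d => Cmod (rect_int F a b c d) <= e * ((b - a) + (d - c)) ^ 2).
assert (B : forall e, 0 < e -> P e a b c d).
{ intros e He; apply rect_bisection; auto.
  - intros; apply Rle_dec.
  - intros a' b' c' d' Ha Hc m n P1 P2 P3 P4; unfold P in *.
    assert (Hm : a' <= m <= b') by (unfold m; lra).
    assert (Hn : c' <= n <= d') by (unfold n; lra).
    rewrite (rect_int_split F a' m b' c' n d'); auto;
      [|intros x y Hx Hy; apply CF; lra].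
    eapply Rle_trans; [apply Cmod_triangle|].
    eapply Rle_trans; [apply Rplus_le_compat_r, Cmod_triangle|].
    eapply Rle_trans; [apply Rplus_le_compat_r, Rplus_le_compat_r, Cmod_triangle|].
    replace (b' - m) with ((b' - a') / 2) in * by (unfold m; field).
    replace (m - a') with ((b' - a') / 2) in * by (unfold m; field).
    replace (d' - n) with ((d' - c') / 2) in * by (unfold n; field).
    replace (n - c') with ((d' - c') / 2) in * by (unfold n; field).
    lra.
  - intros x y Hx Hy.
    destruct (HF x y Hx Hy) as [q [Hq Eq]].
    assert (He2 : 0 < e / 2) by lra.
    destruct (proj1 (locally_CU _ _) (filter_and _ _ (Hq _ He2) Eq)) as [r [Hr R]].
    exists (r / 2); split; [lra|]; intros a' b' c' d' Ha Hc Lx Ly.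
    unfold P; set (L := b' - a' + (d' - c')).
    set (G := fun z => (F (x, y) - q (x, y) * (x, y) + q (x, y) * z)%C).
    (* [G] is the affine approximation of [F] at (x, y). *)
    assert (CG : rect_ccont G a' b' c' d').
    { intros s t _ _; unfold G.
      apply (@ccont_plus CU); [apply (@ccont_const CU)|].
      apply (@ccont_mult CU); [apply (@ccont_const CU)|apply ccont_id]. }
    assert (CF' : rect_ccont F a' b' c' d') by (intros s t Hs Ht; apply CF; lra).
    replace (rect_int F a' b' c' d') with (rect_int (fun z => F z - G z)%C a' b' c' d').
    2:{ rewrite rect_int_minus; [|lra|lra|exact CF'|exact CG]; unfold G; rewrite rect_int_affine by lra; ring. }
    replace (e * L ^ 2) with (2 * L * (e / 2 * L)) by field.
    apply rect_int_bound; try lra.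
    + intros s t Hs Ht; apply (@ccont_minus CU); [now apply CF'|now apply CG].
    + intros s t Hs Ht.
      assert (D : Cmod ((s, t) - (x, y))%C <= L).
      { eapply Rle_trans; [apply Cmod_le_abs|]; unfold L.
        apply Rplus_le_compat; apply Rabs_le; simpl; lra. }
      destruct (R (s, t)) as [R1 R2]; [unfold L in D; lra|].
      replace (F (s, t) - G (s, t))%C with ((q (s, t) - q (x, y)) * ((s, t) - (x, y)))%C.
      2:{ unfold G; replace (F (s, t)) with (F (x, y) + (F (s, t) - F (x, y)))%C by ring.
          rewrite R2; ring. }
      rewrite Cmod_mult; apply Rmult_le_compat; try apply Cmod_ge_0; lra. }
apply Cmod_small_eq_0; intros e He.
set (L := (b - a + (d - c)) ^ 2).
assert (L0 : 0 <= L) by apply pow2_ge_0.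
assert (B' := B (e / (L + 1)) ltac:(apply Rdiv_lt_0_compat; lra)).
unfold P in B'; fold L in B'.
eapply Rle_trans; [exact B'|].
replace e with (e / (L + 1) * (L + 1)) at 2 by (field; lra).
apply Rmult_le_compat_l; [|lra].
apply Rlt_le, Rdiv_lt_0_compat; lra.
Qed.

(** * Integrals over circles *)

(** Pointwise continuity along a compact vertical segment is uniform in the horizontal
    direction. This is a Lebesgue number argument: each point of the segment lies close to
    a tag (s0, t0) near which F oscillates little. *)
Lemma uniform_vertical (F : C -> C) s0 c d e : 0 < e ->
  (forall t, c <= t <= d -> @ccont CU F (s0, t)) ->
  exists r, 0 < r /\ forall s t, Rabs (s - s0) < r -> c <= t <= d ->
    Cmod (F (s, t) - F (s0, t)) <= e.
Proof.
intros He HF.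
assert (He2 : 0 < e / 2) by lra.
assert (D : forall t, exists r : posreal, c <= t <= d ->
  forall y, Cmod (y - (s0, t)) < r -> Cmod (F y - F (s0, t)) < e / 2).
{ intros t; destruct (Rle_dec c t) as [L1|L1]; [destruct (Rle_dec t d) as [L2|L2]|];
  try (exists (mkposreal 1 Rlt_0_1); intros; lra).
  destruct (proj1 (locally_CU _ _) (HF t (conj L1 L2) _ He2)) as [r [Hr R]].
  now exists (mkposreal r Hr). }
set (delta := fun t => proj1_sig (constructive_indefinite_description _ (D t))).
assert (Hd : forall t, c <= t <= d -> forall y, Cmod (y - (s0, t)) < delta t ->
  Cmod (F y - F (s0, t)) < e / 2).
{ intros t; unfold delta; now destruct (constructive_indefinite_description _ (D t)). }
assert (H2 : forall t, 0 < delta t / 2) by (intros t; generalize (cond_pos (delta t)); lra).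
destruct (compactness_value_1d c d (fun t => mkposreal _ (H2 t))) as [r Hr].
exists r; split; [apply cond_pos|]; intros s t Hs Ht.
destruct (Rle_dec (Cmod (F (s, t) - F (s0, t))) e) as [L|N]; [exact L|exfalso].
apply (Hr t Ht); intros [t0 [Ht0 [H3 H4]]]; simpl in H3, H4; apply N.
assert (A : Cmod (F (s, t) - F (s0, t0)) < e / 2).
{ apply Hd; auto; eapply Rle_lt_trans; [apply Cmod_le_abs|]; simpl.
  change (s + - s0) with (s - s0); change (t + - t0) with (t - t0); lra. }
assert (B : Cmod (F (s0, t) - F (s0, t0)) < e / 2).
{ apply Hd; auto; eapply Rle_lt_trans; [apply Cmod_le_abs|]; simpl.
  rewrite Rplus_opp_r, Rabs_R0; change (t + - t0) with (t - t0); generalize (cond_pos (delta t0)); lra. }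
replace (F (s, t) - F (s0, t))%C
  with ((F (s, t) - F (s0, t0)) + - (F (s0, t) - F (s0, t0)))%C by ring.
eapply Rle_trans; [apply Cmod_triangle|]; rewrite Cmod_opp; lra.
Qed.

Section Strip.

Variables (F : C -> C) (s1 s2 : R).
Hypothesis F_periodic : forall x, F (x, 2 * PI) = F (x, 0).
Hypothesis F_ccont : forall x y, s1 <= x <= s2 -> @ccont CU F (x, y).

Let V (s : R) : C := CRInt (fun y => F (s, y)) 0 (2 * PI).

(** The two horizontal sides of the rectangle cancel by periodicity. *)
Lemma strip_const_holomorphic a b : s1 <= a -> a <= b -> b <= s2 ->
  (forall x y, a <= x <= b -> cdiff F (x, y)) -> V a = V b.
Proof.
intros H1 H2 H3 D.
assert (P := PI_RGT_0).
assert (G := goursat F a b 0 (2 * PI) H2 ltac:(lra) (fun x y Hx _ => D x y Hx)).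
unfold rect_int in G.
rewrite (CRInt_ext (fun x => F (x, 2 * PI)) (fun x => F (x, 0))) in G by (auto; intros; apply F_periodic).
fold (V a) (V b) in G.
assert (E : (Ci * (V b - V a) = 0)%C) by (rewrite <- G; ring).
assert (N : Ci <> 0) by (intros E'; apply (f_equal snd) in E'; simpl in E'; lra).
destruct (Ceq_dec (V b) (V a)) as [Z|Z]; [now symmetry|exfalso].
apply (Cmult_neq_0 Ci (V b - V a)); auto; now apply Cminus_neq_0.
Qed.

Lemma vertical_int_cont s0 e : s1 <= s0 <= s2 -> 0 < e ->
  exists r, 0 < r /\ forall s, s1 <= s <= s2 -> Rabs (s - s0) < r -> Cmod (V s - V s0) <= e.
Proof.
intros Hs0 He; assert (P := PI_RGT_0).
destruct (uniform_vertical F s0 0 (2 * PI) (e / (2 * PI))) as [r [Hr R]].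
- apply Rdiv_lt_0_compat; lra.
- intros; now apply F_ccont.
- exists r; split; [exact Hr|]; intros s Hs1 Hs2.
  unfold V; rewrite <- CRInt_minus; try lra; try (intros t _; apply ccont_vertical; now apply F_ccont).
  replace e with ((2 * PI - 0) * (e / (2 * PI))) by (field; lra).
  apply CRInt_bound_const; [lra| |].
  + intros t _; apply (@ccont_minus R_UniformSpace); apply ccont_vertical; now apply F_ccont.
  + intros t Ht; apply R; auto; lra.
Qed.

(** On either side of the line x = s0 the vertical integral is constant by Goursat's
    theorem, and across that line it is continuous. *)
Lemma strip_const s0 : s1 <= s2 ->
  (forall x y, s1 <= x <= s2 -> x <> s0 -> cdiff F (x, y)) -> V s1 = V s2.
Proof.
intros H12 D.
destruct (Rle_dec s1 s0) as [L1|L1]; [destruct (Rle_dec s0 s2) as [L2|L2]|];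
  try (apply strip_const_holomorphic; try lra; intros; apply D; lra).
transitivity (V s0).
- destruct (Req_dec s1 s0) as [<-|N]; [reflexivity|].
  apply eq_of_Cmod_minus_small; intros e He.
  destruct (vertical_int_cont s0 e) as [r [Hr R]]; [lra|exact He|].
  set (s := Rmax s1 (s0 - r / 2)).
  assert (s1 <= s /\ s0 - r / 2 <= s) by (split; [apply Rmax_l|apply Rmax_r]).
  assert (s < s0) by (apply Rmax_lub_lt; lra).
  rewrite (strip_const_holomorphic s1 s); try lra; [|intros; apply D; lra].
  apply R; [lra|apply Rabs_lt_between; lra].
- destruct (Req_dec s2 s0) as [<-|N]; [reflexivity|].
  symmetry; apply eq_of_Cmod_minus_small; intros e He.
  destruct (vertical_int_cont s0 e) as [r [Hr R]]; [lra|exact He|].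
  set (s := Rmin s2 (s0 + r / 2)).
  assert (s <= s2 /\ s <= s0 + r / 2) by (split; [apply Rmin_l|apply Rmin_r]).
  assert (s0 < s) by (apply Rmin_glb_lt; lra).
  rewrite <- (strip_const_holomorphic s s2); try lra; [|intros; apply D; lra].
  apply R; [lra|apply Rabs_lt_between; lra].
Qed.

End Strip.

Definition circle_pt (r t : R) : C := (r * cos t, r * sin t).

Lemma circle_pt_Cexp r t : 0 < r -> circle_pt r t = Cexp (ln r, t).
Proof. intros Hr; unfold circle_pt, Cexp; simpl; now rewrite exp_ln. Qed.

Lemma Cmod_circle_pt r t : 0 <= r -> Cmod (circle_pt r t) = r.
Proof.
intros [Hr|<-].
- rewrite circle_pt_Cexp, Cmod_Cexp by exact Hr; now apply exp_ln.
- unfold circle_pt; rewrite !Rmult_0_l; apply Cmod_0.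
Qed.

Lemma circle_pt_neq0 r t : 0 < r -> circle_pt r t <> 0.
Proof. intros Hr; apply Cmod_gt_0; rewrite Cmod_circle_pt; lra. Qed.

Lemma circle_pt_mult r s t u : (circle_pt r t * circle_pt s u)%C = circle_pt (r * s) (t + u).
Proof.
unfold circle_pt, Cmult; simpl; rewrite cos_plus, sin_plus; f_equal; ring.
Qed.

Lemma circle_pt_pow r t n : (circle_pt r t ^ n)%C = circle_pt (r ^ n) (INR n * t).
Proof.
induction n as [|n IH].
- simpl; unfold circle_pt; rewrite Rmult_0_l, cos_0, sin_0, Rmult_1_l, Rmult_0_r; reflexivity.
- rewrite Cpow_S, IH, circle_pt_mult, S_INR; f_equal; ring.
Qed.

Lemma circle_pt_inv r t : 0 < r -> (/ circle_pt r t)%C = circle_pt (/ r) (- t).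
Proof.
intros Hr.
assert (E : (circle_pt r t * circle_pt (/ r) (- t))%C = 1).
{ rewrite circle_pt_mult, Rinv_r, Rplus_opp_r by lra; unfold circle_pt; rewrite cos_0, sin_0.
  unfold RtoC; f_equal; ring. }
assert (N := circle_pt_neq0 r t Hr).
replace (circle_pt (/ r) (- t)) with (/ circle_pt r t * (circle_pt r t * circle_pt (/ r) (- t)))%C by (field; auto).
rewrite E; ring.
Qed.

Lemma ccont_circle_pt r t : @ccont R_UniformSpace (circle_pt r) t.
Proof.
apply (@ccont_pair R_UniformSpace (fun t => r * cos t) (fun t => r * sin t));
apply (@ex_derive_continuous R_AbsRing R_NormedModule); auto_derive; auto.
Qed.

Definition circle_int (k : C -> C) (r : R) : C := CRInt (fun t => k (circle_pt r t)) 0 (2 * PI).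

Lemma ccont_on_circle (k : C -> C) r a b : 0 <= r ->
  (forall z, Cmod z = r -> @ccont CU k z) -> ccont_on (fun t => k (circle_pt r t)) a b.
Proof.
intros Hr Hk t _; apply (@ccont_comp R_UniformSpace k (circle_pt r)); [|apply ccont_circle_pt].
now apply Hk, Cmod_circle_pt.
Qed.

(** In the coordinate u = ln z, circles become vertical segments and holomorphic functions
    become periodic ones. The circle of radius rho is the one where only continuity is
    known. *)
Lemma circle_int_const (k : C -> C) (rho r1 r2 : R) : 0 < r1 <= r2 ->
  (forall z, r1 <= Cmod z <= r2 -> @ccont CU k z) ->
  (forall z, r1 <= Cmod z <= r2 -> Cmod z <> rho -> cdiff k z) ->
  circle_int k r1 = circle_int k r2.
Proof.
intros Hr HC HD; assert (P := PI_RGT_0).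
assert (L : ln r1 <= ln r2) by (apply ln_le; lra).
assert (X : forall x y, ln r1 <= x <= ln r2 -> r1 <= Cmod (Cexp (x, y)) <= r2).
{ intros x y Hx; rewrite Cmod_Cexp; simpl.
  rewrite <- (exp_ln r1), <- (exp_ln r2) by lra.
  assert (M : forall a b, a <= b -> exp a <= exp b)
    by (intros a b [l| ->]; [left; now apply exp_increasing|lra]).
  split; apply M; lra. }
assert (S := strip_const (fun u => k (Cexp u)) (ln r1) (ln r2)).
unfold circle_int.
rewrite (CRInt_ext (fun t => k (circle_pt r1 t)) (fun y => k (Cexp (ln r1, y)))) by
  (try lra; intros; rewrite circle_pt_Cexp; auto; lra).
rewrite (CRInt_ext (fun t => k (circle_pt r2 t)) (fun y => k (Cexp (ln r2, y)))) by
  (try lra; intros; rewrite circle_pt_Cexp; auto; lra).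
apply S with (s0 := ln rho); auto.
- intros x; f_equal; unfold Cexp; simpl; now rewrite cos_2PI, sin_2PI, cos_0, sin_0.
- intros x y Hx; apply (@ccont_comp CU k Cexp); [apply HC; now apply X|].
  apply cdiff_ccont, cdiff_Cexp.
- intros x y Hx N; apply cdiff_comp; [|apply cdiff_Cexp].
  apply HD; [now apply X|].
  rewrite Cmod_Cexp; simpl; intros E; apply N; rewrite <- E; now rewrite ln_exp.
Qed.

(** Integrates exp(i a t) over a full turn; the hypotheses say that the frequency a is an
    integer, of either sign. *)
Lemma CRInt_circle_pt_freq s a : a <> 0 -> cos (a * (2 * PI)) = 1 -> sin (a * (2 * PI)) = 0 ->
  CRInt (fun t => circle_pt s (a * t)) 0 (2 * PI) = 0.
Proof.
intros Ha Hc Hs; assert (P := PI_RGT_0).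
rewrite (CRInt_FTC (fun t => (s / a * sin (a * t), - (s / a) * cos (a * t)))).
- rewrite Hc, Hs, (Rmult_0_r a), cos_0, sin_0; unfold Cminus, Cplus, Copp, RtoC; simpl; f_equal; ring.
- lra.
- intros t _; apply (@ccont_pair R_UniformSpace (fun t => s * cos (a * t)) (fun t => s * sin (a * t)));
  apply (@ex_derive_continuous R_AbsRing R_NormedModule); auto_derive; auto.
- intros t _; simpl; split; auto_derive; auto; field; auto.
Qed.

Lemma circle_int_inv_pow r n : 0 < r -> (1 <= n)%nat -> circle_int (fun z => (/ z) ^ n)%C r = 0.
Proof.
intros Hr Hn; assert (P := PI_RGT_0); unfold circle_int.
rewrite (CRInt_ext _ (fun t => circle_pt ((/ r) ^ n) (- INR n * t))).
- assert (N : INR n <> 0) by (apply not_0_INR; lia).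
  apply CRInt_circle_pt_freq; [lra| |];
    replace (- INR n * (2 * PI)) with (- (0 + 2 * INR n * PI)) by ring.
  + rewrite cos_neg, cos_period; apply cos_0.
  + rewrite sin_neg, sin_period, sin_0; ring.
- lra.
- intros t _; rewrite circle_pt_inv, circle_pt_pow by exact Hr; f_equal; ring.
Qed.

Lemma circle_int_bound (k : C -> C) r M : 0 <= r ->
  (forall z, Cmod z = r -> @ccont CU k z) ->
  (forall z, Cmod z = r -> Cmod (k z) <= M) -> Cmod (circle_int k r) <= 2 * PI * M.
Proof.
intros Hr HC B; assert (P := PI_RGT_0); unfold circle_int.
replace (2 * PI * M) with ((2 * PI - 0) * M) by ring.
apply CRInt_bound_const; [lra|now apply ccont_on_circle|].
intros t _; now apply B, Cmod_circle_pt.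
Qed.

Lemma circle_int_ext (k h : C -> C) r : 0 <= r -> (forall z, Cmod z = r -> k z = h z) ->
  circle_int k r = circle_int h r.
Proof.
intros Hr E; assert (P := PI_RGT_0); apply CRInt_ext; [lra|]; intros t _; now apply E, Cmod_circle_pt.
Qed.

Lemma circle_int_plus (k h : C -> C) r : 0 <= r ->
  (forall z, Cmod z = r -> @ccont CU k z) -> (forall z, Cmod z = r -> @ccont CU h z) ->
  circle_int (fun z => k z + h z)%C r = (circle_int k r + circle_int h r)%C.
Proof.
intros Hr Hk Hh; assert (P := PI_RGT_0); apply CRInt_plus; [lra| |]; now apply ccont_on_circle.
Qed.

Lemma circle_int_scal (c : C) (k : C -> C) r : 0 <= r ->
  (forall z, Cmod z = r -> @ccont CU k z) ->
  circle_int (fun z => c * k z)%C r = (c * circle_int k r)%C.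
Proof.
intros Hr Hk; assert (P := PI_RGT_0).
apply (CRInt_scal c (fun t => k (circle_pt r t))); [lra|]; now apply ccont_on_circle.
Qed.

Lemma circle_int_cst c r : circle_int (fun _ => c) r = (2 * PI * c)%C.
Proof.
assert (P := PI_RGT_0); unfold circle_int; rewrite CRInt_const by lra.
rewrite Rminus_0_r, RtoC_mult; reflexivity.
Qed.

(** * Cauchy's formula and the Schwarz lemma *)

Section Kernel.

Variables (g : C -> C) (r : R) (z0 : C).
Hypothesis g_ccont : forall z, Cmod z = r -> @ccont CU g z.
Hypothesis z0_r : Cmod z0 < r.

(** The remainder of Cauchy's integral once n terms of the geometric series of
    z / (z - z0) = 1 / (1 - z0 / z) have been removed; for n = 0 it is Cauchy's integral. *)
Definition kernel_int (n : nat) : C :=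
  circle_int (fun z => g z * ((z0 / z) ^ n * (z / (z - z0))))%C r.

Definition circle_coef (n : nat) : C := circle_int (fun z => g z * (/ z) ^ n)%C r.

Lemma circle_neq z : Cmod z = r -> z <> 0 /\ (z - z0)%C <> 0.
Proof.
intros Hz; assert (P := Cmod_ge_0 z0); split; intros E.
- rewrite E, Cmod_0 in Hz; lra.
- replace z with (z0 + (z - z0))%C in Hz by ring.
  rewrite E, Cplus_0_r in Hz; lra.
Qed.

Lemma kernel_ccont n z : Cmod z = r ->
  @ccont CU (fun z => g z * ((z0 / z) ^ n * (z / (z - z0))))%C z.
Proof.
intros Hz; destruct (circle_neq z Hz) as [N1 N2].
apply (@ccont_mult CU); [now apply g_ccont|].
apply (@ccont_mult CU).
- apply (@ccont_pow CU), (@ccont_mult CU); [apply (@ccont_const CU)|].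
  apply (@ccont_inv CU (fun z => z)); [exact N1|apply ccont_id].
- apply (@ccont_mult CU); [apply ccont_id|].
  apply (@ccont_inv CU (fun z => z - z0)%C); [exact N2|].
  apply (@ccont_minus CU); [apply ccont_id|apply (@ccont_const CU)].
Qed.

Lemma coef_ccont n z : Cmod z = r -> @ccont CU (fun z => g z * (/ z) ^ n)%C z.
Proof.
intros Hz; destruct (circle_neq z Hz) as [N1 N2].
apply (@ccont_mult CU); [now apply g_ccont|].
apply (@ccont_pow CU), (@ccont_inv CU (fun z => z)); [exact N1|apply ccont_id].
Qed.

Lemma kernel_step n : kernel_int n = (z0 ^ n * circle_coef n + kernel_int (S n))%C.
Proof.
assert (P := Cmod_ge_0 z0).
unfold kernel_int, circle_coef.
rewrite <- circle_int_scal; [|lra|apply coef_ccont].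
rewrite <- circle_int_plus; [|lra| |apply (kernel_ccont (S n))].
- apply circle_int_ext; [lra|]; intros z Hz; destruct (circle_neq z Hz) as [N1 N2].
  unfold Cdiv at 1 3; rewrite !Cpow_mult_l, !Cpow_S.
  field; auto.
- intros z Hz; apply (@ccont_mult CU); [apply (@ccont_const CU)|now apply coef_ccont].
Qed.

Lemma kernel_expansion n :
  kernel_int 0 = (sum_n (fun k => z0 ^ k * circle_coef k)%C n + kernel_int (S n))%C.
Proof.
induction n as [|n IH].
- rewrite sum_O; apply kernel_step.
- rewrite sum_Sn, IH, (kernel_step (S n)); unfold plus; simpl; ring.
Qed.

Lemma kernel_bound M n : (forall z, Cmod z = r -> Cmod (g z) <= M) ->
  Cmod (kernel_int n) <= 2 * PI * (M * ((Cmod z0 / r) ^ n * (r / (r - Cmod z0)))).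
Proof.
intros B; assert (P := Cmod_ge_0 z0).
unfold kernel_int; apply circle_int_bound; [lra|exact (kernel_ccont n)|].
intros z Hz; destruct (circle_neq z Hz) as [N1 N2].
assert (T : r - Cmod z0 <= Cmod (z - z0)).
{ assert (T := Cmod_triangle z0 (z - z0)).
  replace (z0 + (z - z0))%C with z in T by ring; lra. }
rewrite !Cmod_mult, Cmod_pow, !Cmod_div, Hz by auto.
apply Rmult_le_compat; [apply Cmod_ge_0| |now apply B|].
- apply Rmult_le_pos; [apply pow_le|]; (apply Rdiv_le_0_compat; lra).
- apply Rmult_le_compat_l; [apply pow_le, Rdiv_le_0_compat; lra|].
  apply Rmult_le_compat_l; [lra|]; apply Rinv_le_contravar; lra.
Qed.

End Kernel.

Lemma geometric_small q c e : 0 <= q < 1 -> 0 <= c -> 0 < e -> exists n, c * q ^ n <= e.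
Proof.
intros Hq Hc He.
destruct (pow_lt_1_zero q ltac:(rewrite Rabs_pos_eq; lra) (e / (c + 1))) as [n Hn].
{ apply Rdiv_lt_0_compat; lra. }
exists n; generalize (Hn n (le_n n)); rewrite Rabs_pos_eq by (apply pow_le; lra); intros B.
assert (0 <= q ^ n) by (apply pow_le; lra).
assert (q ^ n * (c + 1) < e).
{ replace e with (e / (c + 1) * (c + 1)) by (field; lra).
  apply Rmult_lt_compat_r; lra. }
nra.
Qed.

(** Only the term n = 0 of the geometric expansion has a nonzero integral. *)
Lemma kernel_int_one r z0 : Cmod z0 < r -> circle_int (fun z => z / (z - z0))%C r = (2 * PI)%R.
Proof.
intros Hz0; assert (P := Cmod_ge_0 z0); assert (PI0 := PI_RGT_0).
set (one := fun _ : C => RtoC 1).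
assert (HC : forall z, Cmod z = r -> @ccont CU one z) by (intros; apply (@ccont_const CU)).
assert (E0 : circle_int (fun z => z / (z - z0))%C r = kernel_int one r z0 0).
{ apply circle_int_ext; [lra|]; intros z Hz; unfold one; simpl; unfold Cdiv; ring. }
assert (S : forall n, sum_n (fun k => z0 ^ k * circle_coef one r k)%C n = RtoC (2 * PI)).
{ induction n as [|n IH].
  - rewrite sum_O; unfold circle_coef, one; simpl.
    rewrite circle_int_cst, RtoC_mult; ring.
  - rewrite sum_Sn, IH; unfold circle_coef, one.
    rewrite (circle_int_ext _ (fun z => (/ z) ^ (Datatypes.S n))%C) by (try lra; intros; ring).
    rewrite circle_int_inv_pow by (lra || lia).
    unfold plus; simpl; ring. }
rewrite E0.
apply eq_of_Cmod_minus_small; intros e He.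
set (c := 2 * PI * (1 * (r / (r - Cmod z0)))).
destruct (geometric_small (Cmod z0 / r) c e) as [n Hn]; auto.
- split; [apply Rdiv_le_0_compat; lra|].
  apply Rmult_lt_reg_r with r; [lra|]; field_simplify; lra.
- unfold c; rewrite Rmult_1_l; apply Rmult_le_pos; [lra|apply Rdiv_le_0_compat; lra].
- rewrite (kernel_expansion one r z0 HC Hz0 n), S.
  replace ((2 * PI)%R + kernel_int one r z0 (Datatypes.S n) - (2 * PI)%R)%C
    with (kernel_int one r z0 (Datatypes.S n)) by ring.
  eapply Rle_trans; [apply (kernel_bound one r z0 HC Hz0 1); intros; unfold one; rewrite Cmod_1; lra|].
  eapply Rle_trans; [|exact Hn]; simpl.
  replace (2 * PI * (1 * (Cmod z0 / r * (Cmod z0 / r) ^ n * (r / (r - Cmod z0)))))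
    with (Cmod z0 / r * (c * (Cmod z0 / r) ^ n)) by (unfold c; ring).
  rewrite <- (Rmult_1_l (c * (Cmod z0 / r) ^ n)) at 2.
  apply Rmult_le_compat_r.
  + apply Rmult_le_pos.
    * unfold c; rewrite Rmult_1_l; apply Rmult_le_pos; [lra|apply Rdiv_le_0_compat; lra].
    * apply pow_le, Rdiv_le_0_compat; lra.
  + apply Rmult_le_reg_r with r; [lra|]; field_simplify; lra.
Qed.

(** Cauchy's formula with a removable singularity at 0. The function
    k(z) = (h(z) - h(z0)) z / (z - z0), extended by h'(z0) z0 at z0, is continuous away from
    0 and holomorphic off z0, so its circle integral does not depend on the radius; it tends
    to 0 with the radius because h is bounded near 0. *)
Lemma cauchy_punctured (h : C -> C) r z0 B d :
  (forall z, 0 < Cmod z < 1 -> cdiff h z) ->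
  0 < d -> (forall z, 0 < Cmod z < d -> Cmod (h z) <= B) ->
  0 < Cmod z0 < r -> r < 1 ->
  circle_int (fun z => h z * (z / (z - z0)))%C r = ((2 * PI)%R * h z0)%C.
Proof.
intros Hh Hd HB Hz0 Hr; assert (PI0 := PI_RGT_0).
destruct (Hh z0 ltac:(lra)) as [q [Hq Eq]].
set (k := fun z => if Ceq_dec z z0 then (q z0 * z0)%C else ((h z - h z0) * (z / (z - z0)))%C).
assert (K1 : forall z, z <> z0 -> k z = ((h z - h z0) * (z / (z - z0)))%C).
{ intros z N; unfold k; now destruct (Ceq_dec z z0). }
assert (KD : forall z, 0 < Cmod z < 1 -> z <> z0 -> cdiff k z).
{ intros z Hz N.
  assert (N' := Cminus_neq_0 z z0 N).
  apply cdiff_ext_loc with (fun z => (h z - h z0) * (z / (z - z0)))%C.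
  - assert (L : @locally CU z (fun y => y - z0 <> 0)%C).
    { apply (ccont_neq0 (fun y => y - z0)%C); auto.
      apply (@ccont_minus CU); [apply ccont_id|apply (@ccont_const CU)]. }
    revert L; apply filter_imp; intros y Ny; rewrite K1; auto.
    intros ->; apply Ny; ring.
  - apply cdiff_mult; [apply cdiff_minus; [now apply Hh|apply cdiff_const]|].
    apply cdiff_div; [exact N'|apply cdiff_id|apply cdiff_minus; [apply cdiff_id|apply cdiff_const]]. }
assert (KC : forall z, 0 < Cmod z < 1 -> @ccont CU k z).
{ intros z Hz; destruct (Ceq_dec z z0) as [->|N]; [|now apply cdiff_ccont, KD].
  apply (@ccont_ext_loc CU (fun y => q y * y)%C).
  - revert Eq; apply filter_imp; intros y E; unfold k.
    destruct (Ceq_dec y z0) as [->|N]; [reflexivity|].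
    rewrite E; field; now apply Cminus_neq_0.
  - apply (@ccont_mult CU); [exact Hq|apply ccont_id]. }
(* On a small circle of radius s the integrand is O(s), since |z - z0| >= |z0| / 2. *)
assert (K0 : circle_int k r = 0).
{ apply Cmod_small_eq_0; intros e He.
  set (A := Rabs B + Cmod (h z0) + 1).
  assert (A0 : 0 < A) by (unfold A; generalize (Rabs_pos B) (Cmod_ge_0 (h z0)); lra).
  set (c := 2 * PI * (A * (2 / Cmod z0))).
  assert (c0 : 0 < c).
  { assert (0 < 2 / Cmod z0) by (apply Rdiv_lt_0_compat; lra).
    unfold c; apply Rmult_lt_0_compat; [lra|]; apply Rmult_lt_0_compat; lra. }
  set (s := Rmin (d / 2) (Rmin (Cmod z0 / 2) (e / c))).
  assert (s0 : 0 < s).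
  { unfold s; repeat apply Rmin_glb_lt; try lra; apply Rdiv_lt_0_compat; lra. }
  assert (s1 : s <= d / 2) by apply Rmin_l.
  assert (s2 : s <= Cmod z0 / 2) by (eapply Rle_trans; [apply Rmin_r|apply Rmin_l]).
  assert (s3 : s <= e / c) by (eapply Rle_trans; [apply Rmin_r|apply Rmin_r]).
  rewrite <- (circle_int_const k (Cmod z0) s r).
  - apply Rle_trans with (2 * PI * (A * (2 / Cmod z0) * s)).
    + apply circle_int_bound; [lra|intros z Hz; apply KC; lra|].
      intros z Hz.
      assert (N : z <> z0) by (intros ->; lra).
      assert (T : Cmod z0 / 2 <= Cmod (z - z0)).
      { assert (T := Cmod_triangle z (- (z - z0))).
        replace (z + - (z - z0))%C with z0 in T by ring; rewrite Cmod_opp in T; lra. }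
      rewrite K1 by exact N.
      rewrite Cmod_mult, Cmod_div by (apply Cmod_gt_0; lra).
      rewrite Rmult_assoc.
      apply Rmult_le_compat; try apply Cmod_ge_0.
      * apply Rdiv_le_0_compat; [apply Cmod_ge_0|lra].
      * unfold Cminus; eapply Rle_trans; [apply Cmod_triangle|]; rewrite Cmod_opp.
        unfold A; assert (HB' := HB z ltac:(lra)); generalize (Rle_abs B); lra.
      * rewrite Hz; replace (2 / Cmod z0 * s) with (s * / (Cmod z0 / 2)) by (field; lra).
        apply Rmult_le_compat_l; [lra|]; apply Rinv_le_contravar; lra.
    + replace (2 * PI * (A * (2 / Cmod z0) * s)) with (c * s) by (unfold c; ring).
      replace e with (c * (e / c)) by (field; lra).
      apply Rmult_le_compat_l; lra.
  - lra.
  - intros z Hz; apply KC; lra.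
  - intros z Hz N; apply KD; [lra|]; intros ->; now apply N. }
assert (NZ : forall z, Cmod z = r -> (z - z0)%C <> 0) by (intros z Hz; now apply (circle_neq r z0)).
assert (KK : forall z, Cmod z = r -> @ccont CU (fun z => z / (z - z0))%C z).
{ intros z Hz; apply (@ccont_mult CU); [apply ccont_id|].
  apply (@ccont_inv CU (fun z => z - z0)%C); [now apply NZ|].
  apply (@ccont_minus CU); [apply ccont_id|apply (@ccont_const CU)]. }
rewrite (circle_int_ext _ (fun z => k z + h z0 * (z / (z - z0)))%C).
- rewrite circle_int_plus, circle_int_scal, K0, kernel_int_one; try lra; auto.
  + ring.
  + intros z Hz; apply KC; lra.
  + intros z Hz; apply (@ccont_mult CU); [apply (@ccont_const CU)|now apply KK].
- lra.
- intros z Hz; rewrite K1; [ring|]; intros ->; lra.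
Qed.

(** The constant c disappears on taking n-th roots. *)
Lemma le_of_pow_le_scal_pow a M c : 0 <= a -> 0 <= M -> (forall n, a ^ n <= c * M ^ n) -> a <= M.
Proof.
intros Ha HM B; destruct (Rle_dec a M) as [L|N]; [exact L|exfalso].
destruct (Req_dec M 0) as [->|NM].
{ generalize (B 1%nat); simpl; lra. }
set (x := a / M - 1).
assert (X : 0 < x).
{ unfold x; apply Rmult_lt_reg_r with M; [lra|]; field_simplify; lra. }
destruct (INR_unbounded (c / x)) as [n Hn].
assert (P := poly n x X).
replace (1 + x) with (a / M) in P by (unfold x; ring).
assert (Q : (a / M) ^ n <= c).
{ unfold Rdiv; rewrite Rpow_mult_distr, pow_inv.
  assert (0 < M ^ n) by (apply pow_lt; lra).
  apply Rmult_le_reg_r with (M ^ n); [lra|].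
  rewrite Rmult_assoc, Rinv_l, Rmult_1_r by lra; apply B. }
assert (c < INR n * x).
{ replace c with (c / x * x) by (field; lra); apply Rmult_lt_compat_r; lra. }
lra.
Qed.

(** Cauchy's formula for h^n gives |h(z0)|^n <= c M^n with c independent of n, and c
    disappears on taking n-th roots. *)
Lemma max_principle (h : C -> C) r z0 B d M :
  (forall z, 0 < Cmod z < 1 -> cdiff h z) ->
  0 < d -> (forall z, 0 < Cmod z < d -> Cmod (h z) <= B) ->
  0 < Cmod z0 < r -> r < 1 -> (forall z, Cmod z = r -> Cmod (h z) <= M) ->
  Cmod (h z0) <= M.
Proof.
intros Hh Hd HB Hz0 Hr HM; assert (PI0 := PI_RGT_0).
assert (M0 : 0 <= M).
{ eapply Rle_trans; [apply (Cmod_ge_0 (h (circle_pt r 0)))|]; apply HM, Cmod_circle_pt; lra. }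
apply le_of_pow_le_scal_pow with (r / (r - Cmod z0)); [apply Cmod_ge_0|exact M0|].
intros n.
assert (HD : forall z, 0 < Cmod z < 1 -> cdiff (fun z => h z ^ n)%C z).
{ intros z Hz; apply cdiff_pow; now apply Hh. }
assert (C := cauchy_punctured (fun z => h z ^ n)%C r z0 (B ^ n) d HD Hd).
assert (HC : forall z, Cmod z = r -> @ccont CU (fun z => h z ^ n)%C z).
{ intros z Hz; apply cdiff_ccont, HD; lra. }
assert (K := kernel_bound (fun z => h z ^ n)%C r z0 HC ltac:(lra) (M ^ n) 0).
assert (E : kernel_int (fun z => h z ^ n)%C r z0 0 = ((2 * PI)%R * h z0 ^ n)%C).
{ rewrite <- C; try lra.
  - apply circle_int_ext; [lra|]; intros z Hz; simpl; ring.
  - intros z Hz; rewrite Cmod_pow; apply pow_incr; split; [apply Cmod_ge_0|now apply HB]. }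
rewrite E, Cmod_mult, Cmod_R, Cmod_pow, Rabs_pos_eq in K by lra.
apply Rmult_le_reg_l with (2 * PI); [lra|].
eapply Rle_trans; [apply K|].
- intros z Hz; rewrite Cmod_pow; apply pow_incr; split; [apply Cmod_ge_0|now apply HM].
- simpl; right; ring.
Qed.

(** The quotient g(z) / z^m is bounded near 0, and on the circle of radius r it is at most
    1 / r^m; the maximum principle applies and r tends to 1. *)
Lemma schwarz_lemma g m K d :
  (forall z, Cmod z < 1 -> cdiff g z) ->
  (forall z, Cmod z < 1 -> Cmod (g z) <= 1) ->
  0 < d -> (forall z, Cmod z < d -> Cmod (g z) <= K * Cmod z ^ m) ->
  forall z, Cmod z < 1 -> Cmod (g z) <= Cmod z ^ m.
Proof.
intros Hg B1 Hd HK z0 Hz0.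
destruct (Req_dec (Cmod z0) 0) as [Z|NZ].
{ rewrite Z; destruct m as [|m]; [now apply B1|].
  assert (B := HK z0 ltac:(lra)); rewrite Z in B; simpl in *; lra. }
assert (P : 0 < Cmod z0) by (generalize (Cmod_ge_0 z0); lra).
assert (R1 : forall r, Cmod z0 < r < 1 -> Cmod (g z0) * r ^ m <= Cmod z0 ^ m).
{ intros r Hr.
  assert (rm : 0 < r ^ m) by (apply pow_lt; lra).
  assert (zm : 0 < Cmod z0 ^ m) by (apply pow_lt; lra).
  assert (NP : forall z, 0 < Cmod z -> (z ^ m)%C <> 0) by (intros z Hz; now apply Cpow_nz, Cmod_gt_0).
  assert (MP := max_principle (fun z => g z / z ^ m)%C r z0 K (Rmin d 1) (/ r ^ m)).
  cbv beta in MP; rewrite (Cmod_div (g z0)), Cmod_pow in MP by auto.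
  apply Rmult_le_reg_r with (/ r ^ m * / Cmod z0 ^ m).
  { apply Rmult_lt_0_compat; now apply Rinv_0_lt_compat. }
  replace (Cmod z0 ^ m * (/ r ^ m * / Cmod z0 ^ m)) with (/ r ^ m) by (field; lra).
  replace (Cmod (g z0) * r ^ m * (/ r ^ m * / Cmod z0 ^ m)) with (Cmod (g z0) / Cmod z0 ^ m) by (field; lra).
  apply MP; try lra.
  - intros z Hz; apply cdiff_div; [now apply NP|apply Hg; lra|apply cdiff_pow, cdiff_id].
  - apply Rmin_glb_lt; lra.
  - intros z [Hz1 Hz2].
    assert (Hz3 : Cmod z < d) by (eapply Rlt_le_trans; [exact Hz2|apply Rmin_l]).
    rewrite Cmod_div, Cmod_pow by auto.
    assert (0 < Cmod z ^ m) by (apply pow_lt; lra).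
    apply Rmult_le_reg_r with (Cmod z ^ m); [lra|].
    unfold Rdiv; rewrite Rmult_assoc, Rinv_l, Rmult_1_r by lra; now apply HK.
  - intros z Hz; rewrite Cmod_div, Cmod_pow, Hz by (apply NP; lra).
    rewrite <- (Rmult_1_l (/ r ^ m)); apply Rmult_le_compat_r.
    + now apply Rlt_le, Rinv_0_lt_compat.
    + apply B1; lra. }
apply (le_of_mul_pow_le _ _ (Cmod z0) m); [apply Cmod_ge_0|lra|exact R1].
Qed.

(** At the centre the formula is the mean value property, obtained by letting the radius
    tend to 0; elsewhere the punctured version applies. *)
Lemma cauchy_disk g r z0 : (forall z, Cmod z < 1 -> cdiff g z) -> 0 < r < 1 -> Cmod z0 < r ->
  kernel_int g r z0 0 = ((2 * PI)%R * g z0)%C.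
Proof.
intros Hg Hr Hz0; assert (PI0 := PI_RGT_0).
assert (E : kernel_int g r z0 0 = circle_int (fun z => g z * (z / (z - z0)))%C r).
{ apply circle_int_ext; [lra|]; intros z Hz; simpl; ring. }
destruct (Ceq_dec z0 0) as [->|N].
- rewrite E, (circle_int_ext _ g).
  2:{ lra. }
  2:{ intros z Hz; field; apply (circle_neq r 0 Hz0 z Hz). }
  assert (C : forall s, 0 < s <= r -> circle_int g s = circle_int g r).
  { intros s Hs; apply (circle_int_const g 0); auto; intros z Hz.
    - apply cdiff_ccont, Hg; lra.
    - intros _; apply Hg; lra. }
  apply eq_of_Cmod_minus_small; intros e He.
  assert (He' : 0 < e / (2 * PI)) by (apply Rdiv_lt_0_compat; lra).
  destruct (proj1 (locally_CU _ _) (cdiff_ccont g 0 (Hg 0 ltac:(rewrite Cmod_0; lra)) _ He')) as [d [Hd D]].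
  set (s := Rmin r (d / 2)).
  assert (s1 : 0 < s) by (apply Rmin_glb_lt; lra).
  assert (s2 : s <= r) by apply Rmin_l.
  assert (s3 : s <= d / 2) by apply Rmin_r.
  rewrite <- (C s) by lra.
  assert (GC : forall z, Cmod z = s -> @ccont CU g z) by (intros z Hz; apply cdiff_ccont, Hg; lra).
  replace ((2 * PI)%R * g 0)%C with (- (circle_int (fun _ => - g 0)%C s))%C
    by (rewrite circle_int_cst, RtoC_mult; ring).
  replace (circle_int g s - - circle_int (fun _ => - g 0)%C s)%C
    with (circle_int g s + circle_int (fun _ => - g 0)%C s)%C by ring.
  rewrite <- circle_int_plus; [|lra|exact GC|intros; apply (@ccont_const CU)].
  replace e with (2 * PI * (e / (2 * PI))) by (field; lra).
  apply circle_int_bound; [lra| |].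
  + intros z Hz; apply (@ccont_plus CU); [now apply GC|apply (@ccont_const CU)].
  + intros z Hz; left; apply D; replace (z - 0)%C with z by ring; lra.
- rewrite E.
  assert (P : 0 < Cmod z0) by now apply Cmod_gt_0.
  destruct (proj1 (locally_CU _ _) (cdiff_ccont g 0 (Hg 0 ltac:(rewrite Cmod_0; lra)) _ Rlt_0_1)) as [d [Hd D]].
  apply cauchy_punctured with (Cmod (g 0) + 1) d; auto; try lra.
  + intros z Hz; apply Hg; lra.
  + intros z Hz.
    replace (g z) with (g 0 + (g z - g 0))%C by ring.
    eapply Rle_trans; [apply Cmod_triangle|].
    assert (Cmod (g z - g 0) < 1) by (apply D; replace (z - 0)%C with z by ring; lra).
    lra.
Qed.

Definition taylor_coef g (r : R) (n : nat) : C := (circle_coef g r n / (2 * PI)%R)%C.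

Lemma taylor_remainder g r M n z :
  (forall z, Cmod z < 1 -> cdiff g z) -> 0 < r < 1 -> Cmod z < r ->
  (forall z, Cmod z = r -> Cmod (g z) <= M) ->
  Cmod (g z - sum_n (fun k => z ^ k * taylor_coef g r k)%C n)
    <= M * (r / (r - Cmod z)) * (Cmod z / r) ^ S n.
Proof.
intros Hg Hr Hz HM; assert (PI0 := PI_RGT_0).
assert (GC : forall z, Cmod z = r -> @ccont CU g z) by (intros y Hy; apply cdiff_ccont, Hg; lra).
assert (C := cauchy_disk g r z Hg Hr Hz).
rewrite (kernel_expansion g r z GC Hz n) in C.
assert (N : RtoC (2 * PI) <> 0).
{ intros E; apply RtoC_inj in E; lra. }
assert (S : sum_n (fun k => z ^ k * circle_coef g r k)%C n
  = ((2 * PI)%R * sum_n (fun k => z ^ k * taylor_coef g r k)%C n)%C).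
{ clear C; induction n as [|n IH].
  - rewrite !sum_O; unfold taylor_coef.
    match goal with |- ?a = ?b => change (@eq C a b) end; field; auto.
  - rewrite !sum_Sn, IH; unfold plus, taylor_coef; simpl.
    match goal with |- ?a = ?b => change (@eq C a b) end; field; auto. }
rewrite S in C.
assert (E : (g z - sum_n (fun k => z ^ k * taylor_coef g r k)%C n
  = kernel_int g r z (Datatypes.S n) / (2 * PI)%R)%C).
{ replace (g z) with (((2 * PI)%R * g z) / (2 * PI)%R)%C by (field; auto).
  rewrite <- C; field; auto. }
rewrite E, Cmod_div, Cmod_R, Rabs_pos_eq by (auto; lra).
apply Rmult_le_reg_r with (2 * PI); [lra|].
unfold Rdiv at 1; rewrite Rmult_assoc, Rinv_l, Rmult_1_r by lra.
eapply Rle_trans; [now apply (kernel_bound g r z GC Hz M)|right; ring].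
Qed.

(** * Taylor coefficients and derivatives at the origin *)

Lemma is_derive_bound {V : NormedModule C_AbsRing} (f : C -> V) (z : C) (l : V) :
  is_derive f z l -> forall e, 0 < e -> exists d, 0 < d /\
    forall y, Cmod (y - z) < d ->
      norm (minus (minus (f y) (f z)) (scal (y - z)%C l)) <= e * Cmod (y - z).
Proof.
intros [_ D] e He.
destruct (D z (fun P HP => HP) (mkposreal e He)) as [d Hd].
exists d; split; [apply cond_pos|]; intros y Hy; exact (Hd y Hy).
Qed.

(** The linear map L need only be bounded: this is how scalar functions are extracted from
    operator-valued ones. *)
Lemma cdiff_functional {V : NormedModule C_AbsRing} (f : C -> V) (L : V -> C) (K : R) z :
  (forall u v, L (plus u v) = (L u + L v)%C) ->
  (forall (c : C) u, L (scal c u) = (c * L u)%C) ->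
  (forall u, Cmod (L u) <= K * norm u) ->
  ex_derive f z -> cdiff (fun y => L (f y)) z.
Proof.
intros La Ls Lb [l Hl].
assert (Lo : forall u, L (opp u) = (- L u)%C).
{ intros u.
  replace (opp u) with (scal (opp (one : C_AbsRing)) u) by apply (@scal_opp_one C_AbsRing V).
  rewrite Ls; change (- (1) * L u = - L u)%C; ring. }
set (q := fun y => if Ceq_dec y z then L l else ((L (f y) - L (f z)) / (y - z))%C).
exists q; split.
- intros e He.
  assert (He' : 0 < e / (Rabs K + 1)) by (apply Rdiv_lt_0_compat; [|generalize (Rabs_pos K)]; lra).
  destruct (is_derive_bound f z l Hl _ He') as [d [Hd D]].
  apply locally_CU; exists d; split; [exact Hd|]; intros y Hy.
  unfold q; destruct (Ceq_dec z z) as [_|N]; [|now elim N].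
  destruct (Ceq_dec y z) as [->|N].
  { replace (L l - L l)%C with (RtoC 0) by ring; rewrite Cmod_0; lra. }
  assert (N' := Cminus_neq_0 y z N).
  assert (P : 0 < Cmod (y - z)) by now apply Cmod_gt_0.
  replace ((L (f y) - L (f z)) / (y - z) - L l)%C
    with (L (minus (minus (f y) (f z)) (scal (y - z)%C l)) / (y - z))%C.
  2:{ unfold minus; rewrite !La, !Lo, Ls; field; auto. }
  rewrite Cmod_div by auto.
  apply Rle_lt_trans with (Rabs K * (e / (Rabs K + 1))).
  + apply Rmult_le_reg_r with (Cmod (y - z)); [exact P|].
    unfold Rdiv at 1; rewrite Rmult_assoc, Rinv_l, Rmult_1_r by lra.
    eapply Rle_trans; [apply Lb|].
    eapply Rle_trans; [apply Rmult_le_compat_r; [apply norm_ge_0|apply (Rle_abs K)]|].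
    rewrite Rmult_assoc; apply Rmult_le_compat_l; [apply Rabs_pos|now apply D].
  + replace e with ((Rabs K + 1) * (e / (Rabs K + 1))) at 2
      by (field; generalize (Rabs_pos K); lra).
    apply Rmult_lt_compat_r; lra.
- apply filter_forall; intros y; unfold q.
  destruct (Ceq_dec y z) as [->|N]; [ring|].
  field; now apply Cminus_neq_0.
Qed.

Lemma cdiff_ex_derive f z : @ex_derive C_AbsRing C_NormedModule f z -> cdiff f z.
Proof.
apply (@cdiff_functional C_NormedModule f (fun u => u) 1); auto.
intros u; rewrite Rmult_1_l; apply Rle_refl.
Qed.

(** L is only real-linear, so that it may be the real or the imaginary part of a matrix
    coefficient. *)
Lemma is_series_functional {V : NormedModule C_AbsRing} (a : nat -> V) (l : V) (L : V -> R) (K : R) :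
  (forall u v, L (plus u v) = L u + L v) -> (forall u, L (opp u) = - L u) ->
  (forall u, Rabs (L u) <= K * norm u) ->
  is_series a l -> is_series (fun n => L (a n)) (L l).
Proof.
intros La Lo Lb S.
apply (filterlim_locally_ball_norm (U := R_NormedModule)); intros e.
assert (He' : 0 < e / (Rabs K + 1)).
{ apply Rdiv_lt_0_compat; [apply cond_pos|generalize (Rabs_pos K); lra]. }
assert (S' := proj1 (filterlim_locally_ball_norm _ _) S (mkposreal _ He')).
revert S'; apply filter_imp; intros n Hn; unfold ball_norm in *; simpl in Hn.
assert (E : sum_n (fun n => L (a n)) n = L (sum_n a n)).
{ clear - La; induction n as [|n IH].
  - now rewrite !sum_O.
  - now rewrite !sum_Sn, IH, La. }
change (Rabs (sum_n (fun n => L (a n)) n - L l) < e); rewrite E.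
replace (L (sum_n a n) - L l) with (L (minus (sum_n a n) l)) by (unfold minus; rewrite La, Lo; ring).
eapply Rle_lt_trans; [apply Lb|].
eapply Rle_lt_trans; [apply Rmult_le_compat_r; [apply norm_ge_0|apply (Rle_abs K)]|].
replace (pos e) with ((Rabs K + 1) * (e / (Rabs K + 1)))
  by (field; generalize (Rabs_pos K); lra).
apply Rle_lt_trans with (Rabs K * (e / (Rabs K + 1))).
- apply Rmult_le_compat_l; [apply Rabs_pos|lra].
- apply Rmult_lt_compat_r; lra.
Qed.

(** Convergence at r / 2 makes the radius of convergence positive, and derivatives at 0 see
    only the germ of u. *)
Lemma Derive_n_pseries_0 (u : R -> R) (a : nat -> R) r n :
  0 < r -> (forall t, Rabs t < r -> is_pseries a t (u t)) ->
  Derive_n u n 0 = a n * INR (Factorial.fact n).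
Proof.
intros Hr Hu.
assert (P : Rbar_lt 0 (CV_radius a)).
{ destruct (Rbar_lt_le_dec 0 (CV_radius a)) as [L|L]; [exact L|exfalso].
  assert (Hr2 : Rabs (r / 2) < r) by (rewrite Rabs_pos_eq; lra).
  apply (CV_disk_outside a (r / 2)).
  - eapply Rbar_le_lt_trans; [exact L|]; simpl; rewrite Rabs_pos_eq; lra.
  - apply ex_series_lim_0; apply (proj1 (ex_pseries_R a (r / 2))).
    eexists; now apply Hu. }
rewrite <- Derive_n_coef by exact P.
apply Derive_n_ext_loc.
exists (mkposreal r Hr); intros t Ht; symmetry; apply is_pseries_unique, Hu.
unfold ball in Ht; simpl in Ht; unfold AbsRing_ball, abs, minus, plus, opp in Ht; simpl in Ht.
now rewrite Ropp_0, Rplus_0_r in Ht.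
Qed.

Lemma sum_n_Re (c : nat -> C) n : fst (sum_n c n : C) = sum_n (fun k => fst (c k)) n.
Proof.
induction n as [|n IH]; [now rewrite !sum_O|].
rewrite !sum_Sn, <- IH; reflexivity.
Qed.

Lemma sum_n_Im (c : nat -> C) n : snd (sum_n c n : C) = sum_n (fun k => snd (c k)) n.
Proof.
induction n as [|n IH]; [now rewrite !sum_O|].
rewrite !sum_Sn, <- IH; reflexivity.
Qed.

Lemma is_series_of_bound (a : nat -> R) (l K q : R) : 0 <= q < 1 -> 0 <= K ->
  (forall n, Rabs (l - sum_n a n) <= K * q ^ S n) -> is_series a l.
Proof.
intros Hq HK B.
apply (filterlim_locally_ball_norm (U := R_NormedModule)); intros e.
assert (He : 0 < e / 2) by (generalize (cond_pos e); lra).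
destruct (geometric_small q K _ Hq HK He) as [N HN].
exists N; intros n Hn.
change (Rabs (sum_n a n - l) < e); rewrite Rabs_minus_sym.
eapply Rle_lt_trans; [apply B|].
apply Rle_lt_trans with (K * q ^ N); [|generalize (cond_pos e); lra].
apply Rmult_le_compat_l; [exact HK|].
replace (S n) with (N + (S n - N))%nat by lia.
rewrite pow_add, <- (Rmult_1_r (q ^ N)) at 1.
assert (0 <= q ^ N) by (apply pow_le; lra).
rewrite Rmult_1_r; rewrite <- (Rmult_1_r (q ^ N)) at 2.
apply Rmult_le_compat_l; [lra|].
rewrite <- (pow1 (S n - N)); apply pow_incr; lra.
Qed.

Section TaylorReal.

Variables (g : C -> C) (r M : R).
Hypothesis g_cdiff : forall z, Cmod z < 1 -> cdiff g z.
Hypothesis r_bounds : 0 < r < 1.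
Hypothesis g_bound : forall z, Cmod z = r -> Cmod (g z) <= M.

(** On the real axis the Taylor expansion splits into two real power series, for which
    iterated derivatives and uniqueness of coefficients are classical. *)
Lemma taylor_real (t : R) : Rabs t < r ->
  is_pseries (fun n => fst (taylor_coef g r n)) t (fst (g t)) /\
  is_pseries (fun n => snd (taylor_coef g r n)) t (snd (g t)).
Proof.
intros Ht; rewrite <- Cmod_R in Ht.
assert (R := fun n => taylor_remainder g r M n t g_cdiff r_bounds Ht g_bound).
set (q := Cmod t / r) in *.
assert (Hq : 0 <= q < 1).
{ assert (C0 := Cmod_ge_0 t); unfold q; split; [apply Rdiv_le_0_compat; lra|].
  apply Rmult_lt_reg_r with r; [lra|]; field_simplify; lra. }
assert (M0 : 0 <= M).
{ eapply Rle_trans; [apply (Cmod_ge_0 (g (circle_pt r 0)))|]; apply g_bound, Cmod_circle_pt; lra. }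
assert (K0 : 0 <= M * (r / (r - Cmod t))) by (apply Rmult_le_pos; [lra|apply Rdiv_le_0_compat; lra]).
split; apply (is_series_of_bound _ _ _ q Hq K0); intros n; (eapply Rle_trans; [|apply (R n)]);
  (eapply Rle_trans; [|apply Rmax_Cmod]).
- eapply Rle_trans; [|apply Rmax_l]; right; f_equal.
  change (fst (g t - sum_n (fun k => (t ^ k * taylor_coef g r k)%C) n)%C)
    with (fst (g t) - fst (sum_n (fun k => (t ^ k * taylor_coef g r k)%C) n : C)).
  rewrite sum_n_Re; f_equal; apply sum_n_ext; intros k.
  rewrite <- RtoC_pow, pow_n_pow; unfold scal; simpl; unfold mult; simpl; ring.
- eapply Rle_trans; [|apply Rmax_r]; right; f_equal.
  change (snd (g t - sum_n (fun k => (t ^ k * taylor_coef g r k)%C) n)%C)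
    with (snd (g t) - snd (sum_n (fun k => (t ^ k * taylor_coef g r k)%C) n : C)).
  rewrite sum_n_Im; f_equal; apply sum_n_ext; intros k.
  rewrite <- RtoC_pow, pow_n_pow; unfold scal; simpl; unfold mult; simpl; ring.
Qed.

Lemma taylor_coef_Derive_n n :
  (Derive_n (fun t => fst (g (RtoC t))) n 0, Derive_n (fun t => snd (g (RtoC t))) n 0)
  = (INR (Factorial.fact n) * taylor_coef g r n)%C.
Proof.
rewrite (Derive_n_pseries_0 (fun t => fst (g (RtoC t))) (fun n => fst (taylor_coef g r n)) r n
  (proj1 r_bounds) (fun t Ht => proj1 (taylor_real t Ht))).
rewrite (Derive_n_pseries_0 (fun t => snd (g (RtoC t))) (fun n => snd (taylor_coef g r n)) r n
  (proj1 r_bounds) (fun t Ht => proj2 (taylor_real t Ht))).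
unfold Cmult; simpl; f_equal; ring.
Qed.

Lemma taylor_coef_unique (c : nat -> C) n :
  (forall t, Rabs t < r -> is_pseries (fun n => fst (c n)) t (fst (g t)) /\
     is_pseries (fun n => snd (c n)) t (snd (g t))) ->
  taylor_coef g r n = c n.
Proof.
intros Hc; assert (F := INR_fact_neq_0 n).
destruct r_bounds as [r0 _].
apply injective_projections.
- apply Rmult_eq_reg_r with (INR (Factorial.fact n)); [|exact F].
  rewrite <- (Derive_n_pseries_0 (fun t => fst (g t)) (fun n => fst (c n)) r n r0 (fun t Ht => proj1 (Hc t Ht))).
  symmetry; apply (Derive_n_pseries_0 (fun t => fst (g t)) (fun n => fst (taylor_coef g r n)) r n r0).
  intros t Ht; exact (proj1 (taylor_real t Ht)).
- apply Rmult_eq_reg_r with (INR (Factorial.fact n)); [|exact F].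
  rewrite <- (Derive_n_pseries_0 (fun t => snd (g t)) (fun n => snd (c n)) r n r0 (fun t Ht => proj2 (Hc t Ht))).
  symmetry; apply (Derive_n_pseries_0 (fun t => snd (g t)) (fun n => snd (taylor_coef g r n)) r n r0).
  intros t Ht; exact (proj2 (taylor_real t Ht)).
Qed.

End TaylorReal.

Lemma Lim_shift (G : R -> R) (x : R) : Lim G x = Lim (fun s => G (x + s)) 0.
Proof.
unfold Lim; apply Lim_seq_ext; intros n; simpl; f_equal; ring.
Qed.

(** [C_derive] is computed along the real direction, so it only sees the restriction of the
    function to the real axis. *)
Lemma C_derive_real f (x : R) :
  C_derive f x = (Derive (fun t => fst (f (RtoC t))) x, Derive (fun t => snd (f (RtoC t))) x).
Proof.
unfold C_derive, C_lim, Derive; simpl; f_equal; f_equal; rewrite Lim_shift;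
unfold Lim; apply Lim_seq_ext; intros n; simpl;
generalize (pos_INR n); intros P;
fold (RtoC (x + (0 + / (INR n + 1)))); field; repeat split; try nra.
Qed.

Lemma C_derive_n_real f n (x : R) :
  C_derive_n f n x = (Derive_n (fun t => fst (f (RtoC t))) n x, Derive_n (fun t => snd (f (RtoC t))) n x).
Proof.
revert x; induction n as [|n IH]; intros x; simpl.
- apply surjective_pairing.
- rewrite C_derive_real; f_equal; apply Derive_ext; intros t; now rewrite IH.
Qed.

(** The vanishing derivatives kill the first m Taylor coefficients, so f(z) = O(|z|^m) by the
    Taylor remainder on the circle of radius 1/2, and the Schwarz lemma applies. *)
Lemma schwarz_map_order_bound m f : schwarz_map_of_order m f ->
  forall z, Cmod z < 1 -> Cmod (f z) <= Cmod z ^ m.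
Proof.
intros [[Hol [Disk _]] [Z _]].
assert (D : forall z, Cmod z < 1 -> cdiff f z) by (intros z Hz; apply cdiff_ex_derive; now apply Hol).
assert (B : forall z, Cmod z < 1 -> Cmod (f z) <= 1) by (intros z Hz; left; now apply Disk).
apply (schwarz_lemma f m (2 * 2 ^ m) (1 / 4)); auto; [lra|].
intros z Hz; assert (C0 := Cmod_ge_0 z).
(* For |z| < 1/4 the remainder is at most 2 (2 |z|)^m, whence the constant 2 * 2^m. *)
destruct m as [|m]; [simpl; generalize (B z ltac:(lra)); lra|].
assert (T0 : forall k, (k < S m)%nat -> taylor_coef f (1 / 2) k = 0).
{ intros k Hk.
  assert (E := taylor_coef_Derive_n f (1 / 2) 1 D ltac:(lra) (fun z Hz => B z ltac:(lra)) k).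
  rewrite <- (C_derive_n_real f k 0), Z in E by exact Hk.
  assert (F := INR_fact_neq_0 k).
  assert (N : RtoC (INR (Factorial.fact k)) <> 0) by (intros E'; now apply F, RtoC_inj).
  destruct (Ceq_dec (taylor_coef f (1 / 2) k) 0) as [E'|N']; [exact E'|].
  exfalso; now apply (Cmult_neq_0 _ _ N N'). }
assert (R := taylor_remainder f (1 / 2) 1 m z D ltac:(lra) ltac:(lra) (fun z Hz => B z ltac:(lra))).
assert (S0 : forall n, (n <= m)%nat ->
  sum_n (fun k => z ^ k * taylor_coef f (1 / 2) k)%C n = RtoC 0).
{ induction n as [|n IH]; intros Hn.
  - rewrite sum_O, T0 by lia; simpl; ring.
  - rewrite sum_Sn, IH, T0 by lia; unfold plus; simpl; ring. }
rewrite S0 in R by lia.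
replace (f z - 0)%C with (f z) in R by ring.
eapply Rle_trans; [exact R|].
replace (Cmod z / (1 / 2)) with (2 * Cmod z) by field.
rewrite Rpow_mult_distr, <- Rmult_assoc.
apply Rmult_le_compat_r; [now apply pow_le|].
apply Rmult_le_compat_r; [apply pow_le; lra|].
rewrite Rmult_1_l.
apply Rmult_le_reg_r with (1 / 2 - Cmod z); [lra|].
unfold Rdiv at 1; rewrite Rmult_assoc, Rinv_l by lra; lra.
Qed.

(** * The scalar Schwarz-Pick inequality *)

Lemma Cmod_minus_sq u v :
  Cmod (u - v) ^ 2 = Cmod u ^ 2 + Cmod v ^ 2 - 2 * fst (u * Cconj v)%C.
Proof. rewrite !Cmod2_alt; destruct u, v; simpl; ring. Qed.

Lemma fst_le_Cmod z : fst z <= Cmod z.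
Proof. eapply Rle_trans; [apply Rle_abs|]; eapply Rle_trans; [apply Rmax_l|apply Rmax_Cmod]. Qed.

(** Squaring, with t = Re(conj(b) g) <= |b| |g|, the hypothesis becomes
    (|g| - |b|)^2 <= rho^2 (1 - |b| |g|)^2. *)
Lemma schwarz_pick_algebra (b g : C) (rho : R) : 0 <= rho <= 1 -> Cmod b <= 1 -> Cmod g <= 1 ->
  Cmod (g - b) <= rho * Cmod (1 - Cconj b * g) ->
  Cmod g * (1 + Cmod b * rho) <= Cmod b + rho.
Proof.
intros Hr Hb Hg H.
assert (B0 := Cmod_ge_0 b); assert (G0 := Cmod_ge_0 g).
assert (H2 : Cmod (g - b) ^ 2 <= rho ^ 2 * Cmod (1 - Cconj b * g) ^ 2).
{ rewrite <- Rpow_mult_distr; apply pow_incr; split; [apply Cmod_ge_0|exact H]. }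
rewrite !Cmod_minus_sq, Cmod_1, Cmod_mult, Cmod_conj in H2.
assert (E : fst (1 * Cconj (Cconj b * g))%C = fst (g * Cconj b)%C)
  by (destruct b, g; simpl; ring).
rewrite E in H2.
assert (T : fst (g * Cconj b)%C <= Cmod g * Cmod b).
{ rewrite <- (Cmod_conj b), <- Cmod_mult; apply fst_le_Cmod. }
set (t := fst (g * Cconj b)%C) in *; set (be := Cmod b) in *; set (ga := Cmod g) in *.
assert (S : (ga - be) ^ 2 <= (rho * (1 - be * ga)) ^ 2).
{ assert (0 <= 1 - rho ^ 2) by nra. nra. }
assert (P : 0 <= 1 - be * ga) by nra.
assert (ga - be <= rho * (1 - be * ga)); [|lra].
assert (0 <= rho * (1 - be * ga)) by (apply Rmult_le_pos; lra).
destruct (Rle_dec (ga - be) 0) as [L|L]; [lra|].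
apply Rsqr_incr_0; unfold Rsqr; lra.
Qed.

(** The difference of the squares of both sides is (1 - |b|^2)(1 - |g|^2). *)
Lemma moebius_le_1 (b g : C) : Cmod b <= 1 -> Cmod g <= 1 -> Cmod (g - b) <= Cmod (1 - Cconj b * g).
Proof.
intros Hb Hg; assert (B0 := Cmod_ge_0 b); assert (G0 := Cmod_ge_0 g).
apply Rsqr_incr_0; try apply Cmod_ge_0; unfold Rsqr.
assert (E : fst (1 * Cconj (Cconj b * g))%C = fst (g * Cconj b)%C)
  by (destruct b, g; simpl; ring).
assert (H1 := Cmod_minus_sq g b); assert (H2 := Cmod_minus_sq 1 (Cconj b * g)).
rewrite E, Cmod_1, Cmod_mult, Cmod_conj in H2.
assert (0 <= (1 - Cmod b ^ 2) * (1 - Cmod g ^ 2)) by (apply Rmult_le_pos; nra).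
nra.
Qed.

(** The Schwarz lemma for (g - g(0)) / (1 - conj(g(0)) g). *)
Lemma schwarz_pick g a :
  (forall z, Cmod z < 1 -> cdiff g z) -> (forall z, Cmod z < 1 -> Cmod (g z) <= 1) ->
  Cmod (g 0) <= a -> a < 1 ->
  forall z, Cmod z < 1 -> Cmod (g z) <= (a + Cmod z) / (1 + a * Cmod z).
Proof.
intros Hg Bg Ha Ha1.
set (b := g 0) in *.
assert (B0 := Cmod_ge_0 b).
assert (N : forall z, Cmod z < 1 -> (1 - Cconj b * g z)%C <> 0).
{ intros z Hz E.
  assert (T := Cmod_triangle (1 - Cconj b * g z) (Cconj b * g z)).
  replace (1 - Cconj b * g z + Cconj b * g z)%C with (RtoC 1) in T by ring.
  rewrite E, Cmod_0, Cmod_1, Cmod_mult, Cmod_conj in T.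
  assert (G := Bg z Hz); generalize (Cmod_ge_0 (g z)); nra. }
set (G := fun z => ((g z - b) / (1 - Cconj b * g z))%C).
assert (Z0 : Cmod 0 < 1) by (rewrite Cmod_0; lra).
assert (GD : forall z, Cmod z < 1 -> cdiff G z).
{ intros z Hz; apply cdiff_div; [now apply N| |];
  (apply cdiff_minus; [|]); try apply cdiff_const; try apply cdiff_mult; try apply cdiff_const; now apply Hg. }
assert (G1 : forall z, Cmod z < 1 -> Cmod (G z) <= 1).
{ intros z Hz; unfold G; rewrite Cmod_div by now apply N.
  assert (P : 0 < Cmod (1 - Cconj b * g z)) by (apply Cmod_gt_0; now apply N).
  apply Rmult_le_reg_r with (Cmod (1 - Cconj b * g z)); [exact P|].
  unfold Rdiv; rewrite Rmult_assoc, Rinv_l, Rmult_1_l, Rmult_1_r by lra.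
  apply moebius_le_1; [lra|now apply Bg]. }
assert (G00 : G 0 = 0).
{ unfold G; fold b; unfold Cdiv; ring. }
assert (S : exists K d, 0 < d /\ forall z, Cmod z < d -> Cmod (G z) <= K * Cmod z ^ 1).
{ destruct (GD 0 Z0) as [q [Hq Eq]].
  destruct (proj1 (locally_CU _ _) (filter_and _ _ (Hq 1 Rlt_0_1) Eq)) as [d [Hd D]].
  exists (Cmod (q 0) + 1), d; split; [exact Hd|]; intros z Hz.
  destruct (D z) as [D1 D2]; [now replace (z - 0)%C with z by ring|].
  rewrite G00 in D2.
  replace (G z) with (q z * z)%C by (transitivity (G z - 0)%C; [rewrite D2; ring|ring]).
  rewrite Cmod_mult, pow_1; apply Rmult_le_compat_r; [apply Cmod_ge_0|].
  assert (T := Cmod_triangle (q 0) (q z - q 0)).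
  replace (q 0 + (q z - q 0))%C with (q z) in T by ring; lra. }
destruct S as [K [d [Hd S]]].
intros z Hz; assert (R0 := Cmod_ge_0 z).
assert (L := schwarz_lemma G 1 K d GD G1 Hd S z Hz).
rewrite pow_1 in L; unfold G in L; rewrite Cmod_div in L by now apply N.
assert (P : 0 < Cmod (1 - Cconj b * g z)) by (apply Cmod_gt_0; now apply N).
assert (L' : Cmod (g z - b) <= Cmod z * Cmod (1 - Cconj b * g z)).
{ replace (Cmod (g z - b)) with (Cmod (g z - b) / Cmod (1 - Cconj b * g z) * Cmod (1 - Cconj b * g z))
    by (field; lra).
  apply Rmult_le_compat_r; lra. }
apply schwarz_pick_algebra in L'; [|lra|lra|now apply Bg].
assert (a0 : 0 <= a) by lra.
apply Rmult_le_reg_r with (1 + a * Cmod z); [nra|].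
unfold Rdiv; rewrite Rmult_assoc, Rinv_l, Rmult_1_r by nra.
assert (Bz := Bg z Hz); assert (Gz := Cmod_ge_0 (g z)).
assert (0 <= (a - Cmod b) * (1 - Cmod z * Cmod (g z))) by (apply Rmult_le_pos; nra).
lra.
Qed.

Lemma mean_value g r : (forall z, Cmod z < 1 -> cdiff g z) -> 0 < r < 1 ->
  circle_int g r = ((2 * PI)%R * g 0)%C.
Proof.
intros Hg Hr; assert (Z : Cmod 0 < r) by (rewrite Cmod_0; lra).
rewrite <- (cauchy_disk g r 0 Hg Hr Z).
apply circle_int_ext; [lra|]; intros z Hz; simpl; field.
now apply (circle_neq r 0 Z z Hz).
Qed.

(** * Operator-valued functions on the disk *)

Section Hilbert.

Variable H : HilbertSpace.
Implicit Types x y u v : H.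

Lemma inner_plus_r x y u : inner H x (plus y u) = (inner H x y + inner H x u)%C.
Proof.
rewrite inner_conj, inner_plus_l, (inner_conj H x y), (inner_conj H x u).
destruct (inner H y x), (inner H u x); unfold Cconj, Cplus; simpl; f_equal; ring.
Qed.

Lemma inner_scal_r (c : C) x y : inner H x (scal c y) = (Cconj c * inner H x y)%C.
Proof.
rewrite inner_conj, inner_scal_l, (inner_conj H x y).
destruct (inner H y x), c; unfold Cconj, Cmult; simpl; f_equal; ring.
Qed.

Lemma norm_sq_plus x y : norm (plus x y) ^ 2 = norm x ^ 2 + norm y ^ 2 + 2 * fst (inner H x y).
Proof.
apply RtoC_inj; rewrite <- inner_norm, inner_plus_l, !inner_plus_r, !inner_norm, (inner_conj H x y).
destruct (inner H x y); unfold Cconj, Cplus, RtoC; simpl; f_equal; ring.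
Qed.

Lemma norm_sq_scal (c : C) x : norm (scal c x) ^ 2 = Cmod c ^ 2 * norm x ^ 2.
Proof.
apply RtoC_inj; rewrite <- inner_norm, inner_scal_l, inner_scal_r, inner_norm.
rewrite RtoC_mult, Cmod2_conj; ring.
Qed.

(** Expands the square of the norm of |y|^2 x - <x, y> y. *)
Lemma cauchy_schwarz x y : Cmod (inner H x y) <= norm x * norm y.
Proof.
assert (X0 := norm_ge_0 x); assert (Y0 := norm_ge_0 y).
set (c := inner H x y).
destruct (Req_dec (norm y) 0) as [Z|NZ].
{ assert (Ey : plus y y = y) by (rewrite (norm_eq_zero y Z); apply plus_zero_r).
  assert (E := inner_plus_r x y y); rewrite Ey in E; fold c in E.
  assert (E0 : c = 0) by (replace c with (c + c - c)%C by ring; rewrite <- E; ring).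
  rewrite E0, Cmod_0, Z; lra. }
assert (E : norm (plus (scal (RtoC (norm y ^ 2)) x) (scal (- c)%C y)) ^ 2
  = norm y ^ 2 * (norm x ^ 2 * norm y ^ 2 - Cmod c ^ 2)).
{ rewrite norm_sq_plus, !norm_sq_scal, Cmod_opp, Cmod_R, inner_scal_l, inner_scal_r; fold c.
  rewrite (Rabs_pos_eq (norm y ^ 2)) by apply pow2_ge_0.
  replace (fst (RtoC (norm y ^ 2) * (Cconj (- c) * c))%C) with (- (norm y ^ 2 * Cmod c ^ 2)).
  - ring.
  - rewrite Cmod2_alt; destruct c; simpl; ring. }
assert (P := pow2_ge_0 (norm (plus (scal (RtoC (norm y ^ 2)) x) (scal (- c)%C y)))).
rewrite E in P.
assert (Q : 0 < norm y ^ 2) by (apply pow_lt; lra).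
assert (D : 0 <= norm x ^ 2 * norm y ^ 2 - Cmod c ^ 2) by nra.
apply Rsqr_incr_0; [unfold Rsqr; nra|apply Cmod_ge_0|now apply Rmult_le_pos].
Qed.

Section OperatorFunction.

Variables (f : C -> Defs.bop H) (A : nat -> Defs.bop H) (a0 : C).
Hypothesis f_hol : holomorphic_on_disk f.
Hypothesis f_series : forall z, disk z -> is_pseries A z (f z).
Hypothesis A_0 : A 0%nat = scal a0 (bop_id H).
Hypothesis a0_lt_1 : Cmod a0 < 1.
Hypothesis f_bound : forall z, disk z -> norm (f z) <= 1.

Lemma f_apply_bound z x : Cmod z < 1 -> norm (f z x) <= norm x.
Proof.
intros Hz; eapply Rle_trans; [apply opnorm_bound|].
rewrite <- (Rmult_1_l (norm x)) at 2; apply Rmult_le_compat_r; [apply norm_ge_0|].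
now apply f_bound.
Qed.

Lemma matrix_coef_bound (T : Defs.bop H) x y :
  Cmod (inner H (T x) y) <= norm x * norm y * norm (T : bop_NormedModule H).
Proof.
eapply Rle_trans; [apply cauchy_schwarz|].
assert (B := opnorm_bound H T x); change (norm (T : bop_NormedModule H)) with (opnorm T).
generalize (norm_ge_0 y) (norm_ge_0 x); nra.
Qed.

Lemma matrix_coef_cdiff x y z : Cmod z < 1 -> cdiff (fun z => inner H (f z x) y) z.
Proof.
intros Hz.
apply (@cdiff_functional (bop_NormedModule H) f (fun T : Defs.bop H => inner H (T x) y) (norm x * norm y)).
- intros S T; exact (inner_plus_l H (S x) (T x) y).
- intros c T; exact (inner_scal_l H c (T x) y).
- intros T; apply matrix_coef_bound.
- now apply f_hol.
Qed.

Lemma matrix_coef_le x y z : Cmod z < 1 -> Cmod (inner H (f z x) y) <= norm x * norm y.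
Proof.
intros Hz; eapply Rle_trans; [apply cauchy_schwarz|].
apply Rmult_le_compat_r; [apply norm_ge_0|now apply f_apply_bound].
Qed.

(** The Cauchy coefficients of z |-> <f(z) x, y> and the numbers <A_n x, y> are coefficients
    of the same power series on the real axis. *)
Lemma matrix_coef_taylor x y r n : 0 < r < 1 ->
  circle_coef (fun z => inner H (f z x) y) r n = ((2 * PI)%R * inner H (A n x) y)%C.
Proof.
intros Hr; assert (P := PI_RGT_0).
assert (N : RtoC (2 * PI) <> 0) by (intros E; apply RtoC_inj in E; lra).
set (L := fun T : Defs.bop H => inner H (T x) y).
assert (T : taylor_coef (fun z => inner H (f z x) y) r n = inner H (A n x) y).
{ apply (taylor_coef_unique _ r (norm x * norm y)) with (c := fun n => inner H (A n x) y).
  - intros z Hz; now apply matrix_coef_cdiff.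
  - exact Hr.
  - intros z Hz; apply matrix_coef_le; lra.
  - intros t Ht.
    assert (S : is_series (fun k => scal (pow_n (RtoC t : C_AbsRing) k) (A k)) (f t)).
    { apply f_series; unfold disk; rewrite Cmod_R; lra. }
    assert (pw : forall k, pow_n (RtoC t : C_AbsRing) k = RtoC (t ^ k)).
    { induction k as [|k IH]; [reflexivity|]; simpl; rewrite IH, RtoC_mult; reflexivity. }
    assert (LS : forall k, L (scal (pow_n (RtoC t : C_AbsRing) k) (A k)) = (RtoC (t ^ k) * L (A k))%C).
    { intros k; rewrite pw; exact (inner_scal_l H _ (A k x) y). }
    assert (Lo : forall T, L (opp T) = (- L T)%C).
    { intros T; transitivity ((- (1)) * L T)%C; [|ring].
      exact (inner_scal_l H (- (1))%C (T x) y). }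
    split.
    + apply (is_series_ext (fun k => fst (L (scal (pow_n (RtoC t : C_AbsRing) k) (A k))))).
      { intros k; rewrite (LS k); transitivity (t ^ k * fst (L (A k))); [simpl; ring|].
        rewrite <- (pow_n_pow t k); reflexivity. }
      apply (@is_series_functional (bop_NormedModule H) _ (f t) (fun T : Defs.bop H => fst (L T)) (norm x * norm y)).
      * intros S1 S2; exact (f_equal fst (inner_plus_l H (S1 x) (S2 x) y)).
      * intros S1; exact (f_equal fst (Lo S1)).
      * intros S1; eapply Rle_trans; [eapply Rle_trans; [apply Rmax_l|apply Rmax_Cmod]|apply matrix_coef_bound].
      * exact S.
    + apply (is_series_ext (fun k => snd (L (scal (pow_n (RtoC t : C_AbsRing) k) (A k))))).
      { intros k; rewrite (LS k); transitivity (t ^ k * snd (L (A k))); [simpl; ring|].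
        rewrite <- (pow_n_pow t k); reflexivity. }
      apply (@is_series_functional (bop_NormedModule H) _ (f t) (fun T : Defs.bop H => snd (L T)) (norm x * norm y)).
      * intros S1 S2; exact (f_equal snd (inner_plus_l H (S1 x) (S2 x) y)).
      * intros S1; exact (f_equal snd (Lo S1)).
      * intros S1; eapply Rle_trans; [eapply Rle_trans; [apply Rmax_r|apply Rmax_Cmod]|apply matrix_coef_bound].
      * exact S. }
rewrite <- T; unfold taylor_coef; field; auto.
Qed.

Lemma inner_A0 x y : inner H (A 0%nat x) y = (a0 * inner H x y)%C.
Proof. rewrite A_0; exact (inner_scal_l H a0 x y). Qed.

Lemma matrix_coef_at_0 x y : inner H (f 0 x) y = (a0 * inner H x y)%C.
Proof.
assert (P := PI_RGT_0).
assert (N : RtoC (2 * PI) <> 0) by (intros E; apply RtoC_inj in E; lra).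
assert (M := mean_value (fun z => inner H (f z x) y) (1 / 2) (fun z Hz => matrix_coef_cdiff x y z Hz) ltac:(lra)).
assert (T := matrix_coef_taylor x y (1 / 2) 0 ltac:(lra)).
unfold circle_coef in T.
rewrite (circle_int_ext _ (fun z => inner H (f z x) y)) in T by (try lra; intros; simpl; ring).
rewrite M, inner_A0 in T.
replace (inner H (f 0 x) y) with ((2 * PI)%R * inner H (f 0 x) y / (2 * PI)%R)%C by (field; auto).
rewrite T; field; auto.
Qed.

(** The value |f(z) x| is the matrix coefficient of f(z) at x and y = f(z) x, divided by |y|;
    the scalar bound applies because the normalised coefficient has modulus at most |a0| at
    the centre. *)
Lemma operator_schwarz_pick z : Cmod z < 1 ->
  norm (f z) <= (Cmod a0 + Cmod z) / (1 + Cmod a0 * Cmod z).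
Proof.
intros Hz; assert (a00 := Cmod_ge_0 a0); assert (z0 := Cmod_ge_0 z).
set (M := (Cmod a0 + Cmod z) / (1 + Cmod a0 * Cmod z)).
assert (M0 : 0 <= M) by (apply Rdiv_le_0_compat; nra).
apply (opnorm_le H (f z) M M0); intros x.
set (y := f z x).
destruct (Req_dec (norm y) 0) as [Zy|Ny].
{ rewrite Zy; apply Rmult_le_pos; [exact M0|apply norm_ge_0]. }
assert (Py : 0 < norm y) by (generalize (norm_ge_0 y); lra).
assert (Px : 0 < norm x).
{ assert (B := f_apply_bound z x Hz); fold y in B; lra. }
set (c := RtoC (/ (norm x * norm y))).
assert (Pxy : 0 < norm x * norm y) by now apply Rmult_lt_0_compat.
assert (Hc : Cmod c = / (norm x * norm y)).
{ unfold c; rewrite Cmod_R; apply Rabs_pos_eq, Rlt_le; now apply Rinv_0_lt_compat. }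
assert (S := schwarz_pick (fun z => c * inner H (f z x) y)%C (Cmod a0)).
assert (B : Cmod (c * inner H (f z x) y) <= M).
{ apply S; auto.
  - intros w Hw; apply cdiff_mult; [apply cdiff_const|now apply matrix_coef_cdiff].
  - intros w Hw; rewrite Cmod_mult, Hc.
    rewrite <- (Rinv_l (norm x * norm y)) by lra.
    apply Rmult_le_compat_l; [apply Rlt_le; now apply Rinv_0_lt_compat|now apply matrix_coef_le].
  - rewrite matrix_coef_at_0, !Cmod_mult, Hc.
    assert (CS := cauchy_schwarz x y).
    rewrite <- (Rmult_1_r (Cmod a0)) at 2.
    rewrite <- (Rinv_l (norm x * norm y)) by lra.
    replace (/ (norm x * norm y) * (Cmod a0 * Cmod (inner H x y)))
      with (Cmod a0 * (/ (norm x * norm y) * Cmod (inner H x y))) by ring.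
    apply Rmult_le_compat_l; [exact a00|].
    apply Rmult_le_compat_l; [apply Rlt_le; now apply Rinv_0_lt_compat|exact CS]. }
fold y in B; rewrite Cmod_mult, Hc, inner_norm, Cmod_R in B.
rewrite Rabs_pos_eq in B by apply pow2_ge_0.
replace (norm y) with (/ (norm x * norm y) * norm y ^ 2 * norm x) by (field; lra).
apply Rmult_le_compat_r; lra.
Qed.

(** On |z| = r, the pairing of f(z) (x + z^n y) with u + conj(z^-n) v has the left-hand side
    as its mean. Since f(z) is a contraction it is at most half the sum of the squared norms
    of the two vectors, a trigonometric polynomial whose mean is the right-hand side. For
    r = 1 this expresses that the block matrix with rows (a0, 0) and (A_n, a0) is a
    contraction. *)
Lemma toeplitz_contraction n r x y u v : (1 <= n)%nat -> 0 < r < 1 ->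
  Cmod (a0 * inner H x u + inner H (A n x) v + a0 * inner H y v)
  <= (norm x ^ 2 + (r ^ n) ^ 2 * norm y ^ 2 + norm u ^ 2 + / (r ^ n) ^ 2 * norm v ^ 2) / 2.
Proof.
intros Hn Hr; assert (P := PI_RGT_0).
assert (rn : 0 < r ^ n) by (apply pow_lt; lra).
set (Q := fun z => (inner H (f z x) u + (z ^ n * inner H (f z y) u
   + (inner H (f z x) v * (/ z) ^ n + inner H (f z y) v)))%C).
set (a := (norm x ^ 2 + (r ^ n) ^ 2 * norm y ^ 2 + norm u ^ 2 + / (r ^ n) ^ 2 * norm v ^ 2) / 2).
assert (CM : forall p q z, Cmod z = r -> @ccont CU (fun z => inner H (f z p) q) z).
{ intros p q z Hz; apply cdiff_ccont, matrix_coef_cdiff; lra. }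
assert (C1 : forall z, Cmod z = r -> @ccont CU (fun z => z ^ n * inner H (f z y) u)%C z).
{ intros z Hz; apply (@ccont_mult CU); [apply (@ccont_pow CU), ccont_id|now apply CM]. }
assert (C2 : forall z, Cmod z = r -> @ccont CU (fun z => inner H (f z x) v * (/ z) ^ n)%C z).
{ intros z Hz; apply (@ccont_mult CU); [now apply CM|].
  apply (@ccont_pow CU), (@ccont_inv CU (fun z => z)); [|apply ccont_id].
  apply Cmod_gt_0; lra. }
assert (C3 : forall z, Cmod z = r -> @ccont CU (fun z => inner H (f z x) v * (/ z) ^ n + inner H (f z y) v)%C z).
{ intros z Hz; apply (@ccont_plus CU); [now apply C2|now apply CM]. }
assert (C4 : forall z, Cmod z = r -> @ccont CU (fun z => z ^ n * inner H (f z y) u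
   + (inner H (f z x) v * (/ z) ^ n + inner H (f z y) v))%C z).
{ intros z Hz; apply (@ccont_plus CU); [now apply C1|now apply C3]. }
assert (CQ : forall z, Cmod z = r -> @ccont CU Q z).
{ intros z Hz; apply (@ccont_plus CU); [now apply CM|now apply C4]. }
assert (IQ : circle_int Q r = ((2 * PI)%R * (a0 * inner H x u + inner H (A n x) v + a0 * inner H y v))%C).
{ unfold Q.
  rewrite circle_int_plus, circle_int_plus, circle_int_plus; try lra; auto.
  rewrite (mean_value (fun z => inner H (f z x) u)); auto; [|intros; now apply matrix_coef_cdiff].
  rewrite (mean_value (fun z => inner H (f z y) v)); auto; [|intros; now apply matrix_coef_cdiff].
  rewrite (mean_value (fun z => z ^ n * inner H (f z y) u)%C); auto.
  2:{ intros z Hz; apply cdiff_mult; [apply cdiff_pow, cdiff_id|now apply matrix_coef_cdiff]. }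
  assert (T := matrix_coef_taylor x v r n Hr); unfold circle_coef in T; rewrite T.
  rewrite !matrix_coef_at_0.
  (* The term in z^n has mean zero because it vanishes at 0. *)
  destruct n as [|n']; [lia|]; rewrite Cpow_S; ring. }
(* Half the sum of the squared norms is [a + Re W], where W has mean zero. *)
set (kap := (RtoC ((r ^ n) ^ 2) * inner H x y + inner H u v)%C).
set (W := fun t => (kap * (/ circle_pt r t) ^ n)%C).
assert (CW0 : ccont_on (fun t => (/ circle_pt r t) ^ n)%C 0 (2 * PI)).
{ intros t _; apply (@ccont_pow R_UniformSpace), (@ccont_inv R_UniformSpace);
  [apply circle_pt_neq0; lra|apply ccont_circle_pt]. }
assert (CW : ccont_on W 0 (2 * PI)).
{ intros t Ht; apply (@ccont_mult R_UniformSpace); [apply (@ccont_const R_UniformSpace)|now apply CW0]. }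
assert (IW : CRInt W 0 (2 * PI) = 0).
{ unfold W; rewrite CRInt_scal; [|lra|exact CW0].
  assert (E := circle_int_inv_pow r n ltac:(lra) Hn); unfold circle_int in E; rewrite E; ring. }
assert (EW := ex_RInt_Re W 0 (2 * PI) ltac:(lra) CW).
assert (EG : ex_RInt (fun t => a + fst (W t)) 0 (2 * PI)).
{ apply (@ex_RInt_plus R_NormedModule (fun _ => a) (fun t => fst (W t))); [apply ex_RInt_const|exact EW]. }
assert (IG : RInt (fun t => a + fst (W t)) 0 (2 * PI) = 2 * PI * a).
{ assert (E := @RInt_plus R_CompleteNormedModule (fun _ => a) (fun t => fst (W t)) 0 (2 * PI)
    (ex_RInt_const _ _ _) EW).
  change (RInt (fun t => a + fst (W t)) 0 (2 * PI)
    = RInt (fun _ => a) 0 (2 * PI) + RInt (fun t => fst (W t)) 0 (2 * PI)) in E.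
  rewrite E; change (RInt (fun t => fst (W t)) 0 (2 * PI)) with (fst (CRInt W 0 (2 * PI))).
  rewrite IW, (@RInt_const R_CompleteNormedModule); unfold scal; simpl; unfold mult; simpl; ring. }
apply Rmult_le_reg_l with (2 * PI); [lra|].
fold a; rewrite <- IG.
replace (2 * PI * Cmod (a0 * inner H x u + inner H (A n x) v + a0 * inner H y v))
  with (Cmod (circle_int Q r)).
2:{ rewrite IQ, Cmod_mult, Cmod_R, Rabs_pos_eq by lra; reflexivity. }
apply CRInt_bound; [lra|apply ccont_on_circle; [lra|exact CQ]|exact EG|].
intros t _; set (z := circle_pt r t).
assert (Hz : Cmod z = r) by (apply Cmod_circle_pt; lra).
assert (Nz : z <> 0) by (apply circle_pt_neq0; lra).
assert (Nzn : (z ^ n)%C <> 0) by now apply Cpow_nz.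
set (c := Cconj ((/ z) ^ n)%C).
assert (EQ : Q z = inner H (f z (plus x (scal (z ^ n)%C y))) (plus u (scal c v))).
{ destruct (bop_linear H (f z)) as [fp fs _].
  rewrite fp, fs, inner_plus_l, !inner_plus_r, !inner_scal_l, !inner_scal_r.
  unfold c, Q; rewrite Cconj_conj, Cpow_inv by exact Nz; field; exact Nzn. }
rewrite EQ.
eapply Rle_trans; [apply cauchy_schwarz|].
eapply Rle_trans; [apply Rmult_le_compat_r; [apply norm_ge_0|apply f_apply_bound; lra]|].
set (X := plus x (scal (z ^ n)%C y)); set (Y := plus u (scal c v)).
apply Rle_trans with ((norm X ^ 2 + norm Y ^ 2) / 2).
{ generalize (pow2_ge_0 (norm X - norm Y)); lra. }
right; unfold X, Y; rewrite !norm_sq_plus, !norm_sq_scal, !inner_scal_r.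
assert (Mc : Cmod c = / r ^ n).
{ unfold c; rewrite Cmod_conj, Cmod_pow, Cmod_inv, Hz, pow_inv by exact Nz; reflexivity. }
rewrite Mc, Cmod_pow, Hz.
assert (Ezn : Cconj (z ^ n) = (RtoC ((r ^ n) ^ 2) * (/ z) ^ n)%C).
{ rewrite Cpow_inv by exact Nz.
  replace (r ^ n) with (Cmod (z ^ n)%C) by (now rewrite Cmod_pow, Hz).
  rewrite Cmod2_conj; field; exact Nzn. }
unfold c; rewrite Cconj_conj, Ezn; unfold W, kap; fold z.
replace ((r ^ n * (r ^ n * 1))) with ((r ^ n) ^ 2) by ring.
set (s := (r ^ n) ^ 2) in *.
unfold a; rewrite pow_inv; fold s.
destruct ((/ z) ^ n)%C as [p1 p2], (inner H x y) as [q1 q2], (inner H u v) as [w1 w2].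
simpl; field; unfold s; apply pow_nonzero; lra.
Qed.

(** With w = A_n x and D = 1 - |a0|^2, the contraction is tested on y = (conj(a0) / D) w,
    chosen so that A_n x + a0 y = w / D, and paired with the image (a0 x, w / D) itself. The
    powers of r in y, v compensate for the radius, and r tends to 1. *)
Lemma coefficient_bound n : (1 <= n)%nat -> norm (A n) <= 1 - Cmod a0 ^ 2.
Proof.
intros Hn; assert (a00 := Cmod_ge_0 a0).
assert (D0 : 0 < 1 - Cmod a0 ^ 2) by nra.
apply (opnorm_le H (A n)); [lra|]; intros x.
apply (le_of_mul_pow_le _ _ 0 n); [apply norm_ge_0|lra|]; intros r Hr.
assert (rn : 0 < r ^ n) by (apply pow_lt; lra).
set (D := 1 - Cmod a0 ^ 2) in *.
set (w := A n x).
set (y := scal (Cconj a0 * RtoC (/ D))%C w).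
set (v := scal (RtoC (r ^ n * r ^ n * / D)) w).
assert (T := toeplitz_contraction n r x y (scal a0 x) v Hn ltac:(lra)).
fold w in T; unfold y, v in T.
rewrite !norm_sq_scal, !inner_scal_l, !inner_scal_r, !inner_norm in T.
assert (RC : forall t : R, Cconj (RtoC t) = RtoC t) by (intros t; unfold Cconj, RtoC; simpl; f_equal; ring).
rewrite !RC, !Cmod_mult, !Cmod_R, Cmod_conj in T.
set (X := norm x ^ 2) in *; set (W := norm w ^ 2) in *; set (s := r ^ n) in *.
assert (ID : 0 < / D) by now apply Rinv_0_lt_compat.
assert (X0 : 0 <= X) by apply pow2_ge_0.
assert (W0 : 0 <= W) by apply pow2_ge_0.
assert (E : (a0 * (Cconj a0 * X) + (s * s * / D)%R * W + a0 * (Cconj a0 * (/ D)%R * ((s * s * / D)%R * W)))%C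
   = RtoC (Cmod a0 ^ 2 * X + s * s * / D * W + Cmod a0 ^ 2 * / D * (s * s * / D * W))).
{ rewrite !RtoC_plus, !RtoC_mult, Cmod2_conj; ring. }
rewrite E, Cmod_R in T; clear E.
apply (Rle_trans _ _ _ (Rle_abs _)) in T.
rewrite !Rpow_mult_distr, !pow2_abs, !Rpow_mult_distr in T.
assert (al : Cmod a0 ^ 2 = 1 - D) by (unfold D; ring).
rewrite al in T.
apply Rsqr_incr_0; [|apply Rmult_le_pos; [apply norm_ge_0|lra]|apply Rmult_le_pos; [lra|apply norm_ge_0]].
replace (Rsqr (norm w * s)) with (W * s ^ 2) by (unfold W, Rsqr; ring).
replace (Rsqr (D * norm x)) with (D ^ 2 * X) by (unfold X, Rsqr; ring).
assert (E1 : (1 - D) * X + s * s * / D * W + (1 - D) * / D * (s * s * / D * W)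
  = (1 - D) * X + W * s ^ 2 * / D ^ 2) by (field; lra).
assert (E2 : (X + s ^ 2 * ((1 - D) * (/ D) ^ 2 * W) + (1 - D) * X +
     / s ^ 2 * (s ^ 2 * s ^ 2 * (/ D) ^ 2 * W)) / 2
  = (2 - D) / 2 * X + (2 - D) / 2 * (W * s ^ 2 * / D ^ 2)) by (field; lra).
rewrite E1, E2 in T.
replace (W * s ^ 2) with (D ^ 2 * (W * s ^ 2 * / D ^ 2)) by (field; lra).
apply Rmult_le_compat_l; [apply pow2_ge_0|].
apply Rmult_le_reg_l with D; lra.
Qed.

End OperatorFunction.

End Hilbert.

(** * The Bohr inequality *)

(** Concavity of s |-> s^(p/2) at s = 1, where s = y^2; this is where p <= 2 enters. It is
    the weighted arithmetic-geometric mean inequality for s and 1 with weights p/2 and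
    1 - p/2, proved from the tangent line of exp at m = p ln y. *)
Lemma rpow_le_linear y p : 0 <= y -> 0 < p <= 2 -> rpow y p <= 1 - p / 2 * (1 - y ^ 2).
Proof.
intros Hy Hp; unfold rpow; destruct (Req_dec_T y 0) as [->|N].
- simpl; lra.
- assert (P : 0 < y) by lra.
  unfold Rpower; set (m := p * ln y).
  assert (E2 : y ^ 2 = exp m * exp (2 * ln y - m)).
  { rewrite <- exp_plus; replace (m + (2 * ln y - m)) with (ln y + ln y) by ring.
    rewrite exp_plus, exp_ln by exact P; ring. }
  assert (E1 : 1 = exp m * exp (- m)) by (rewrite <- exp_plus, Rplus_opp_r, exp_0; reflexivity).
  assert (I1 := exp_ineq1_le (2 * ln y - m)); assert (I2 := exp_ineq1_le (- m)).
  assert (M := exp_pos m).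
  assert (J1 : exp m * (1 + (2 * ln y - m)) <= y ^ 2) by (rewrite E2; apply Rmult_le_compat_l; lra).
  assert (J2 : exp m * (1 + - m) <= 1) by (rewrite E1; apply Rmult_le_compat_l; lra).
  apply (Rmult_le_compat_l (p / 2)) in J1; [|lra].
  apply (Rmult_le_compat_l (1 - p / 2)) in J2; [|lra].
  assert (E : p / 2 * (exp m * (1 + (2 * ln y - m))) + (1 - p / 2) * (exp m * (1 + - m)) = exp m)
    by (unfold m; field).
  lra.
Qed.

(** From exp t >= 1 + t and ln y >= 1 - 1/y. *)
Lemma rpow_ge_linear y p : 0 < y -> 0 < p -> 1 - p * ((1 - y) / y) <= rpow y p.
Proof.
intros Hy Hp; unfold rpow; destruct (Req_dec_T y 0) as [E|_]; [lra|].
unfold Rpower.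
eapply Rle_trans; [|apply exp_ineq1_le].
assert (I := exp_ineq1_le (- ln y)).
rewrite exp_Ropp, exp_ln in I by exact Hy.
replace ((1 - y) / y) with (/ y - 1) by (field; lra).
assert (p * (1 - / y) <= p * ln y) by (apply Rmult_le_compat_l; lra).
lra.
Qed.

Lemma moebius_ratio_mono a s x : 0 <= a < 1 -> 0 <= s <= x ->
  (a + s) / (1 + a * s) <= (a + x) / (1 + a * x).
Proof.
intros Ha Hs.
assert (0 < 1 + a * s) by nra; assert (0 < 1 + a * x) by nra.
apply Rmult_le_reg_r with ((1 + a * s) * (1 + a * x)); [now apply Rmult_lt_0_compat|].
field_simplify; [|lra|lra].
assert (0 <= (1 - a ^ 2) * (x - s)) by (apply Rmult_le_pos; nra).
nra.
Qed.

(** The right-hand side equals (1 - a^2)(1 - x^2) / (1 + a x)^2, and 1 + a x <= 1 + x. *)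
Lemma defect_bound a x : 0 <= a < 1 -> 0 <= x <= 1 ->
  (1 - a ^ 2) * ((1 - x) / (1 + x)) <= 1 - ((a + x) / (1 + a * x)) ^ 2.
Proof.
intros Ha Hx.
assert (0 < 1 + a * x) by nra.
assert (E : 1 - ((a + x) / (1 + a * x)) ^ 2 = (1 - a ^ 2) * ((1 - x ^ 2) / (1 + a * x) ^ 2)) by (field; lra).
rewrite E; apply Rmult_le_compat_l; [nra|].
apply Rmult_le_reg_r with ((1 + x) * (1 + a * x) ^ 2).
{ apply Rmult_lt_0_compat; [lra|now apply pow_lt]. }
replace ((1 - x) / (1 + x) * ((1 + x) * (1 + a * x) ^ 2)) with ((1 - x) * (1 + a * x) ^ 2) by (field; lra).
replace ((1 - x ^ 2) / (1 + a * x) ^ 2 * ((1 + x) * (1 + a * x) ^ 2)) with ((1 - x) * (1 + x) ^ 2) by (field; lra).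
apply Rmult_le_compat_l; [lra|].
apply pow_incr; nra.
Qed.

Lemma class_F_ex_series phi r N : class_F phi -> unit_interval r ->
  ex_series (fun k => phi (N + k)%nat r).
Proof.
intros [_ [_ U]] Hr; destruct (U r Hr) as [d Hd].
destruct (CVU_CVS_dom _ _ Hd r) as [l Hl].
- split; [exact Hr|]; rewrite Rminus_diag, Rabs_R0; apply cond_pos.
- apply (ex_series_incr_n (fun k => phi k r) N); exists l; exact Hl.
Qed.

Lemma Series_nonneg (a : nat -> R) : (forall n, 0 <= a n) -> ex_series a -> 0 <= Series a.
Proof.
intros Ha Ea.
assert (Z : Series (fun n => 0 * a n) = 0) by (rewrite Series_scal_l; ring).
rewrite <- Z; apply Series_le; [|exact Ea].
intros n; rewrite Rmult_0_l; split; [lra|apply Ha].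
Qed.

Lemma partial_sum_le_Series (a : nat -> R) K : (forall n, 0 <= a n) -> ex_series a ->
  sum_n a K <= Series a.
Proof.
intros Ha Ea.
rewrite (Series_incr_n a (S K)) by (lia || exact Ea); simpl pred.
rewrite sum_n_Reals.
assert (0 <= Series (fun k => a (S K + k)%nat)); [|lra].
apply Series_nonneg; [intros; apply Ha|].
exact (proj1 (ex_series_incr_n a (S K)) Ea).
Qed.

Lemma Hinfty_norm_le_iff {V : NormedModule C_AbsRing} (f : C -> V) (M : R) :
  Rbar_le (Hinfty_norm f) M <-> forall z, disk z -> norm (f z) <= M.
Proof.
unfold Hinfty_norm.
destruct (Lub_Rbar_correct (fun y => exists z, disk z /\ y = norm (f z))) as [U L]; split.
- intros B z Hz.
  exact (Rbar_le_trans (norm (f z)) _ M (U _ (ex_intro _ z (conj Hz eq_refl))) B).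
- intros B; apply L; intros y [z [Hz ->]]; now apply B.
Qed.

(** Of the lost quantity (p/2)(1 - y^2) phi_0 it is shown that it exceeds the gained tail
    mu (1 - a^2) T: by the sharp estimates it is at least (1 - a^2)/2 times
    p (1 - x)/(1 + x) phi_0, which is at least 2 mu T within the radius. *)
Lemma bohr_inequality_holds (H : HilbertSpace) p m N mu phi RN :
  0 < p <= 2 -> (1 <= N)%nat ->
  (forall r, unit_interval r -> 0 <= mu r) -> class_F phi ->
  (forall r, unit_interval r -> r <= RN ->
     2 * mu r * tail N phi r <= p * ((1 - r ^ m) / (1 + r ^ m)) * phi 0%nat r) ->
  bohr_inequality_upto H p m N mu phi RN.
Proof.
intros Hp HN Hmu Hphi Hle w f A a0 Hw Hf Hs HA Ha0 Hb z Hz Hr.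
destruct Hf as [Hol _].
assert (Fb := proj1 (Hinfty_norm_le_iff f 1) Hb).
assert (Ur : unit_interval (Cmod z)) by (split; [apply Cmod_ge_0|exact Hz]).
unfold bohr_sum; set (r := Cmod z) in *.
specialize (Hle r Ur Hr).
set (x := r ^ m) in *.
assert (Hx : 0 <= x <= 1).
{ destruct Ur; split; [now apply pow_le|].
  rewrite <- (pow1 m); apply pow_incr; lra. }
assert (Wx : Cmod (w z) <= x) by (now apply schwarz_map_order_bound).
assert (Wd : Cmod (w z) < 1) by (destruct Hw as [[_ [D _]] _]; now apply D).
set (a := Cmod a0) in *.
assert (a1 : 0 <= a < 1) by (split; [apply Cmod_ge_0|exact Ha0]).
set (Y := (a + x) / (1 + a * x)).
assert (FY : norm (f (w z)) <= Y).
{ eapply Rle_trans.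
  - exact (operator_schwarz_pick H f A a0 Hol Hs HA Ha0 Fb (w z) Wd).
  - apply moebius_ratio_mono; [exact a1|split; [apply Cmod_ge_0|exact Wx]]. }
set (y := norm (f (w z))) in *.
assert (y0 : 0 <= y) by apply norm_ge_0.
assert (R1 := rpow_le_linear y p y0 Hp).
assert (yY : y ^ 2 <= Y ^ 2) by (apply pow_incr; lra).
assert (DB := defect_bound a x a1 Hx); fold Y in DB.
assert (P0 := proj1 (proj2 Hphi)).
assert (ph0 := P0 0%nat r Ur).
assert (mu0 := Hmu r Ur).
assert (EX := class_F_ex_series phi r N Hphi Ur).
assert (S1 : Series (fun k => norm (A (N + k)%nat) * phi (N + k)%nat r) <= (1 - a ^ 2) * tail N phi r).
{ unfold tail; rewrite <- Series_scal_l; apply Series_le.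
  - intros n; split.
    + apply Rmult_le_pos; [apply norm_ge_0|now apply P0].
    + apply Rmult_le_compat_r; [now apply P0|].
      apply (coefficient_bound H f A a0 Hol Hs HA Ha0 Fb); lia.
  - exact (@ex_series_scal_l R_AbsRing R_NormedModule (1 - a ^ 2) (fun k => phi (N + k)%nat r) EX). }
set (T := tail N phi r) in *.
set (Q := (1 - x) / (1 + x)) in *.
apply (Rmult_le_compat_l (mu r)) in S1; [|exact mu0].
apply (Rmult_le_compat_r (phi 0%nat r)) in R1; [|exact ph0].
assert (L1 : (1 - a ^ 2) * (2 * mu r * T) <= (1 - a ^ 2) * (p * Q * phi 0%nat r)).
{ apply Rmult_le_compat_l; [nra|exact Hle]. }
assert (L2 : p / 2 * phi 0%nat r * ((1 - a ^ 2) * Q) <= p / 2 * phi 0%nat r * (1 - Y ^ 2)).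
{ apply Rmult_le_compat_l; [apply Rmult_le_pos; lra|exact DB]. }
assert (L3 : p / 2 * phi 0%nat r * (1 - Y ^ 2) <= p / 2 * phi 0%nat r * (1 - y ^ 2)).
{ apply Rmult_le_compat_l; [apply Rmult_le_pos; lra|lra]. }
lra.
Qed.

(** * Sharpness of the radius *)

(** Turns Caratheodory's form back into a derivative, with values in any normed space. *)
Lemma ex_derive_scal_vector {V : NormedModule C_AbsRing} (c : C -> C) (v : V) (z : C) :
  cdiff c z -> @ex_derive C_AbsRing V (fun y => scal (c y) v) z.
Proof.
intros [q [Hq Eq]]; exists (scal (q z) v); split; [apply (@is_linear_scal_l C_AbsRing V)|].
intros x Hx; apply (@is_filter_lim_locally_unique C_AbsRing (AbsRing_NormedModule C_AbsRing) z x) in Hx.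
subst x; intros e.
assert (N0 := norm_ge_0 v).
assert (He : 0 < e / (norm v + 1)) by (apply Rdiv_lt_0_compat; [apply cond_pos|lra]).
generalize (filter_and _ _ (Hq _ He) Eq); apply filter_imp; intros y [H1 H2].
apply Rle_trans with (norm (scal ((q y - q z) * (y - z))%C v)).
- right; f_equal.
  assert (M : forall a b : C, minus (scal a v) (scal b v) = scal (a - b)%C v).
  { intros a b; unfold minus; rewrite <- (@scal_opp_l C_AbsRing V), <- (@scal_distr_r C_AbsRing V); reflexivity. }
  rewrite scal_assoc, !M; f_equal.
  change (mult (minus y z) (q z)) with ((y - z) * q z)%C.
  rewrite H2; ring.
- eapply Rle_trans; [apply @norm_scal|].
  change (Cmod ((q y - q z) * (y - z))%C * norm v <= e * Cmod (y - z)%C).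
  rewrite Cmod_mult.
  replace (Cmod (q y - q z) * Cmod (y - z) * norm v) with (Cmod (q y - q z) * norm v * Cmod (y - z)) by ring.
  apply Rmult_le_compat_r; [apply Cmod_ge_0|].
  apply Rle_trans with (e / (norm v + 1) * (norm v + 1)); [|right; field; lra].
  apply Rmult_le_compat; try lra; apply Cmod_ge_0.
Qed.

Lemma ex_derive_cdiff (c : C -> C) (z : C) : cdiff c z -> @ex_derive C_AbsRing C_NormedModule c z.
Proof.
intros Hc.
apply (@ex_derive_ext C_AbsRing C_NormedModule (fun y => scal (c y) (RtoC 1 : C_NormedModule))).
- intros t; change ((c t * 1)%C = c t); ring.
- now apply ex_derive_scal_vector.
Qed.

(** The iterated derivatives are those of t |-> t^m on the real axis. *)
Lemma pow_schwarz_map_of_order m : (1 <= m)%nat -> schwarz_map_of_order m (fun z => z ^ m)%C.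
Proof.
intros Hm; split; [split; [|split]|split].
- intros z _; apply ex_derive_cdiff, cdiff_pow, cdiff_id.
- intros z Hz; unfold disk in *; rewrite Cmod_pow.
  apply pow_lt_1_compat; [split; [apply Cmod_ge_0|exact Hz]|lia].
- destruct m as [|m]; [lia|]; rewrite Cpow_S; ring.
- intros j Hj; rewrite (C_derive_n_real (fun z => z ^ m)%C j 0).
  rewrite (Derive_n_ext _ (fun t => t ^ m)) by (intros t; rewrite <- RtoC_pow; reflexivity).
  rewrite (Derive_n_ext (fun t => snd (RtoC t ^ m)%C) (fun _ => 0)) by (intros t; rewrite <- RtoC_pow; reflexivity).
  rewrite Derive_n_pow_smalli by lia.
  rewrite pow_i by lia.
  rewrite Rmult_0_r; unfold RtoC; f_equal.
  destruct j; [reflexivity|apply Derive_n_const].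
- rewrite (C_derive_n_real (fun z => z ^ m)%C m 0); intros E; apply (f_equal fst) in E; simpl in E.
  rewrite (Derive_n_ext _ (fun t => t ^ m)) in E by (intros t; rewrite <- RtoC_pow; reflexivity).
  rewrite Derive_n_pow_smalli, Nat.sub_diag in E by lia; simpl in E.
  assert (F := INR_fact_neq_0 m).
  rewrite Rmult_1_r, Rdiv_1_r in E; auto.
Qed.

(** The extremal function (a + z) / (1 + a z) I and its coefficients a, (1 - a^2) (-a)^(n-1). *)
Section Extremal.

Variables (H : HilbertSpace) (a : R).
Hypothesis a_bounds : 0 < a < 1.

Definition moebius (z : C) : C := ((a + z) / (1 + a * z))%C.

Definition moebius_coef (n : nat) : C :=
  match n with
  | O => RtoC a
  | S k => (RtoC (1 - a ^ 2) * RtoC (- a) ^ k)%C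
  end.

Definition scalar_op (c : C) : Defs.bop H := bop_scal H c (bop_id H).

Lemma norm_scalar_op_le (c : C) : norm (scalar_op c : bop_NormedModule H) <= Cmod c.
Proof.
apply (opnorm_le H (scalar_op c)); [apply Cmod_ge_0|]; intros x; apply @norm_scal.
Qed.

Lemma norm_scalar_op (c : C) : (exists x : H, x <> zero) ->
  norm (scalar_op c : bop_NormedModule H) = Cmod c.
Proof.
intros [x Hx]; apply Rle_antisym; [apply norm_scalar_op_le|].
assert (P : 0 < norm x).
{ destruct (norm_ge_0 x) as [L|E]; [exact L|]; elim Hx; exact (@norm_eq_zero C_AbsRing H x (eq_sym E)). }
apply Rmult_le_reg_r with (norm x); [exact P|].
apply Rle_trans with (norm (scal c x)); [|exact (opnorm_bound H (scalar_op c) x)].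
right; rewrite <- (Rabs_pos_eq (Cmod c * norm x)), <- (Rabs_pos_eq (norm (scal c x)));
  [|apply norm_ge_0|apply Rmult_le_pos; [apply Cmod_ge_0|apply norm_ge_0]].
apply Rsqr_eq_abs_0; unfold Rsqr.
generalize (norm_sq_scal H c x); lra.
Qed.

Lemma moebius_den z : Cmod z < 1 -> (1 + a * z)%C <> 0.
Proof.
intros Hz E.
assert (T := Cmod_triangle (1 + a * z) (- (a * z))).
replace (1 + a * z + - (a * z))%C with (RtoC 1) in T by ring.
rewrite E, Cmod_0, Cmod_1, Cmod_opp, Cmod_mult, Cmod_R, Rabs_pos_eq in T by lra.
generalize (Cmod_ge_0 z); nra.
Qed.

Lemma moebius_bound z : Cmod z < 1 -> Cmod (moebius z) <= 1.
Proof.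
intros Hz; assert (N := moebius_den z Hz); unfold moebius; rewrite Cmod_div by exact N.
assert (P : 0 < Cmod (1 + a * z)) by now apply Cmod_gt_0.
apply Rmult_le_reg_r with (Cmod (1 + a * z)); [exact P|].
unfold Rdiv; rewrite Rmult_assoc, Rinv_l, Rmult_1_r, Rmult_1_l by lra.
assert (B := moebius_le_1 (RtoC (- a)) z).
replace (z - (- a)%R)%C with (a + z)%C in B by (rewrite RtoC_opp; ring).
replace (1 - Cconj (- a)%R * z)%C with (1 + a * z)%C in B.
- apply B; [|lra]; rewrite Cmod_R, Rabs_Ropp, Rabs_pos_eq; lra.
- replace (Cconj (- a)%R) with (RtoC (- a)) by (unfold Cconj, RtoC; simpl; f_equal; ring).
  rewrite RtoC_opp; ring.
Qed.

(** The partial sums are geometric, so the remainder is explicit. *)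
Lemma moebius_partial_sum z n : Cmod z < 1 ->
  (sum_n (fun k => z ^ k * moebius_coef k)%C n - moebius z
   = - ((1 - a ^ 2)%R * z / (1 + a * z)) * ((- a)%R * z) ^ n)%C.
Proof.
intros Hz; assert (N := moebius_den z Hz).
induction n as [|n IH].
- rewrite sum_O; unfold moebius; simpl moebius_coef; simpl Cpow.
  rewrite RtoC_minus, RtoC_pow; field; exact N.
- rewrite sum_Sn.
  replace (plus (sum_n (fun k => z ^ k * moebius_coef k)%C n) (z ^ S n * moebius_coef (S n))%C - moebius z)%C
    with ((sum_n (fun k => z ^ k * moebius_coef k)%C n - moebius z) + z ^ S n * moebius_coef (S n))%C
    by (unfold plus; simpl; ring).
  rewrite IH; change (moebius_coef (S n)) with ((1 - a ^ 2)%R * (- a)%R ^ n)%C.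
  rewrite !Cpow_S, !Cpow_mult_l, RtoC_opp; field; exact N.
Qed.

Lemma moebius_pseries z : Cmod z < 1 ->
  @is_pseries C_AbsRing (bop_NormedModule H) (fun n => scalar_op (moebius_coef n)) z (scalar_op (moebius z)).
Proof.
intros Hz; apply (filterlim_locally_ball_norm (U := bop_NormedModule H)); intros e.
assert (N := moebius_den z Hz).
set (K := Cmod ((1 - a ^ 2)%R * z / (1 + a * z))).
assert (K0 : 0 <= K) by apply Cmod_ge_0.
assert (Hq : 0 <= a * Cmod z < 1) by (generalize (Cmod_ge_0 z); nra).
assert (He : 0 < e / 2) by (generalize (cond_pos e); lra).
destruct (geometric_small _ K _ Hq K0 He) as [n0 Hn0].
exists n0; intros n Hn; unfold ball_norm.
assert (pw : forall k, pow_n (z : C_AbsRing) k = (z ^ k)%C).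
{ induction k as [|k IH]; [reflexivity|]; simpl; rewrite IH; reflexivity. }
assert (E : @sum_n (bop_NormedModule H) (fun k => scal (pow_n (z : C_AbsRing) k) (scalar_op (moebius_coef k))) n
  = scalar_op (sum_n (fun k => z ^ k * moebius_coef k)%C n)).
{ clear Hn; induction n as [|n IH].
  - rewrite !sum_O, pw; apply (@scal_assoc C_AbsRing (bop_ModuleSpace H)).
  - rewrite !sum_Sn, IH, pw.
    transitivity (plus (scalar_op (sum_n (fun k => z ^ k * moebius_coef k)%C n))
       (scalar_op (z ^ S n * moebius_coef (S n))%C)).
    + f_equal; apply (@scal_assoc C_AbsRing (bop_ModuleSpace H)).
    + symmetry; apply (@scal_distr_r C_AbsRing (bop_ModuleSpace H)). }
match goal with |- norm (minus ?s _) < _ => change s with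
  (@sum_n (bop_NormedModule H) (fun k => scal (pow_n (z : C_AbsRing) k) (scalar_op (moebius_coef k))) n) end.
rewrite E.
apply Rle_lt_trans with (norm (scalar_op (sum_n (fun k => z ^ k * moebius_coef k)%C n - moebius z)%C : bop_NormedModule H)).
- right; f_equal; unfold scalar_op, minus; symmetry.
  transitivity (plus (bop_scal H (sum_n (fun k => z ^ k * moebius_coef k)%C n) (bop_id H))
    (bop_scal H (opp (moebius z)) (bop_id H))).
  + apply (@scal_distr_r C_AbsRing (bop_ModuleSpace H)).
  + f_equal; apply (@scal_opp_l C_AbsRing (bop_ModuleSpace H)).
- eapply Rle_lt_trans; [apply norm_scalar_op_le|].
  rewrite moebius_partial_sum, Cmod_mult, Cmod_opp, Cmod_pow, Cmod_mult, Cmod_R by exact Hz; fold K.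
  rewrite Rabs_Ropp, Rabs_pos_eq by lra.
  apply Rle_lt_trans with (K * (a * Cmod z) ^ n0); [|generalize (cond_pos e); lra].
  apply Rmult_le_compat_l; [exact K0|].
  replace n with (n0 + (n - n0))%nat by lia; rewrite pow_add.
  rewrite <- (Rmult_1_r ((a * Cmod z) ^ n0)) at 2.
  apply Rmult_le_compat_l; [apply pow_le; lra|].
  rewrite <- (pow1 (n - n0)); apply pow_incr; lra.
Qed.

Lemma moebius_holomorphic : @holomorphic_on_disk (bop_NormedModule H) (fun z => scalar_op (moebius z)).
Proof.
intros z Hz; apply (@ex_derive_scal_vector (bop_NormedModule H) moebius (bop_id H)).
unfold moebius; apply cdiff_div; [now apply moebius_den| |];
(apply cdiff_plus; [apply cdiff_const|]); [apply cdiff_id|].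
apply cdiff_mult; [apply cdiff_const|apply cdiff_id].
Qed.

Lemma Cmod_moebius_coef k : Cmod (moebius_coef (S k)) = (1 - a ^ 2) * a ^ k.
Proof.
simpl moebius_coef; rewrite Cmod_mult, Cmod_pow, !Cmod_R, Rabs_Ropp, !Rabs_pos_eq by nra; reflexivity.
Qed.

Lemma bohr_inequality_extremal p m N mu phi rho r :
  (exists x : H, x <> zero) -> (1 <= m)%nat ->
  bohr_inequality_upto H p m N mu phi rho -> 0 <= r < 1 -> r <= rho ->
  rpow ((a + r ^ m) / (1 + a * r ^ m)) p * phi 0%nat r
  + mu r * Series (fun k => Cmod (moebius_coef (N + k)) * phi (N + k)%nat r) <= phi 0%nat r.
Proof.
intros Hx Hm B Hr Hrho.
assert (Mr : Cmod (RtoC r) = r) by (rewrite Cmod_R; apply Rabs_pos_eq; lra).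
assert (B' := B (fun z => z ^ m)%C (fun z => scalar_op (moebius z)) (fun n => scalar_op (moebius_coef n)) (RtoC a)
  (pow_schwarz_map_of_order m Hm)).
assert (HF : Hinfty (V := bop_NormedModule H) (fun z => scalar_op (moebius z))).
{ split; [exact moebius_holomorphic|exists 1; intros z Hz].
  eapply Rle_trans; [apply norm_scalar_op_le|now apply moebius_bound]. }
specialize (B' HF).
specialize (B' (fun z Hz => moebius_pseries z Hz) eq_refl).
assert (Ha : Cmod (RtoC a) < 1) by (rewrite Cmod_R, Rabs_pos_eq; lra).
specialize (B' Ha).
assert (HN : Rbar_le (Hinfty_norm (V := bop_NormedModule H) (fun z => scalar_op (moebius z))) 1).
{ apply (Hinfty_norm_le_iff (V := bop_NormedModule H)); intros z Hz.
  eapply Rle_trans; [apply norm_scalar_op_le|now apply moebius_bound]. }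
specialize (B' HN (RtoC r)).
unfold disk in B'; rewrite Mr in B'; specialize (B' (proj2 Hr) Hrho).
unfold bohr_sum in B'; rewrite Mr in B'.
rewrite (norm_scalar_op _ Hx) in B'.
assert (rm : 0 <= r ^ m) by (apply pow_le; lra).
assert (Em : Cmod (moebius (RtoC r ^ m)%C) = (a + r ^ m) / (1 + a * r ^ m)).
{ unfold moebius; rewrite <- RtoC_pow.
  rewrite <- RtoC_mult, <- !RtoC_plus, <- RtoC_div by nra.
  rewrite Cmod_R; apply Rabs_pos_eq, Rdiv_le_0_compat; nra. }
rewrite Em in B'.
rewrite (Series_ext _ (fun k => Cmod (moebius_coef (N + k)) * phi (N + k)%nat r)) in B'
  by (intros k; now rewrite (norm_scalar_op _ Hx)).
exact B'.
Qed.

End Extremal.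

Lemma positive_left_of_one (F : R -> R) : continuous F 1 -> 0 < F 1 -> exists a, 0 < a < 1 /\ 0 < F a.
Proof.
intros HF P.
assert (L := proj1 (filterlim_locally F (F 1)) HF (mkposreal _ P)).
destruct L as [d Hd].
set (t := Rmin (d / 2) (1 / 2)).
assert (D := cond_pos d).
assert (t0 : 0 < t) by (apply Rmin_glb_lt; lra).
assert (t1 : t <= d / 2) by apply Rmin_l.
assert (t2 : t <= 1 / 2) by apply Rmin_r.
exists (1 - t); split; [lra|].
assert (B : Rabs (F (1 - t) - F 1) < F 1).
{ apply (Hd (1 - t)); change (Rabs (1 - t - 1) < d).
  rewrite Rabs_left; lra. }
apply Rabs_lt_between in B; lra.
Qed.

(** Keep only finitely many terms of the tail and bound a^(N+k-1) below by a^(N+K). Then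
    1 - a factors out of the excess of the extremal Bohr sum over phi_0(r), and the other
    factor is continuous in a and positive at a = 1. *)
Lemma bohr_inequality_fails (H : HilbertSpace) p m N mu phi rho r :
  (exists x : H, x <> zero) -> 0 < p -> (1 <= m)%nat -> (1 <= N)%nat ->
  0 < r < 1 -> r <= rho -> 0 <= mu r -> class_F phi ->
  p * ((1 - r ^ m) / (1 + r ^ m)) * phi 0%nat r < 2 * mu r * tail N phi r ->
  ~ bohr_inequality_upto H p m N mu phi rho.
Proof.
intros Hx Hp Hm HN Hr Hrho Hmu Hphi Hlt B.
assert (Ur : unit_interval r) by (unfold unit_interval; lra).
assert (EX := class_F_ex_series phi r N Hphi Ur).
assert (P0 := fun n => proj1 (proj2 Hphi) n r Ur).
set (x := r ^ m) in *.
assert (x0 : 0 < x) by (apply pow_lt; lra).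
assert (x1 : x < 1) by (apply pow_lt_1_compat; [lra|lia]).
set (Q := p * ((1 - x) / (1 + x)) * phi 0%nat r) in *.
assert (K : exists K, Q < 2 * mu r * sum_n (fun k => phi (N + k)%nat r) K).
{ assert (L := Series_correct _ EX); fold (tail N phi r) in L.
  assert (L2 : is_lim_seq (fun n => 2 * mu r * sum_n (fun k => phi (N + k)%nat r) n) (2 * mu r * tail N phi r)).
  { apply (is_lim_seq_scal_l _ (2 * mu r) (tail N phi r)); exact L. }
  assert (Hgap : 0 < 2 * mu r * tail N phi r - Q) by lra.
  destruct (proj2 (is_lim_seq_spec _ _) L2 (mkposreal _ Hgap)) as [K HK].
  exists K; specialize (HK K (le_n K)); simpl in HK; apply Rabs_lt_between in HK; lra. }
destruct K as [K HK].
set (S := sum_n (fun k => phi (N + k)%nat r) K) in *.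
set (n := (N + K)%nat).
(* The cofactor of (1 - a) / (a + x) in the lower bound for the excess. *)
destruct (positive_left_of_one (fun a => (1 + a) * a ^ n * (a + x) * (mu r * S) - p * (1 - x) * phi 0%nat r)) as [a [Ha HFa]].
{ apply (@ex_derive_continuous R_AbsRing R_NormedModule); auto_derive; auto. }
{ rewrite pow1.
  assert (E : (1 + 1) * 1 * (1 + x) * (mu r * S) - p * (1 - x) * phi 0%nat r
    = (1 + x) * (2 * mu r * S - Q)) by (unfold Q; field; lra).
  rewrite E; apply Rmult_lt_0_compat; lra. }
assert (I := bohr_inequality_extremal H a Ha p m N mu phi rho r Hx Hm B ltac:(lra) Hrho).
fold x in I.
set (y := (a + x) / (1 + a * x)) in *.
assert (ax : 0 < a * x) by (apply Rmult_lt_0_compat; lra).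
assert (y0 : 0 < y) by (apply Rdiv_lt_0_compat; lra).
assert (R1 := rpow_ge_linear y p y0 Hp).
assert (Ey : (1 - y) / y = (1 - a) * (1 - x) / (a + x)) by (unfold y; field; lra).
rewrite Ey in R1.
apply (Rmult_le_compat_r (phi 0%nat r)) in R1; [|apply P0].
assert (D0 : 0 < 1 - a ^ 2) by nra.
assert (C1 : forall k, Cmod (moebius_coef a (N + k)) = (1 - a ^ 2) * a ^ (N + k - 1)).
{ intros k; replace (N + k)%nat with (Datatypes.S (N + k - 1)) at 1 by lia.
  now apply Cmod_moebius_coef. }
assert (pwle : forall i j, (i <= j)%nat -> a ^ j <= a ^ i).
{ intros i j Hij; replace j with (i + (j - i))%nat by lia; rewrite pow_add.
  rewrite <- (Rmult_1_r (a ^ i)) at 2; apply Rmult_le_compat_l; [apply pow_le; lra|].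
  rewrite <- (pow1 (j - i)); apply pow_incr; lra. }
assert (an : forall i, 0 < a ^ i) by (intros; apply pow_lt; lra).
assert (T : (1 - a ^ 2) * a ^ n * S <= Series (fun k => Cmod (moebius_coef a (N + k)) * phi (N + k)%nat r)).
{ eapply Rle_trans; [|apply (partial_sum_le_Series _ K)].
  - unfold S; rewrite !sum_n_Reals, scal_sum; apply sum_Rle; intros k Hk.
    rewrite Rmult_comm; rewrite C1; apply Rmult_le_compat_r; [apply P0|].
    apply Rmult_le_compat_l; [lra|]; apply pwle; unfold n; lia.
  - intros k; rewrite C1; apply Rmult_le_pos; [|apply P0].
    apply Rmult_le_pos; [lra|apply Rlt_le, an].
  - apply (@ex_series_le R_AbsRing R_CompleteNormedModule _ (fun k => phi (N + k)%nat r)); [|exact EX].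
    intros k; change (Rabs (Cmod (moebius_coef a (N + k)) * phi (N + k)%nat r) <= phi (N + k)%nat r).
    rewrite Rabs_pos_eq.
    + rewrite <- (Rmult_1_l (phi (N + k)%nat r)) at 2.
      apply Rmult_le_compat_r; [apply P0|]; rewrite C1.
      assert (L := pwle 0%nat (N + k - 1)%nat ltac:(lia)); simpl in L.
      specialize (an (N + k - 1)%nat); nra.
    + apply Rmult_le_pos; [apply Cmod_ge_0|apply P0]. }
apply (Rmult_le_compat_l (mu r)) in T; [|exact Hmu].
assert (F : 0 < (1 - a) / (a + x) * ((1 + a) * a ^ n * (a + x) * (mu r * S) - p * (1 - x) * phi 0%nat r)).
{ apply Rmult_lt_0_compat; [apply Rdiv_lt_0_compat; lra|exact HFa]. }
replace ((1 - a) / (a + x) * ((1 + a) * a ^ n * (a + x) * (mu r * S) - p * (1 - x) * phi 0%nat r))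
  with (mu r * ((1 - a ^ 2) * a ^ n * S) - p * ((1 - a) * (1 - x) / (a + x)) * phi 0%nat r) in F
  by (field; lra).
lra.
Qed.

(** * The Bohr radius *)

Theorem theorem2p5 (H : HilbertSpace) (p : R) (m N : nat) (mu : R -> R)
    (phi : nat -> R -> R) (RN : R)
    (hp : 0 < p <= 2)
    (hN : (1 <= N)%nat)
    (hmu_cont : continuous_on unit_interval mu)
    (hmu_pos : forall r, unit_interval r -> 0 <= mu r)
    (hphi : class_F phi)
    (hroot : is_minimal_positive_root
       (fun r => p * ((1 - r ^ m) / (1 + r ^ m)) * phi 0%nat r
                 - 2 * mu r * tail N phi r) RN)
    (hbelow : forall r, 0 <= r < RN ->
       p * ((1 - r ^ m) / (1 + r ^ m)) * phi 0%nat r > 2 * mu r * tail N phi r) :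
  bohr_inequality_upto H p m N mu phi RN /\
  ((exists x : H, x <> zero) ->
   (exists eps : R, 0 < eps /\ RN + eps <= 1 /\
      forall r, RN < r < RN + eps ->
        p * ((1 - r ^ m) / (1 + r ^ m)) * phi 0%nat r < 2 * mu r * tail N phi r) ->
   forall rho : R, RN < rho -> ~ bohr_inequality_upto H p m N mu phi rho).
Proof.
destruct hroot as [[hR root] _].
split.
- apply bohr_inequality_holds; auto.
  intros r Hr Hle; destruct (Rle_lt_or_eq_dec r RN Hle) as [L|E].
  + left; apply hbelow; destruct Hr; lra.
  + rewrite E; lra.
- intros Hx [eps [Heps [Heps1 Habove]]] rho Hrho.
  (* For m = 0 the left-hand side vanishes identically, which contradicts the strict
     inequality at r = 0. *)
  assert (Hm : (1 <= m)%nat).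
  { destruct m as [|m']; [exfalso|lia].
    assert (U0 : unit_interval 0) by (unfold unit_interval; lra).
    assert (B := hbelow 0 ltac:(lra)); simpl in B.
    assert (T : 0 <= tail N phi 0).
    { apply Series_nonneg; [intros; now apply hphi|now apply class_F_ex_series]. }
    assert (M := hmu_pos 0 U0).
    assert (0 <= mu 0 * tail N phi 0) by now apply Rmult_le_pos.
    unfold Rdiv in B; rewrite Rminus_diag in B; lra. }
  set (d := Rmin eps (rho - RN)).
  assert (d0 : 0 < d) by (apply Rmin_glb_lt; lra).
  assert (d1 : d <= eps) by apply Rmin_l.
  assert (d2 : d <= rho - RN) by apply Rmin_r.
  apply (bohr_inequality_fails H p m N mu phi rho (RN + d / 2)); auto; try lra.
  + apply hmu_pos; unfold unit_interval; lra.
  + apply Habove; lra.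
Qed.
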